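(* For every $K\ge1$ there exist constants $C_i,C_i'>0$ ($i=1,2,\dots$) depending only on $K$ such that the following holds. Let $d\ge2$, let $\boldsymbol{\mathcal X}\in\mathbb{R}^{n_1\times\cdots\times n_d}$ be a tensor, let $(r_1,\dots,r_d)$ with $1\le r_i\le n_i$ be the target rank, and let $\hat{\boldsymbol{\mathcal X}}$ be the approximation of $\boldsymbol{\mathcal X}$ generated either by the algorithm RHOSVD-KRP or by its memoized version RHOSVD-KRP-MEMO (both described in the context) with sketch sizes $\ell_1,\dots,\ell_d$. Let $0<\delta\le\min\{1,2de^{-2}\}$. If $\ell_i\ge C_i^d\ln^d(2d\cdot9^{r_i}/\delta)$ for $1\le i\le d$, then with probability at least $1-\delta$, $$\|\boldsymbol{\mathcal X}-\hat{\boldsymbol{\mathcal X}}\|_F^2\le\sum_{i=1}^d\bigl(1+2(1+\Gamma_i)\bigr)\sum_{j=r_i+1}^{n_i}\sigma_j^2(\boldsymbol X_{(i)}),$$ where $$\Gamma_i=(C_i')^d\max\left\{\frac{\ln^{1/2}(2d/\delta)}{\ell_i^{1/2}},\frac{\ln^d(2d/\delta)}{\ell_i}\right\},\qquad 1\le i\le d.$$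
   Context: Notation. $\boldsymbol X_{(i)}\in\mathbb{R}^{n_i\times\prod_{j\ne i}n_j}$ is the mode-$i$ unfolding of $\boldsymbol{\mathcal X}$ (its columns are the mode-$i$ fibers, ordered compatibly with the Kronecker ordering used in the algorithms, i.e. lower modes vary fastest). $\sigma_j(\cdot)$ is the $j$-th largest singular value, taken to be $0$ if $j$ exceeds the number of singular values. The mode-$i$ product $\boldsymbol{\mathcal Y}=\boldsymbol{\mathcal X}\times_i\boldsymbol A$ is defined by $\boldsymbol Y_{(i)}=\boldsymbol A\boldsymbol X_{(i)}$. $\|\boldsymbol{\mathcal X}\|_F$ is the square root of the sum of squares of the entries. The Khatri-Rao product $\odot$ is the columnwise Kronecker product: the $k$-th column of $\boldsymbol A\odot\boldsymbol B$ is $\boldsymbol a_k\otimes\boldsymbol b_k$. The sub-Gaussian norm of a random variable $X$ is $\|X\|_{\Psi_2}=\inf\{t>0:\mathbb{E}\exp(|X|^2/t^2)\le2\}$. In a thin QR factorization $\boldsymbol Y=\boldsymbol Q\boldsymbol R$ of $\boldsymbol Y\in\mathbb{R}^{a\times b}$, $\boldsymbol Q$ has $\min\{a,b\}$ orthonormal columns, and its range contains the range of $\boldsymbol Y$. Algorithm RHOSVD-KRP (sketch sizes $\ell_i=r_i+p$ with oversampling parameter $p\ge 0$). For $i=1,\dots,d$: draw a fresh family (independent of those drawn for other $i$) of $d-1$ independent random matrices $\boldsymbol\Omega^{(j)}\in\mathbb{R}^{n_j\times\ell_i}$, $j\ne i$, with independent, mean zero, unit variance sub-Gaussian entries of sub-Gaussian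 norm at most $K$; compute $$\boldsymbol Y_{(i)}=\boldsymbol X_{(i)}\bigl(\boldsymbol\Omega^{(d)}\odot\cdots\odot\boldsymbol\Omega^{(i+1)}\odot\boldsymbol\Omega^{(i-1)}\odot\cdots\odot\boldsymbol\Omega^{(1)}\bigr);$$ compute a thin QR factorization $\boldsymbol Y_{(i)}=\boldsymbol Q_i\boldsymbol R_i$. Then form the core $\boldsymbol{\mathcal G}=\boldsymbol{\mathcal X}\times_1\boldsymbol Q_1^\top\times_2\cdots\times_d\boldsymbol Q_d^\top$ and output $\hat{\boldsymbol{\mathcal X}}=\boldsymbol{\mathcal G}\times_1\boldsymbol Q_1\times_2\cdots\times_d\boldsymbol Q_d$. Algorithm RHOSVD-KRP-MEMO. A single family of independent random matrices $\boldsymbol\Omega^{(j)}\in\mathbb{R}^{n_j\times\ell}$, $j=1,\dots,d$, with a common number of columns $\ell=\ell_1=\cdots=\ell_d$ and with independent, mean zero, unit variance sub-Gaussian entries of sub-Gaussian norm at most $K$, is drawn once. For every mode $i=1,\dots,d$, these same matrices are used to form $$\boldsymbol Y_{(i)}=\boldsymbol X_{(i)}\bigl(\boldsymbol\Omega^{(d)}\odot\cdots\odot\boldsymbol\Omega^{(i+1)}\odot\boldsymbol\Omega^{(i-1)}\odot\cdots\odot\boldsymbol\Omega^{(1)}\bigr),$$ and a thin QR factorization $\boldsymbol Y_{(i)}=\boldsymbol Q_i\boldsymbol R_i$ is computed. Then form the core $\boldsymbol{\mathcal G}=\boldsymbol{\mathcal X}\times_1\boldsymbol Q_1^\top\times_2\cdots\times_d\boldsymbol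 Q_d^\top$ and output $\hat{\boldsymbol{\mathcal X}}=\boldsymbol{\mathcal G}\times_1\boldsymbol Q_1\times_2\cdots\times_d\boldsymbol Q_d$. *)

(* Defs.v *)
From HB Require Import structures.
From mathcomp Require Import all_boot all_order all_algebra.
From mathcomp Require Import polyrcf.
From mathcomp Require Import all_classical all_reals all_analysis.

Set Implicit Arguments.
Unset Strict Implicit.
Unset Printing Implicit Defensive.

Import Order.TTheory GRing.Theory Num.Theory.
Import numFieldNormedType.Exports.

Local Open Scope ring_scope.

(* Modes are numbered from 0.                                                 *)

Section SingularValues.
Context {R : rcfType}.

Definition real_eigenvalues m (S : 'M[R]_m) : seq R :=
  flatten [seq nseq (mup x (char_poly S)) x | x <- rootsR (char_poly S)].

Definition singular_values m n (A : 'M[R]_(m, n)) : seq R :=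
  sort >=%R [seq Num.sqrt x | x <- real_eigenvalues (A *m A^T)].

(* The index j is 1-based: sigma A 1 is the largest singular value.           *)
Definition sigma m n (A : 'M[R]_(m, n)) (j : nat) : R :=
  (singular_values A)`_j.-1.

End SingularValues.

Section Tensors.
Context {R : realType} {d : nat}.
Implicit Types (a b n : 'I_d -> nat) (i : 'I_d).

Definition tindex n := {dffun forall j : 'I_d, 'I_(n j)}.
Definition tensor n := {ffun tindex n -> R}.

Definition frob n (X : tensor n) : R := Num.sqrt (\sum_k X k ^+ 2).

Definition ncols n i : nat := (\prod_(j < d | j != i) n j)%N.

Definition colnum n i (k : tindex n) : nat :=
  (\sum_(j < d | j != i) k j * \prod_(h < d | (h < j) && (h != i)) n h)%N.

(* X_k sits in row k_i and column (colnum i k) of the mode-i unfolding; the   *)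
(* sum has exactly one term.                                                  *)
Definition unfold n i (X : tensor n) : 'M[R]_(n i, ncols n i) :=
  \matrix_(p, c) \sum_(k : tindex n | (k i == p) && (colnum i k == c :> nat)) X k.

(* Inverse of [unfold i], for a matrix whose columns are numbered by the      *)
(* sizes a; it is used when a and b agree at all modes but i.                 *)
Definition refold a b i (M : 'M[R]_(b i, ncols a i)) : tensor b :=
  [ffun k => \sum_(c < ncols a i | c == colnum i k :> nat) M (k i) c].

Definition mode_mul a b i (A : 'M[R]_(b i, a i)) (X : tensor a) : tensor b :=
  refold (A *m unfold i X).

(* Sizes after the products along the first t modes.                          *)
Definition stage a b (t : nat) (j : 'I_d) : nat := if (j < t)%N then b j else a j.

Lemma stage_old a b i : stage a b i i = a i.
Proof. by rewrite /stage ltnn. Qed.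

Lemma stage_new a b i : stage a b i.+1 i = b i.
Proof. by rewrite /stage ltnSn. Qed.

Fixpoint mode_muls_upto a b (A : forall i, 'M[R]_(b i, a i)) (X : tensor a)
    (t : nat) : (t <= d)%N -> tensor (stage a b t) :=
  match t with
  | 0 => fun=> X
  | t'.+1 => fun lt_t'd =>
      let i := Ordinal lt_t'd in
      mode_mul (i := i)
        (castmx (esym (stage_new a b i), esym (stage_old a b i)) (A i))
        (mode_muls_upto A X (ltnW lt_t'd))
  end.

(* Transport between pointwise equal sizes; the sum has exactly one term.     *)
Definition retype a b (X : tensor a) : tensor b :=
  [ffun k : tindex b =>
     \sum_(k' : tindex a | [forall j, k' j == k j :> nat]) X k'].

(* X x_1 A_1 x_2 ... x_d A_d                                                  *)
Definition mode_muls a b (A : forall i, 'M[R]_(b i, a i)) (X : tensor a) :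
    tensor b :=
  retype b (mode_muls_upto A X (leqnn d)).

End Tensors.

Arguments tensor R {d} n.

Section Sketching.
Context {R : realType}.

(* Column k is the Kronecker product of the k-th columns of A and B: mxvec is *)
(* row-major, so the index of B varies fastest.                               *)
Definition khatri_rao m n l (A : 'M[R]_(m, l)) (B : 'M[R]_(n, l)) :
    'M[R]_(m * n, l) :=
  (\matrix_(k < l) mxvec (col k A *m (col k B)^T))^T.

Context {d : nat}.
Implicit Types (n : 'I_d -> nat) (i : 'I_d).

Definition krp_rows n (s : seq 'I_d) : nat :=
  foldr (fun j N => (n j * N)%N) 1%N s.

Fixpoint krp n l (Om : forall j, 'M[R]_(n j, l)) (s : seq 'I_d) :
    'M[R]_(krp_rows n s, l) :=
  match s with
  | [::] => const_mx 1
  | j :: s' => khatri_rao (Om j) (krp Om s')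
  end.

(* Modes other than i, in decreasing order.                                   *)
Definition other_modes i : seq 'I_d := rev [seq j <- enum 'I_d | j != i].

Lemma krp_rows_other n i : krp_rows n (other_modes i) = ncols n i.
Proof.
have -> : krp_rows n (other_modes i) = (\prod_(j <- other_modes i) n j)%N.
  by elim: other_modes => [|j s IHs]; rewrite ?big_nil // big_cons /= IHs.
rewrite /ncols -[RHS]big_filter; apply: perm_big.
by rewrite perm_rev enumT.
Qed.

Definition sketch n l i (X : tensor R n) (Om : forall j, 'M[R]_(n j, l)) :
    'M[R]_(n i, l) :=
  unfold i X *m castmx (krp_rows_other n i, erefl) (krp Om (other_modes i)).

Definition thin_qr a b (Y : 'M[R]_(a, b)) (Q : 'M[R]_(a, minn a b))
    (U : 'M[R]_(minn a b, b)) : Prop :=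
  [/\ Q^T *m Q = 1%:M, is_trig_mx U^T & Y = Q *m U].

(* Om i j is the matrix Omega^(j) used for mode i; Om i i is never used. A QR *)
(* factorization is not unique, so the output is specified as a relation.     *)
Definition rhosvd_output n (l : 'I_d -> nat) (X : tensor R n)
    (Om : forall i j : 'I_d, 'M[R]_(n j, l i)) (Xhat : tensor R n) : Prop :=
  exists (Q : forall i, 'M[R]_(n i, minn (n i) (l i)))
         (U : forall i, 'M[R]_(minn (n i) (l i), l i)),
    (forall i, thin_qr (sketch i X (Om i)) (Q i) (U i)) /\
    Xhat = mode_muls Q (mode_muls (fun i => (Q i)^T) X).

End Sketching.

Section Randomness.
Local Open Scope classical_set_scope.
Context {R : realType} {disp : measure_display} {T : measurableType disp}.
Variable P : probability T R.

Definition psi2_norm (X : {RV P >-> R}) : \bar R :=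
  ereal_inf [set t%:E | t in
    [set t : R | 0 < t /\
       ('E_P[(fun w => expR (`|X w| ^+ 2 / t ^+ 2))%R] <= 2%:E)%E]].

Definition mutually_independent (I : finType) (X : I -> {RV P >-> R}) : Prop :=
  forall (J : {set I}) (B : I -> set R), (forall q, measurable (B q)) ->
    P [set w | forall q, q \in J -> B q (X q w)] =
    (\prod_(q in J) P (X q @^-1` B q))%E.

Definition sketch_entry (K : R) (X : {RV P >-> R}) : Prop :=
  [/\ ('E_P[X] = 0)%E, ('V_P[X] = 1)%E & (psi2_norm X <= K%:E)%E].

(* A may be non-measurable, since the QR routine is an arbitrary selection;   *)
(* for measurable A this says p <= P A.                                       *)
Definition holds_with_prob (p : R) (A : set T) : Prop :=
  exists E : set T, [/\ measurable E, E `<=` A & (p%:E <= P E)%E].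

Context {d : nat}.

Definition random_mx m l (W : 'I_m -> 'I_l -> {RV P >-> R}) (w : T) :
    'M[R]_(m, l) :=
  \matrix_(a, b) W a b w.

(* Positions of the entries drawn by RHOSVD-KRP: (i, j) with j != i, then row *)
(* and column in Omega^(j) for mode i.                                        *)
Definition krp_entry (n l : 'I_d -> nat) : finType :=
  {ij : {ij : 'I_d * 'I_d | ij.2 != ij.1} &
     ('I_(n (val ij).2) * 'I_(l (val ij).1))%type}.

Definition krp_draw (K : R) (n l : 'I_d -> nat)
    (W : forall i j : 'I_d, 'I_(n j) -> 'I_(l i) -> {RV P >-> R}) : Prop :=
  (forall i j a b, j != i -> sketch_entry K (W i j a b)) /\
  mutually_independent (fun q : krp_entry n l =>
    W (val (tag q)).1 (val (tag q)).2 (tagged q).1 (tagged q).2).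

Definition memo_draw (K : R) (n : 'I_d -> nat) (l : nat)
    (W : forall j : 'I_d, 'I_(n j) -> 'I_l -> {RV P >-> R}) : Prop :=
  (forall j a b, sketch_entry K (W j a b)) /\
  mutually_independent (fun q : {j : 'I_d & ('I_(n j) * 'I_l)%type} =>
    W (tag q) (tagged q).1 (tagged q).2).

(* Xhat is the random output of the algorithm, with sketch sizes r_i + p.     *)
Definition rhosvd_krp (K : R) (n r l : 'I_d -> nat) (X : tensor R n)
    (Xhat : T -> tensor R n) : Prop :=
  exists (p : nat) (W : forall i j, 'I_(n j) -> 'I_(l i) -> {RV P >-> R}),
    [/\ forall i, l i = (r i + p)%N, krp_draw K W &
        forall w, rhosvd_output X (fun i j => random_mx (W i j) w) (Xhat w)].

(* One family of matrices, with l_0 columns each, serves all the modes.       *)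
Definition rhosvd_krp_memo (K : R) (n : 'I_d -> nat) (l : 'I_d -> nat)
    (X : tensor R n) (Xhat : T -> tensor R n) : Prop :=
  exists (l0 : nat) (W : forall j, 'I_(n j) -> 'I_l0 -> {RV P >-> R}),
    [/\ forall i, l i = l0, memo_draw K W &
        forall w, rhosvd_output (l := fun=> l0) X
                    (fun _ j => random_mx (W j) w) (Xhat w)].

End Randomness.

Definition Gamma {R : realType} (d : nat) (C' : R) (delta : R) (l : nat) : R :=
  C' ^+ d * Num.max
    (Num.sqrt (ln (2 * d%:R / delta)) / Num.sqrt l%:R)
    (ln (2 * d%:R / delta) ^+ d / l%:R).

(* Main.v *)
(* Projecting along the modes one after the other, the squared error is at most
   the sum over i of |X_(i) - Q_i Q_i^T X_(i)|^2. Fix a mode, write A for the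
   unfolding and Omega for the Khatri-Rao sketch, and split A = A1 + A2 along the
   r leading left singular vectors. Let V be a basis of the row space of A1,
   orthonormal up to zero rows. If Omega embeds that space, that is if
   |x V Omega|^2 >= (l/2) |x V|^2, then the range of A Omega captures A up to
   |A2|^2 + (2/l) |A2 Omega|^2.

   Both |A2 Omega|^2 and the values |x V Omega|^2 on a net are sums over the l
   columns of independent variables |M omega|^2, with omega a Kronecker product
   of d - 1 vectors. Integrating the factors out one at a time, by Jensen, gives
   E |M omega|^(2p) <= (c p)^((d-1) p) |M|^(2p), hence a Bernstein-type bound on
   the moments of the centred sum and, by Markov at an order p comparable to the
   logarithm of the failure probability, the required concentration. The union
   bound over the modes needs no independence between them, so the memoized
   sketches are covered by the same argument. *)

Require Import Defs.
From HB Require Import structures.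
From mathcomp Require Import all_boot all_order all_algebra.
From mathcomp Require Import perm finmap measurable_realfun polyrcf complex ring lra zify.
From mathcomp Require Import all_classical all_reals all_analysis.

Set Implicit Arguments.
Unset Strict Implicit.
Unset Printing Implicit Defensive.

Import Order.TTheory GRing.Theory Num.Theory.
Import numFieldNormedType.Exports.

Local Open Scope ring_scope.

(** * Expectation of products of independent variables *)

(** For d >= 3 the squares |M omega|^2 need not have exponential moments, so the classical Bernstein
    inequality is out of reach; generating functions truncated at the order p used by Markov take
    its place. Integrating out one factor is conditioning, but all entries live on one abstract
    probability space. Only polynomials in the entries ever occur, so independence is reduced to the
    factorization of expectations of monomials, and conditioning to evaluating a polynomial at two
    sample points. The QR factor may depend on the sample point in a non-measurable way. The
    exceptional event is therefore defined by the sketch alone, and outside it the error is bounded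
    for every factorization at once. Constants: delta <= 2 d exp(-2) says that L = ln(2 d / delta)
    is at least 2, which leaves room for an even moment order between L and 2 L. With e = exp 1 and
    c = 64 e K^2, the sketch size uses C = 68 (80 e^3 c)^2, and Gamma uses C' = 16 e^3 c. The factor
    2 (1 + Gamma) is 2 / l times the bound l (1 + Gamma) |A2|^2 for |A2 Omega|^2. *)

Section SimpleFunctions.
Local Open Scope classical_set_scope.
Local Open Scope ereal_scope.
Context {R : realType} {disp : measure_display} {T : measurableType disp}.
Variable P : probability T R.

Import HBNNSimple.

Lemma nnsfunE_sum d' (U : measurableType d') (f : {nnsfun U >-> R}) x :
  f x = (\sum_(y <- fset_set (range f)) y * \1_(f @^-1` [set y]) x)%R.
Proof. by rewrite fimfunE fsbig_finite. Qed.

Lemma nnsfun_term_ge0 d' (U : measurableType d') (f : {nnsfun U >-> R}) x y :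
  (0 <= y * \1_(f @^-1` [set y]) x)%R.
Proof. by have := nnfun_muleindic_ge0 f y x; rewrite lee_fin. Qed.

(** The identity is linear in [g], so it passes from indicators to simple functions and then, by
    monotone convergence, to nonnegative measurable functions. [G] stands for the product of all the
    other factors. *)
Lemma ge0_integral_slot (V G : T -> R) (c : R) (g : R -> R) :
  measurable_fun setT V -> measurable_fun setT G -> (forall w, 0 <= G w)%R ->
  measurable_fun setT g -> (forall x, 0 <= g x)%R ->
  (forall B : set R, measurable B ->
     \int[P]_w (\1_B (V w) * G w)%:E = \int[P]_w (\1_B (V w))%:E * c%:E) ->
  \int[P]_w (g (V w) * G w)%:E = \int[P]_w (g (V w))%:E * c%:E.
Proof.
move=> mV mG G0 mg g0 hB.
have mg' : measurable_fun [set: measurableTypeR R] (fun x => (g x)%:E).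
  exact/measurable_EFinP.
pose h := nnsfun_approx measurableT mg'.
have hcvg (x : R) : (h n x)%:E @[n --> \oo] --> (g x)%:E.
  have f0 (y : R) : setT y -> 0 <= (g y)%:E by rewrite lee_fin.
  exact: (cvg_nnsfun_approx measurableT mg' f0 (x := x) I).
have mh n : measurable_fun setT (h n) by exact/measurable_funP.
have ndh (x : R) m n : (m <= n)%N -> (h m x <= h n x)%R.
  by move=> mn; exact: (lefP _ _ (nd_nnsfun_approx measurableT mg' mn)).
have mhV n : measurable_fun setT (fun w => h n (V w)).
  exact: (measurableT_comp (mh n) mV).
have -> : \int[P]_w (g (V w))%:E = limn (fun n => \int[P]_w (h n (V w))%:E).
  rewrite -monotone_convergence//.
  - by apply: eq_integral => w _; apply/esym/cvg_lim.
  - by move=> n; apply/measurable_EFinP; exact: mhV.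
  - by move=> n w _; rewrite lee_fin.
  - by move=> w _ m n mn; rewrite lee_fin ndh.
have -> : \int[P]_w (g (V w) * G w)%:E =
    limn (fun n => \int[P]_w (h n (V w) * G w)%:E).
  rewrite -monotone_convergence//.
  - apply: eq_integral => w _; apply/esym/cvg_lim => //.
    by rewrite EFinM; apply: (cvgeZr (y := (G w)%:E) _ (hcvg (V w))).
  - by move=> n; apply/measurable_EFinP; apply: measurable_funM.
  - by move=> n w _; rewrite lee_fin mulr_ge0.
  - by move=> w _ m n mn; rewrite lee_fin ler_wpM2r ?ndh.
have mI (B : set R) : measurable B -> measurable_fun setT (fun w => \1_B (V w) : R).
  by move=> mB; apply: measurableT_comp => //; exact: measurable_indic.
have mpre n y : measurable (h n @^-1` [set y]) by [].
have key n : \int[P]_w (h n (V w) * G w)%:E = \int[P]_w (h n (V w))%:E * c%:E.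
  pose s : seq R := fset_set (range (h n)).
  transitivity (\int[P]_w (\sum_(y <- s)
    (y * \1_(h n @^-1` [set y]) (V w) * G w)%:E)).
    apply: eq_integral => w _.
    by rewrite nnsfunE_sum mulr_suml sumEFin.
  rewrite ge0_integral_sum//; last 2 first.
  - move=> y; apply/measurable_EFinP; apply: measurable_funM => //.
    by apply: measurable_funM => //; exact: (mI _ (mpre n y)).
  - by move=> y w _; rewrite lee_fin mulr_ge0 ?nnsfun_term_ge0.
  have -> : \int[P]_w (h n (V w))%:E =
      \sum_(y <- s) \int[P]_w (y * \1_(h n @^-1` [set y]) (V w))%:E.
    rewrite -ge0_integral_sum//.
    - by apply: eq_integral => w _; rewrite nnsfunE_sum sumEFin.
    - by move=> y; apply/measurable_EFinP; apply: measurable_funM => //; exact: (mI _ (mpre n y)).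
    - by move=> y w _; rewrite lee_fin nnsfun_term_ge0.
  rewrite ge0_sume_distrl; last first.
    by move=> y _; apply: integral_ge0 => w _; rewrite lee_fin nnsfun_term_ge0.
  rewrite big_seq [RHS]big_seq; apply: eq_bigr => y ys.
  have y0 : (0 <= y)%R.
    by move: ys; rewrite in_fset_set// inE => -[x _ <-].
  under eq_integral do rewrite -mulrA EFinM.
  rewrite ge0_integralZl_EFin//; last 2 first.
  - by move=> w _; rewrite lee_fin mulr_ge0.
  - by apply/measurable_EFinP; apply: measurable_funM => //; exact: (mI _ (mpre n y)).
  under [in RHS]eq_integral do rewrite EFinM.
  rewrite ge0_integralZl_EFin//; last first.
  - by apply/measurable_EFinP; exact: (mI _ (mpre n y)).
  by rewrite -muleA; congr (_ * _); exact: (hB _ (mpre n y)).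
under eq_fun do rewrite key.
have nd : nondecreasing_seq (fun n => \int[P]_w (h n (V w))%:E).
  move=> m n mn; apply: ge0_le_integral => //.
  - by move=> w _; rewrite lee_fin.
  - by apply/measurable_EFinP; exact: mhV.
  - by apply/measurable_EFinP; exact: mhV.
  - by move=> w _; rewrite lee_fin ndh.
apply/cvg_lim => //; apply: cvgeZr => //.
exact/ereal_nondecreasing_is_cvgn.
Qed.
End SimpleFunctions.

Section ProductExpectation.
Local Open Scope classical_set_scope.
Context {R : realType} {disp : measure_display} {T : measurableType disp}.
Variable P : probability T R.

Definition rintegrable (f : T -> R) := P.-integrable setT (EFin \o f).

(** All indices are tested at once; a subfamily is reached by taking [B q] to be the whole line
    elsewhere. *)
Definition independent_family (I : finType) (V : I -> T -> R) : Prop :=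
  forall B : I -> set R, (forall q, measurable (B q)) ->
    P [set w | forall q, B q (V q w)] = (\prod_q P (V q @^-1` B q))%E.

Lemma rintegrable_meas f : rintegrable f -> measurable_fun setT f.
Proof. by move=> /measurable_int /measurable_EFinP. Qed.

Lemma EFin_Rintegral f : rintegrable f -> (\int[P]_w (f w)%:E = (\int[P]_w f w)%:E)%E.
Proof. by move=> fi; rewrite /Rintegral fineK//; exact: integrable_fin_num. Qed.

Lemma measurable_prod_cond (J : finType) (Q : pred J) (h : J -> T -> R) :
  (forall i, measurable_fun setT (h i)) ->
  measurable_fun setT (fun x => \prod_(i | Q i) h i x).
Proof.
move=> mh; under eq_fun do rewrite -big_filter.
by apply: measurable_prod => i _.
Qed.

Variables (I : finType) (V : I -> T -> R).
Hypothesis mV : forall q, measurable_fun setT (V q).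
Hypothesis indV : independent_family V.

Definition upd (f : I -> R -> R) q u := fun q' => if q' == q then u else f q'.

Lemma prod_upd f q u w : \prod_q' upd f q u q' (V q' w) =
  u (V q w) * \prod_(q' | q' != q) f q' (V q' w).
Proof.
rewrite (bigD1 q)//= /upd eqxx; congr (_ * _).
by apply: eq_bigr => q' /negPf ->.
Qed.

Lemma prodE_upd f q u : \prod_q' (\int[P]_w upd f q u q' (V q' w)) =
  (\int[P]_w u (V q w)) * \prod_(q' | q' != q) \int[P]_w f q' (V q' w).
Proof.
rewrite (bigD1 q)//= /upd eqxx; congr (_ * _).
by apply: eq_bigr => q' /negPf ->.
Qed.

(* Induction on s: the factors outside s are indicators, and a factor of s is
   released from indicators to nonnegative functions one variable at a time. *)
Lemma ge0_expectation_prod (s : seq I) (g : I -> R -> R) :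
  (forall q, measurable_fun setT (g q)) -> (forall q x, 0 <= g q x) ->
  (forall q, rintegrable (fun w => g q (V q w))) ->
  (forall q, q \notin s -> exists2 B : set R, measurable B & g q = \1_B) ->
  (\int[P]_w (\prod_q g q (V q w))%:E =
   (\prod_q \int[P]_w g q (V q w))%:E)%E.
Proof.
elim: s g => [|q s IHs] g mg g0 ig hg.
  have /choice[B hB] q : exists B : set R, measurable B /\ g q = \1_B.
    by have [//|B mB ->] := hg q; exists B.
  pose E := [set w | forall q, B q (V q w)].
  have mpre q : measurable (V q @^-1` B q).
    by rewrite -[_ @^-1` _]setTI; apply: mV => //; have [] := hB q.
  have mE : measurable E.
    rewrite (_ : E = \bigcap_(q in setT) (V q @^-1` B q)); last first.
      apply/seteqP; split => w /= h q => [_|]; exact: h.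
    by apply: fin_bigcap_measurable => //; exact: finite_finset.
  have intq q : (\int[P]_w (g q (V q w))%:E = P (V q @^-1` B q))%E.
    have -> : g q = \1_(B q) by have [] := hB q.
    by rewrite -(setIT (V q @^-1` _)) -integral_indic.
  transitivity (P E).
    rewrite -(setIT E) -integral_indic//; apply: eq_integral => w _.
    congr (_%:E); rewrite indicE; have [|/negP nE] := boolP (w \in E).
      rewrite inE => /= wE; rewrite big1// => q _; have [_ ->] := hB q.
      by rewrite indicE mem_set.
    have [q nq] : exists q, ~ B q (V q w).
      by apply: contrapT => h; apply: nE; rewrite inE => q; apply: contrapT => nq; apply: h; exists q.
    rewrite (bigD1 q)//=; have [_ ->] := hB q.
    by rewrite indicE memNset// mul0r.
  rewrite indV; last by move=> q; have [] := hB q.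
  rewrite -prodEFin; apply: eq_bigr => q _.
  by rewrite -intq EFin_Rintegral.
pose G w := \prod_(q' | q' != q) g q' (V q' w).
pose c := \prod_(q' | q' != q) \int[P]_w g q' (V q' w).
have G0 w : 0 <= G w by apply: prodr_ge0.
have mgV q' : measurable_fun setT (fun w => g q' (V q' w)) by exact/rintegrable_meas.
have mG : measurable_fun setT G by exact: measurable_prod_cond.
transitivity (\int[P]_w (g q (V q w) * G w)%:E)%E.
  by apply: eq_integral => w _; rewrite (bigD1 q).
rewrite (@ge0_integral_slot _ _ _ _ _ _ c)//.
  by rewrite [in RHS](bigD1 q)//= EFin_Rintegral.
move=> B mB.
have iB : rintegrable (fun w => \1_B (V q w)).
  rewrite /rintegrable.
  have -> : EFin \o (fun w => \1_B (V q w)) = EFin \o (\1_(V q @^-1` B) : T -> R) by [].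
  by apply: integrable_indic => //; rewrite -[_ @^-1` _]setTI; exact: mV.
have := IHs (upd g q (\1_B)).
under eq_integral do rewrite prod_upd.
move=> ->.
- by rewrite prodE_upd EFinM EFin_Rintegral.
- by move=> q'; rewrite /upd; case: eqP => // _; exact: measurable_indic.
- by move=> q' x; rewrite /upd; case: eqP.
- by move=> q'; rewrite /upd; case: eqP => [->|].
- move=> q' q's; rewrite /upd; case: eqP => [_|/eqP qq']; first by exists B.
  by apply: hg; rewrite inE negb_or qq'.
Qed.

Lemma rintegrable_ge0 (f : T -> R) : measurable_fun setT f -> (forall w, 0 <= f w) ->
  (\int[P]_w (f w)%:E < +oo)%E -> rintegrable f.
Proof.
move=> mf f0 fi; apply/integrableP; split; first exact/measurable_EFinP.
by under eq_integral => w _ do rewrite /= ger0_norm//.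
Qed.

Lemma rintegrableB f g : rintegrable f -> rintegrable g ->
  rintegrable (fun w => f w - g w).
Proof.
move=> fi gi; have := integrableB measurableT fi gi.
by apply: eq_integrable => // w _ /=; rewrite EFinB.
Qed.

(** The factors in [s] may change sign. Each step of the induction splits one of them into its
    positive and negative parts and subtracts the two products, in which that slot is
    nonnegative. *)
Lemma expectation_prod (s : seq I) (g : I -> R -> R) :
  (forall q, measurable_fun setT (g q)) ->
  (forall q, rintegrable (fun w => g q (V q w))) ->
  (forall q, q \notin s -> forall x, 0 <= g q x) ->
  rintegrable (fun w => \prod_q g q (V q w)) /\
  \int[P]_w (\prod_q g q (V q w)) = \prod_q \int[P]_w g q (V q w).
Proof.
elim: s g => [|q s IHs] g mg ig hg.
  have g0 q x : 0 <= g q x by exact: hg.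
  have e : (\int[P]_w (\prod_q g q (V q w))%:E =
     (\prod_q \int[P]_w g q (V q w))%:E)%E.
    by apply: (@ge0_expectation_prod (enum I)) => // q; rewrite mem_enum.
  split; last by rewrite /Rintegral e.
  apply: rintegrable_ge0; last by rewrite e ltry.
    by apply: measurable_prod_cond => q; exact/rintegrable_meas.
  by move=> w; apply: prodr_ge0.
pose u x := Num.max (g q x) 0.
pose v x := Num.max (- g q x) 0.
have guv x : g q x = u x - v x.
  by rewrite /u /v; case: (lerP (g q x) 0) => h; case: (lerP (- g q x) 0) => h'; lra.
have mu : measurable_fun setT u by apply: measurable_maxr.
have mv : measurable_fun setT v by apply: measurable_maxr => //; exact: measurableT_comp.
have iu : rintegrable (fun w => u (V q w)).
  apply: (le_integrable measurableT _ _ (ig q)).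
    by apply/measurable_EFinP/measurable_maxr => //; exact: rintegrable_meas.
  move=> t _; rewrite /= lee_fin /u ger0_norm ?le_max ?lexx ?orbT//.
  by rewrite ge_max ler_norm normr_ge0.
have iv : rintegrable (fun w => v (V q w)).
  apply: (le_integrable measurableT _ _ (ig q)).
    apply/measurable_EFinP/measurable_maxr => //; apply: measurableT_comp => //.
    exact: rintegrable_meas.
  move=> t _; rewrite /= lee_fin /v ger0_norm ?le_max ?lexx ?orbT//.
  by rewrite ge_max -normrN ler_norm normr_ge0.
have step z : measurable_fun setT z -> rintegrable (fun w => z (V q w)) ->
    (forall x, 0 <= z x) ->
    rintegrable (fun w => \prod_q' upd g q z q' (V q' w)) /\
    \int[P]_w (\prod_q' upd g q z q' (V q' w)) = \prod_q' \int[P]_w upd g q z q' (V q' w).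
  move=> mz iz z0; apply: IHs.
  - by move=> q'; rewrite /upd; case: eqP.
  - by move=> q'; rewrite /upd; case: eqP => [->|].
  - move=> q' q's x; rewrite /upd; case: eqP => // /eqP qq'.
    by apply: hg; rewrite inE negb_or qq'.
have u0 x : 0 <= u x by rewrite /u le_max lexx orbT.
have v0 x : 0 <= v x by rewrite /v le_max lexx orbT.
have [iU eU] := step u mu iu u0.
have [iV eV] := step v mv iv v0.
have E w : \prod_q g q (V q w) =
   \prod_q' upd g q u q' (V q' w) - \prod_q' upd g q v q' (V q' w).
  by rewrite !prod_upd -mulrBl -guv (bigD1 q).
split.
  by apply: eq_integrable (rintegrableB iU iV) => // w _ /=; rewrite E.
under eq_Rintegral do rewrite E.
rewrite RintegralB// eU eV !prodE_upd -mulrBl -RintegralB// [in RHS](bigD1 q)//=.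
by congr (_ * _); apply: eq_Rintegral => w _; rewrite guv.
Qed.

End ProductExpectation.

(** * Polynomials in independent variables *)
Section PolynomialAlgebra.
Local Open Scope classical_set_scope.
Context {R : realType} {disp : measure_display} {T : measurableType disp}.
Variable P : probability T R.
Notation Ex f := (Rintegral P setT f).

Lemma rintegrableD (f g : T -> R) : rintegrable P f -> rintegrable P g ->
  rintegrable P (fun w => f w + g w).
Proof.
move=> fi gi; have := integrableD measurableT fi gi.
by apply: eq_integrable => // w _ /=; rewrite EFinD.
Qed.

Lemma rintegrableZ c (f : T -> R) : rintegrable P f ->
  rintegrable P (fun w => c * f w).
Proof.
move=> fi; have := integrableZl measurableT c fi.
by apply: eq_integrable => // w _ /=; rewrite EFinM.
Qed.

Lemma rintegrable_cst (c : R) : rintegrable P (fun=> c).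
Proof. exact: finite_measure_integrable_cst. Qed.

Lemma Rintegral_sum (J : Type) (s : seq J) (F : J -> T -> R) :
  (forall j, rintegrable P (F j)) ->
  rintegrable P (fun w => \sum_(j <- s) F j w) /\
  Ex (fun w => \sum_(j <- s) F j w) = \sum_(j <- s) Ex (F j).
Proof.
move=> Fi; elim: s => [|j s [IHi IHe]].
  have -> : (fun w => \sum_(i <- [::]) F i w) = (fun=> 0).
    by apply/funext => w; rewrite big_nil.
  by rewrite big_nil Rintegral_cst// mul0r; split => //; exact: rintegrable_cst.
have -> : (fun w => \sum_(i <- j :: s) F i w) =
    (fun w => F j w + \sum_(i <- s) F i w).
  by apply/funext => w; rewrite big_cons.
split; first exact: rintegrableD.
by rewrite big_cons -IHe; apply: RintegralD => //; exact: Fi.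
Qed.

Lemma Ex_cst (c : R) : Ex (fun=> c) = c.
Proof. by rewrite Rintegral_cst//= probability_setT mulr1. Qed.

Variables (I : finType) (V : I -> T -> R).

(* Polynomials in the variables V q with A q. The support A is tracked because
   disjoint supports give independence, without any sigma-algebra. *)
Inductive palg (A : pred I) : (T -> R) -> Prop :=
| palgC c : palg A (fun=> c)
| palgV q : A q -> palg A (V q)
| palgD f g : palg A f -> palg A g -> palg A (fun w => f w + g w)
| palgM f g : palg A f -> palg A g -> palg A (fun w => f w * g w).

Lemma palgS (A B : pred I) f : (forall q, A q -> B q) -> palg A f -> palg B f.
Proof.
move=> AB; elim=> [c|q /AB|g h _ IHg _ IHh|g h _ IHg _ IHh];
  [exact: palgC|exact: palgV|exact: palgD|exact: palgM].
Qed.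

Lemma palg_ext (A : pred I) f g : palg A f -> f =1 g -> palg A g.
Proof. by move=> fA /funext <-. Qed.

Lemma palg_sum (J : Type) (s : seq J) (Q : pred J) (A : pred I) (F : J -> T -> R) :
  (forall j, Q j -> palg A (F j)) -> palg A (fun w => \sum_(j <- s | Q j) F j w).
Proof.
move=> FA; elim: s => [|j s IHs].
  by apply: palg_ext (palgC _ 0) _ => w; rewrite big_nil.
have [Qj|nQj] := boolP (Q j).
  by apply: palg_ext (palgD (FA _ Qj) IHs) _ => w; rewrite big_cons Qj.
by apply: palg_ext IHs _ => w; rewrite big_cons (negPf nQj).
Qed.

Lemma palgX (A : pred I) f n : palg A f -> palg A (fun w => f w ^+ n).
Proof.
move=> fA; elim: n => [|n IHn].
  by apply: palg_ext (palgC _ 1) _ => w; rewrite expr0.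
by apply: palg_ext (palgM fA IHn) _ => w; rewrite exprS.
Qed.

Lemma palgZ (A : pred I) c f : palg A f -> palg A (fun w => c * f w).
Proof. by move=> fA; apply: palgM => //; exact: palgC. Qed.

Lemma palgN (A : pred I) f : palg A f -> palg A (fun w => - f w).
Proof.
by move=> fA; apply: palg_ext (palgZ (-1) fA) _ => w; rewrite mulN1r.
Qed.

Lemma palgB (A : pred I) f g : palg A f -> palg A g -> palg A (fun w => f w - g w).
Proof. by move=> fA gA; apply: palgD => //; exact: palgN. Qed.

Let monomial (e : {ffun I -> nat}) w := \prod_q V q w ^+ e q.

Let mmul (m m' : R * {ffun I -> nat}) : R * {ffun I -> nat} :=
  (m.1 * m'.1, [ffun q => (m.2 q + m'.2 q)%N]).

(** A normal form in which the support becomes visible: exponents vanish off [A]. *)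
Lemma palg_monomials A f : palg A f -> exists s : seq (R * {ffun I -> nat}),
  (forall m, m \in s -> forall q, ~~ A q -> m.2 q = 0%N) /\
  (forall w, f w = \sum_(m <- s) m.1 * monomial m.2 w).
Proof.
elim=> [c|q Aq|g h _ [s [s0 sE]] _ [t [t0 tE]]|g h _ [s [s0 sE]] _ [t [t0 tE]]].
- exists [:: (c, [ffun=> 0%N])]; split.
    by move=> m; rewrite inE => /eqP -> q _; rewrite ffunE.
  move=> w; rewrite big_seq1 /= /monomial big1 ?mulr1// => q _.
  by rewrite ffunE.
- exists [:: (1, [ffun q' => (q' == q) : nat])]; split.
    move=> m; rewrite inE => /eqP -> q' /=; rewrite ffunE.
    by case: eqP => // ->; rewrite Aq.
  move=> w; rewrite big_seq1 /= mul1r /monomial (bigD1 q)//= ffunE eqxx expr1.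
  by rewrite big1 ?mulr1// => q' /negPf nq; rewrite ffunE nq.
- exists (s ++ t); split.
    by move=> m; rewrite mem_cat => /orP[/s0|/t0].
  by move=> w; rewrite big_cat/= sE tE.
- exists [seq mmul m m' | m <- s, m' <- t].
  split.
    move=> m /allpairsP[[m1 m2] [/= /s0 h1 /t0 h2 ->]] q nAq /=; rewrite /mmul.
    by rewrite ffunE h1// h2.
  move=> w; rewrite sE tE big_allpairs_dep/= mulr_suml; apply: eq_bigr => m _.
  rewrite mulr_sumr; apply: eq_bigr => m' _.
  rewrite mulrACA; congr (_ * _); rewrite /monomial -big_split/=.
  by apply: eq_bigr => q _; rewrite ffunE exprD.
Qed.

Hypothesis indV : independent_family P V.
Hypothesis momV : forall q k, rintegrable P (fun w => V q w ^+ k).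

Lemma monomial_expectation (e : {ffun I -> nat}) : rintegrable P (monomial e) /\
  Ex (monomial e) = \prod_q Ex (fun w => V q w ^+ e q).
Proof.
have mV q : measurable_fun setT (V q).
  by apply: (rintegrable_meas (P := P)); have := momV q 1.
apply: (expectation_prod (P := P) mV indV (s := enum I) (g := fun q x => x ^+ e q)).
- by move=> q; exact: measurable_funX.
- by move=> q; exact: momV.
- by move=> q; rewrite mem_enum.
Qed.

Lemma palg_integrable A f : palg A f -> rintegrable P f.
Proof.
move=> /palg_monomials[s [_ sE]]; rewrite (_ : f = fun w => \sum_(m <- s) m.1 * monomial m.2 w); last exact/funext.
apply: (Rintegral_sum s _).1 => m; apply: rintegrableZ.
by have [] := monomial_expectation m.2.
Qed.

Lemma palg_measurable A f : palg A f -> measurable_fun setT f.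
Proof. by move=> /palg_integrable /rintegrable_meas. Qed.

Lemma ExD A f g : palg A f -> palg A g -> Ex (fun w => f w + g w) = Ex f + Ex g.
Proof. by move=> /palg_integrable fi /palg_integrable gi; rewrite RintegralD. Qed.

Lemma ExZ A c f : palg A f -> Ex (fun w => c * f w) = c * Ex f.
Proof. by move=> /palg_integrable fi; rewrite RintegralZl. Qed.

Lemma Ex_sum A (J : Type) (s : seq J) (F : J -> T -> R) :
  (forall j, palg A (F j)) ->
  Ex (fun w => \sum_(j <- s) F j w) = \sum_(j <- s) Ex (F j).
Proof. by move=> FA; apply: (Rintegral_sum s _).2 => j; exact: (palg_integrable (FA j)). Qed.

Lemma Ex_le A f g : palg A f -> palg A g -> (forall w, f w <= g w) -> Ex f <= Ex g.
Proof.
by move=> /palg_integrable fi /palg_integrable gi fg; exact: le_Rintegral.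
Qed.

(** After expansion into monomials, each variable has a nonzero exponent in at most one of the two
    factors, and its moment of order 0 is 1; hence the moment of the summed exponent is the product
    of the two moments. *)
Lemma palg_indep (A B : pred I) f g : (forall q, A q -> ~~ B q) ->
  palg A f -> palg B g -> Ex (fun w => f w * g w) = Ex f * Ex g.
Proof.
move=> AB fA gB.
have ex0 q : Ex (fun w => V q w ^+ 0) = 1.
  by rewrite -[RHS](Ex_cst 1); apply: eq_Rintegral => w _; rewrite expr0.
have [s [s0 sE]] := palg_monomials fA; have [t [t0 tE]] := palg_monomials gB.
have mi m : rintegrable P (fun w => m.1 * monomial m.2 w).
  by apply: rintegrableZ; have [] := monomial_expectation m.2.
have eE u : Ex (fun w => \sum_(m <- u) m.1 * monomial m.2 w) =
    \sum_(m <- u) m.1 * \prod_q Ex (fun w => V q w ^+ m.2 q).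
  rewrite (Rintegral_sum u mi).2; apply: eq_bigr => m _.
  have [i e] := monomial_expectation m.2.
  by rewrite RintegralZl// e.
rewrite (_ : f = fun w => \sum_(m <- s) m.1 * monomial m.2 w); last exact/funext.
rewrite (_ : g = fun w => \sum_(m <- t) m.1 * monomial m.2 w); last exact/funext.
rewrite !eE.
pose st := [seq mmul m m' | m <- s, m' <- t].
transitivity (Ex (fun w => \sum_(m <- st) m.1 * monomial m.2 w)).
  apply: eq_Rintegral => w _; rewrite big_allpairs_dep/= mulr_suml.
  apply: eq_bigr => m _; rewrite mulr_sumr; apply: eq_bigr => m' _.
  rewrite mulrACA; congr (_ * _); rewrite /monomial -big_split/=.
  by apply: eq_bigr => q _; rewrite ffunE exprD.
rewrite eE big_allpairs_dep/= mulr_suml.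
rewrite big_seq [RHS]big_seq; apply: eq_bigr => m ms; rewrite mulr_sumr.
rewrite big_seq [RHS]big_seq; apply: eq_bigr => m' mt.
rewrite mulrACA; congr (_ * _); rewrite -big_split/=.
apply: eq_bigr => q _; rewrite ffunE; have [Aq|nAq] := boolP (A q).
  by rewrite (t0 _ mt) ?AB// addn0 ex0 mulr1.
by rewrite (s0 _ ms)// add0n ex0 mul1r.
Qed.

(* Polynomials in two disjoint groups of variables, evaluated at two sample
   points: fixing the second point stands for conditioning on the second group. *)
Inductive bialg (A B : pred I) : (T -> T -> R) -> Prop :=
| bialgL f : palg A f -> bialg A B (fun w' _ => f w')
| bialgR f : palg B f -> bialg A B (fun _ w => f w)
| bialgD f g : bialg A B f -> bialg A B g -> bialg A B (fun w' w => f w' w + g w' w)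
| bialgM f g : bialg A B f -> bialg A B g -> bialg A B (fun w' w => f w' w * g w' w).

Lemma bialg_sum (J : Type) (s : seq J) A B (F : J -> T -> T -> R) :
  (forall j, bialg A B (F j)) -> bialg A B (fun w' w => \sum_(j <- s) F j w' w).
Proof.
move=> FA; elim: s => [|j s IHs].
  rewrite (_ : (fun _ => _) = fun _ _ => 0); first by apply: bialgL; exact: palgC.
  by apply/funext => w'; apply/funext => w; rewrite big_nil.
rewrite (_ : (fun _ => _) = fun w' w => F j w' w + \sum_(j <- s) F j w' w).
  exact: bialgD.
by apply/funext => w'; apply/funext => w; rewrite big_cons.
Qed.

Lemma bialgX A B f n : bialg A B f -> bialg A B (fun w' w => f w' w ^+ n).
Proof.
move=> fA; elim: n => [|n IHn].
  rewrite (_ : (fun _ => _) = fun _ _ => 1); first by apply: bialgL; exact: palgC.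
  by apply/funext => w'; apply/funext => w; rewrite expr0.
rewrite (_ : (fun _ => _) = fun w' w => f w' w * f w' w ^+ n); first exact: bialgM.
by apply/funext => w'; apply/funext => w; rewrite exprS.
Qed.

(** Separation of variables: the two sample points occur in different factors of finitely many
    products. *)
Lemma bialg_tensors A B F : bialg A B F -> exists (J : finType) (f g : J -> T -> R),
  [/\ forall j, palg A (f j), forall j, palg B (g j) &
      forall w' w, F w' w = \sum_j f j w' * g j w].
Proof.
elim=> [f fA|g gB|F1 F2 _ [J1 [f1 [g1 [f1A g1B E1]]]] _ [J2 [f2 [g2 [f2A g2B E2]]]]|
                  F1 F2 _ [J1 [f1 [g1 [f1A g1B E1]]]] _ [J2 [f2 [g2 [f2A g2B E2]]]]].
- exists 'I_1, (fun=> f), (fun _ _ => 1); split => // [_|w' w]; first exact: palgC.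
  by rewrite big_ord1 ?mulr1.
- exists 'I_1, (fun _ _ => 1), (fun=> g); split => // [_|w' w]; first exact: palgC.
  by rewrite big_ord1 ?mul1r.
- exists (J1 + J2)%type, (fun j => match j with inl i => f1 i | inr i => f2 i end),
    (fun j => match j with inl i => g1 i | inr i => g2 i end).
  by split => [[]|[]|w' w] //; rewrite big_sumType/= E1 E2.
- exists (J1 * J2)%type, (fun j w => f1 j.1 w * f2 j.2 w), (fun j w => g1 j.1 w * g2 j.2 w).
  split => [j|j|w' w]; try exact: palgM.
  rewrite E1 E2 big_distrlr/= pair_bigA/=.
  by apply: eq_bigr => j _; rewrite mulrACA.
Qed.

(** Fubini for polynomials in two disjoint groups of variables. On a separated sum it is
    [palg_indep] term by term. *)
Lemma decouple (A B : pred I) (F : T -> T -> R) : (forall q, A q -> ~~ B q) -> bialg A B F ->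
  [/\ forall w, palg A (F ^~ w), palg B (fun w => Ex (F ^~ w)),
      palg [predU A & B] (fun w => F w w) &
      Ex (fun w => F w w) = Ex (fun w => Ex (F ^~ w))].
Proof.
move=> AB /bialg_tensors[J [f [g [fA gB E]]]].
have FA w : palg A (F ^~ w).
  rewrite (_ : F ^~ w = fun w' => \sum_j f j w' * g j w).
    by apply: palg_sum => j _; apply: palgM => //; exact: palgC.
  by apply/funext => w'; rewrite E.
have EF : (fun w => Ex (F ^~ w)) = fun w => \sum_j Ex (f j) * g j w.
  apply/funext => w.
  under eq_Rintegral do rewrite E.
  rewrite (Ex_sum (A := A)) => [|j]; last by apply: palgM => //; exact: palgC.
  apply: eq_bigr => j _; under eq_Rintegral do rewrite mulrC.
  by rewrite (ExZ _ (fA j)) mulrC.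
have FU : palg [predU A & B] (fun w => F w w).
  rewrite (_ : (fun w => F w w) = fun w => \sum_j f j w * g j w); last first.
    by apply/funext => w; rewrite E.
  apply: palg_sum => j _; apply: palgM.
    by apply: palgS (fA j) => q Aq; apply/orP; left.
  by apply: palgS (gB j) => q Bq; apply/orP; right.
split => //.
  by rewrite EF; apply: palg_sum => j _; exact: palgZ.
rewrite EF (Ex_sum (A := B)) => [|j]; last exact: palgZ.
under eq_Rintegral do rewrite E.
rewrite (Ex_sum (A := [predU A & B])) => [|j]; last first.
  apply: palgM.
    by apply: palgS (fA j) => q Aq; apply/orP; left.
  by apply: palgS (gB j) => q Bq; apply/orP; right.
by apply: eq_bigr => j _; rewrite (palg_indep AB)// (ExZ _ (gB j)).
Qed.

End PolynomialAlgebra.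

(** * Moments of Khatri-Rao columns *)
Lemma pow_tangent {R : realDomainType} (x m : R) (p : nat) : 0 <= x -> 0 <= m ->
  m ^+ p.+1 + p.+1%:R * m ^+ p * (x - m) <= x ^+ p.+1.
Proof.
move=> x0 m0; elim: p => [|p IHp]; first by rewrite expr0 !expr1 mulr1 mul1r addrC subrK.
have {IHp} := ler_wpM2l x0 IHp; rewrite -exprS; apply: le_trans.
have -> : p.+2%:R = p.+1%:R + 1 :> R by rewrite -natr1.
rewrite !exprS; set c := p.+1%:R; set a := m ^+ p.
rewrite -subr_ge0 (_ : _ - _ = c * a * (x - m) ^+ 2); last by ring.
by rewrite mulr_ge0 ?sqr_ge0// mulr_ge0 ?exprn_ge0// ler0n.
Qed.

(** Jensen for the weights [N j] and the points [y j / N j]: the tangent inequalities at the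
    weighted mean are summed, and their linear parts cancel. A zero weight must carry a zero value,
    since [y j / N j] is then 0 by convention. *)
Lemma jensen_pow {R : realFieldType} (J : finType) (N y : J -> R) (p : nat) :
  (forall j, 0 <= N j) -> (forall j, 0 <= y j) -> (forall j, N j = 0 -> y j = 0) ->
  (\sum_j y j) ^+ p.+1 <= (\sum_j N j) ^+ p * \sum_j N j * (y j / N j) ^+ p.+1.
Proof.
move=> N0 y0 Ny; set NT := \sum_j N j; set Y := \sum_j y j.
have NT0 : 0 <= NT by apply: sumr_ge0.
have [NTe|NTn] := eqVneq NT 0.
  have Nj j : N j = 0 by apply: (psumr_eq0P (P := predT) _ NTe).
  rewrite /Y big1 => [|j _]; last exact/Ny.
  by rewrite expr0n/= mulr_ge0 ?exprn_ge0// sumr_ge0// => j _; rewrite Nj mul0r.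
have NTp : 0 < NT by rewrite lt_def NTn.
pose m := Y / NT.
have Y0 : 0 <= Y by apply: sumr_ge0.
have m0 : 0 <= m by rewrite divr_ge0.
have yE j : N j * (y j / N j) = y j.
  have [e|n] := eqVneq (N j) 0; first by rewrite e mul0r (Ny _ e).
  by rewrite mulrC divfK.
have E : NT * m ^+ p.+1 <= \sum_j N j * (y j / N j) ^+ p.+1.
  have h j : N j * m ^+ p.+1 + p.+1%:R * m ^+ p * (y j - N j * m) <= N j * (y j / N j) ^+ p.+1.
    rewrite -{1}(yE j) -mulrBr mulrCA -mulrDr ler_wpM2l//; apply: pow_tangent => //.
    by rewrite divr_ge0.
  apply: le_trans (ler_sum _ (fun j _ => h j)).
  rewrite big_split/= -mulr_suml -mulr_sumr big_split/= sumrN -mulr_suml -/NT -/Y.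
  by rewrite mulrC [NT * m]mulrC /m divfK// subrr mulr0 addr0.
apply: le_trans (ler_wpM2l _ E); last exact: exprn_ge0.
by rewrite mulrA -exprSr -exprMn /m mulrC divfK.
Qed.

Section Moments.
Local Open Scope classical_set_scope.
Context {R : realType} {disp : measure_display} {T : measurableType disp}.
Variable P : probability T R.
Notation Ex f := (Rintegral P setT f).
Variables (I : finType) (V : I -> T -> R).
Hypothesis indV : independent_family P V.
Hypothesis momV : forall q k, rintegrable P (fun w => V q w ^+ k).
Implicit Types (A : pred I).

Lemma palg_sum_seq (J : eqType) (s : seq J) (X : J -> T -> R) (A : J -> pred I) :
  (forall j, palg V (A j) (X j)) ->
  palg V (fun q => has (fun j => A j q) s) (fun w => \sum_(j <- s) X j w).
Proof.
move=> XA; elim: s => [|j s IHs].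
  by apply: palg_ext (palgC _ _ 0) _ => w; rewrite big_nil.
apply: (palg_ext (f := fun w => X j w + \sum_(j <- s) X j w)); last first.
  by move=> w; rewrite big_cons.
apply: palgD.
  by apply: palgS (XA j) => q /= ->.
by apply: palgS IHs => q /= ->; rewrite orbT.
Qed.

(* E(S^q) t^q / q! is a coefficient of the product of the generating functions
   of the X j; truncating them at degree p avoids exponential moments, which a
   product of several sub-Gaussian variables does not have. *)
Lemma moment_recursion (J : eqType) (s : seq J) (X : J -> T -> R) (A : J -> pred I)
    (b : J -> nat -> R) (p : nat) (t : R) :
  uniq s -> (forall j, palg V (A j) (X j)) ->
  (forall j j' q, j != j' -> A j q -> ~~ A j' q) -> 0 < t ->
  (forall j k, (k <= p)%N -> `|Ex (fun w => X j w ^+ k)| <= k`!%:R * b j k) ->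
  forall q, (q <= p)%N ->
  `|Ex (fun w => (\sum_(j <- s) X j w) ^+ q)| <=
    q`!%:R * t ^- q * \prod_(j <- s) \sum_(k < p.+1) b j k * t ^+ k.
Proof.
move=> us XA dis t0 hb.
have b0 j k : (k <= p)%N -> 0 <= b j k.
  move=> kp; have := le_trans (normr_ge0 _) (hb j k kp).
  by rewrite pmulr_rge0// ltr0n fact_gt0.
have Ex1 (f : T -> R) : Ex (fun w => f w ^+ 0) = 1.
  by rewrite -[RHS](Ex_cst P 1); apply: eq_Rintegral => w _; rewrite expr0.
elim: s us => [_ q qp|j s IHs /= /andP[js us] q qp].
  rewrite big_nil mulr1; case: q qp => [|q] qp.
    by rewrite Ex1 normr1 expr0 invr1 mulr1.
  rewrite (_ : Ex _ = 0) ?normr0 ?mulr_ge0 ?invr_ge0 ?exprn_ge0 ?ltW//.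
  by rewrite -[RHS](Ex_cst P 0); apply: eq_Rintegral => w _; rewrite big_nil expr0n.
set F := \prod_(j <- s) _ in IHs *.
have F0 : 0 <= F.
  rewrite /F prodr_ge0// => i _; rewrite sumr_ge0// => k _.
  by rewrite mulr_ge0 ?b0 ?exprn_ge0 ?(ltW t0)// -ltnS.
pose S w := \sum_(j <- s) X j w.
have SA : palg V (fun q => has (fun j => A j q) s) S by exact: palg_sum_seq.
have disS i : A j i -> ~~ has (fun j => A j i) s.
  move=> Aji; apply/hasPn => j' j's; apply: dis Aji.
  by apply: contraNneq js => ->.
have -> : Ex (fun w => (\sum_(i <- j :: s) X i w) ^+ q) =
    \sum_(i < q.+1) 'C(q, i)%:R * (Ex (fun w => X j w ^+ (q - i)) * Ex (fun w => S w ^+ i)).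
  transitivity (Ex (fun w => \sum_(i < q.+1) 'C(q, i)%:R * (X j w ^+ (q - i) * S w ^+ i))).
    apply: eq_Rintegral => w _; rewrite big_cons exprDn.
    by apply: eq_bigr => i _; rewrite mulr_natl.
  have XSA i : palg V predT (fun w => X j w ^+ (q - i) * S w ^+ i).
    by apply: palgM; apply: palgX; [apply: palgS (XA j)|apply: palgS SA].
  rewrite (Ex_sum (V := V) indV momV (A := predT)) => [|i]; last by apply: palgZ; exact: XSA.
  apply: eq_bigr => i _; rewrite (ExZ (V := V) indV momV _ (XSA i)).
  by rewrite (palg_indep (V := V) indV momV disS)//; apply: palgX.
apply: le_trans (ler_norm_sum _ _ _) _.
apply: (@le_trans _ _ (\sum_(i < q.+1) q`!%:R * t ^- q * F * (b j (q - i)%N * t ^+ (q - i)))).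
  apply: ler_sum => i _; have iq : (i <= q)%N by rewrite -ltnS.
  rewrite !normrM normr_nat.
  apply: (@le_trans _ _ ('C(q, i)%:R * (((q - i)`!%:R * b j (q - i)%N) * (i`!%:R * t ^- i * F)))).
    rewrite ler_wpM2l// ler_pM//.
      by apply: hb; rewrite (leq_trans (leq_subr _ _)).
    by apply: IHs => //; rewrite (leq_trans iq).
  rewrite -(bin_fact iq) !natrM le_eqVlt; apply/orP; left; apply/eqP.
  have -> : t ^- i = t ^- q * t ^+ (q - i).
    rewrite -{2}(subnK iq) exprD invfM mulrAC mulVf ?mul1r//.
    by rewrite expf_neq0// gt_eqF.
  by ring.
rewrite -mulr_sumr big_cons [_ * F in leRHS]mulrC mulrA.
rewrite ler_wpM2l ?mulr_ge0 ?invr_ge0 ?exprn_ge0 ?(ltW t0)//.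
rewrite (reindex_inj rev_ord_inj)/=.
rewrite (eq_bigr (fun i : 'I_q.+1 => b j i * t ^+ i)); last first.
  by move=> i _; rewrite subSS subKn// -ltnS.
rewrite -(big_mkord predT (fun i => b j i * t ^+ i)).
rewrite -(big_mkord predT (fun i => b j i * t ^+ i)).
(* The convolution only produces orders up to [q]; the nonnegative terms up to [p] complete the
   factor. *)
rewrite (big_cat_nat (n := q.+1) (p := p.+1))//= lerDl.
rewrite big_nat_cond sumr_ge0// => i /andP[/andP[_ ip] _].
by rewrite mulr_ge0 ?b0 ?exprn_ge0 ?(ltW t0).
Qed.

(** A bound on the moment generating function that mentions finite orders only. The absolute value
    is outside the expectation, so the centred first moment leaves no linear term in [x] and the
    bound is a pure Gaussian one. *)
Definition subgaussian_moments (s : R) (f : T -> R) :=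
  [/\ Ex f = 0, Ex (fun w => f w ^+ 2) = 1 &
    forall p x, 0 <= x ->
      \sum_(k < p.+1) `|Ex (fun w => f w ^+ k)| / k`!%:R * x ^+ k <= expR (s * x ^+ 2)].

Lemma fact_le_expn n : (n`! <= n ^ n)%N.
Proof.
elim: n => // n IHn; rewrite factS expnS leq_mul2l /= (leq_trans IHn)//.
by case: n {IHn} => // n; rewrite leq_exp2r.
Qed.

(** The truncated generating functions multiply to at most exp(s N t^2), and (2 p)! <= (4 p^2)^p;
    [moment_recursion] then gives the bound for the best [t]. *)
Lemma linear_form_moment (s : R) (K : finType) (W : K -> T -> R) (A : K -> pred I)
    (h : K -> R) (p : nat) :
  0 < s -> (forall j, palg V (A j) (W j)) ->
  (forall j j' q, j != j' -> A j q -> ~~ A j' q) ->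
  (forall j, subgaussian_moments s (W j)) ->
  Ex (fun w => (\sum_j h j * W j w) ^+ (2 * p)) <=
    (4 * expR 1 * s * p%:R * \sum_j h j ^+ 2) ^+ p.
Proof.
move=> s0 WA dis sg; case: p => [|p].
  rewrite muln0 expr0 -[leRHS](Ex_cst P 1) le_eqVlt; apply/orP; left; apply/eqP.
  by apply: eq_Rintegral => w _; rewrite expr0.
set N := \sum_j h j ^+ 2.
have N0 : 0 <= N by apply: sumr_ge0 => j _; exact: sqr_ge0.
have [Ne|Nn] := eqVneq N 0.
  rewrite Ne mulr0 expr0n/= -[leRHS](Ex_cst P 0) le_eqVlt; apply/orP; left; apply/eqP.
  apply: eq_Rintegral => w _; rewrite big1 ?expr0n// => j _.
  have /eqP : h j ^+ 2 = 0 by apply: (psumr_eq0P (P := predT) _ Ne) => // i _; exact: sqr_ge0.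
  by rewrite sqrf_eq0 => /eqP ->; rewrite mul0r.
have Np : 0 < N by rewrite lt_def Nn.
(* The minimizer of t^(-2 (p+1)) exp(s N t^2), as a value of t^2; the exponential becomes
   exp(p+1). *)
pose t2 := p.+1%:R / (s * N).
have t20 : 0 < t2 by rewrite divr_gt0// mulr_gt0.
pose t := Num.sqrt t2.
have t0 : 0 < t by rewrite sqrtr_gt0.
have tt : t ^+ 2 = t2 by rewrite sqr_sqrtr// ltW.
pose b j k := `|h j| ^+ k * (`|Ex (fun w => W j w ^+ k)| / k`!%:R).
have hXA j : palg V (A j) (fun w => h j * W j w) by apply: palgZ.
have hb j k : (k <= 2 * p.+1)%N ->
    `|Ex (fun w => (h j * W j w) ^+ k)| <= k`!%:R * b j k.
  move=> _; have -> : Ex (fun w => (h j * W j w) ^+ k) = h j ^+ k * Ex (fun w => W j w ^+ k).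
    rewrite -(ExZ indV momV _ (palgX k (WA j))).
    by apply: eq_Rintegral => w _; rewrite exprMn.
  by rewrite normrM normrX /b mulrCA [_`!%:R * _]mulrC divfK.
have := moment_recursion (enum_uniq K) hXA dis t0 hb (leqnn _).
rewrite big_enum /=.
rewrite (_ : Ex _ = Ex (fun w => (\sum_j h j * W j w) ^+ (2 * p.+1))); last first.
  by apply: eq_Rintegral => w _; rewrite big_enum.
move=> /(le_trans (ler_norm _))/le_trans; apply.
have F : \prod_j \sum_(k < (2 * p.+1).+1) b j k * t ^+ k <= expR p.+1%:R.
  apply: (@le_trans _ _ (\prod_j expR (s * (`|h j| * t) ^+ 2))).
    apply: ler_prod => j _; apply/andP; split.
      apply: sumr_ge0 => k _; rewrite /b.
      by rewrite !mulr_ge0 ?exprn_ge0 ?invr_ge0 ?(ltW t0).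
    have [_ _ /(_ (2 * p.+1)%N (`|h j| * t))] := sg j.
    rewrite mulr_ge0 ?(ltW t0)// => /(_ isT); apply: le_trans.
    by apply: ler_sum => k _; rewrite /b exprMn mulrAC mulrC.
  rewrite -expR_sum ler_expR -mulr_sumr.
  under eq_bigr do rewrite exprMn tt real_normK ?num_real//.
  by rewrite -mulr_suml -/N /t2 mulrA mulrC divfK// gt_eqF// mulr_gt0.
apply: le_trans (ler_wpM2l _ F) _; first by rewrite mulr_ge0// invr_ge0 exprn_ge0// ltW.
have -> : expR p.+1%:R = expR 1 ^+ p.+1 :> R by rewrite -expRM_natl mulr1.
rewrite exprM tt.
have h1 : (2 * p.+1)`!%:R <= (4 * p.+1%:R ^+ 2) ^+ p.+1 :> R.
  have := fact_le_expn (2 * p.+1); rewrite -(ler_nat R) => /le_trans; apply.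
  rewrite natrX exprM lerXn2r ?nnegrE ?exprn_ge0 ?mulr_ge0//.
  by rewrite natrM exprMn (_ : 2 ^+ 2 = 4 :> R) ?lexx // -natrX.
have g0 : 0 <= t2 ^- p.+1 * expR 1 ^+ p.+1.
  by rewrite mulr_ge0 ?invr_ge0 ?exprn_ge0 ?expR_ge0// ltW.
apply: (@le_trans _ _ ((4 * p.+1%:R ^+ 2) ^+ p.+1 * (t2 ^- p.+1 * expR 1 ^+ p.+1))).
  by rewrite -mulrA; exact: ler_wpM2r.
rewrite -exprVn -!exprMn lerXn2r ?nnegrE//.
- by rewrite !mulr_ge0 ?exprn_ge0 ?expR_ge0 ?invr_ge0// ltW.
- by rewrite !mulr_ge0 ?expR_ge0// ltW.
rewrite /t2 invf_div le_eqVlt; apply/orP; left; apply/eqP; field.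
by rewrite addrC natr1 pnatr_eq0.
Qed.

End Moments.

(** * Moments of quadratic forms in Kronecker products *)

Section KhatriRaoMoments.
Local Open Scope classical_set_scope.
Context {R : realType} {disp : measure_display} {T : measurableType disp}.
Variable P : probability T R.
Notation Ex f := (Rintegral P setT f).
Variables (I : finType) (V : I -> T -> R).
Hypothesis indV : independent_family P V.
Hypothesis momV : forall q k, rintegrable P (fun w => V q w ^+ k).
Implicit Types (A : pred I).

Definition qform (K J : finType) (a : J -> K -> R) (om : K -> R) : R :=
  \sum_j (\sum_k a j k * om k) ^+ 2.

Definition sqnorm (K J : finType) (a : J -> K -> R) : R :=
  \sum_j \sum_k a j k ^+ 2.

(** [m] is the number of Kronecker factors in [om]. The bound is asked for matrices with any finite
    set of rows, so that an induction on the factors can turn the index of a factor into a row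
    index. *)
Definition moment_controlled (c : R) (K : finType) A (m : nat) (om : K -> T -> R) :=
  (forall k, palg V A (om k)) /\
  forall (J : finType) (a : J -> K -> R),
    Ex (fun w => qform a (om ^~ w)) = sqnorm a /\
    forall p, Ex (fun w => qform a (om ^~ w) ^+ p) <=
      (c * p%:R) ^+ (m * p) * sqnorm a ^+ p.

Lemma sqnorm_ge0 (K J : finType) (a : J -> K -> R) : 0 <= sqnorm a.
Proof. by apply: sumr_ge0 => j _; apply: sumr_ge0 => k _; exact: sqr_ge0. Qed.

Lemma qform_ge0 (K J : finType) (a : J -> K -> R) om : 0 <= qform a om.
Proof. by apply: sumr_ge0 => j _; exact: sqr_ge0. Qed.

Lemma palg_qform A (K J : finType) (a : J -> K -> R) (om : K -> T -> R) :
  (forall k, palg V A (om k)) -> palg V A (fun w => qform a (om ^~ w)).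
Proof.
move=> omA; apply: palg_sum => j _; apply: palgX; apply: palg_sum => k _.
exact: palgZ.
Qed.

(** The mean is the covariance identity. For higher moments, Jensen with the squared row norms as
    weights reduces the form to single rows, so the constant does not see the number of rows. *)
Lemma moment_controlled1 (s : R) (K : finType) (W : K -> T -> R)
    (A : K -> pred I) A' :
  0 < s -> (forall j, palg V (A j) (W j)) -> (forall j q, A j q -> A' q) ->
  (forall j j' q, j != j' -> A j q -> ~~ A j' q) ->
  (forall j, subgaussian_moments P s (W j)) ->
  moment_controlled (4 * expR 1 * s) A' 1 W.
Proof.
move=> s0 WA AA' dis sg.
have WA' j : palg V A' (W j) by apply: palgS (WA j) => q; exact: AA'.
split=> // J a; split=> [|p].
  rewrite (Ex_sum indV momV (A := A')) => [|j]; last first.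
    by apply: palgX; apply: palg_sum => k _; exact: palgZ.
  apply: eq_bigr => j _.
  transitivity (Ex (fun w => \sum_k \sum_k' (a j k * a j k') * (W k w * W k' w))).
    apply: eq_Rintegral => w _; rewrite expr2 big_distrlr/=.
    by apply: eq_bigr => k _; apply: eq_bigr => k' _; rewrite mulrACA.
  rewrite (Ex_sum indV momV (A := A')) => [|k]; last first.
    by apply: palg_sum => k' _; apply: palgZ; exact: palgM.
  apply: eq_bigr => k _.
  rewrite (Ex_sum indV momV (A := A')) => [|k']; last by apply: palgZ; exact: palgM.
  rewrite (bigD1 k)//= big1 ?addr0 => [|k' kk'].
    rewrite (ExZ indV momV _ (palgM (WA' k) (WA' k))) -expr2.
    have [_ h _] := sg k; rewrite -[RHS]mulr1 -[in RHS]h; congr (_ * _).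
  rewrite (ExZ indV momV _ (palgM (WA' k) (WA' k'))).
  rewrite (palg_indep indV momV (A := A k) (B := A k'))// => [|q]; last first.
    by apply: dis; rewrite eq_sym.
  by have [-> _ _] := sg k; rewrite mul0r mulr0.
set c := 4 * expR 1 * s.
have c0 : 0 <= c by rewrite !mulr_ge0 ?expR_ge0// ltW.
pose N j := \sum_k a j k ^+ 2.
pose y j w := (\sum_k a j k * W k w) ^+ 2.
have yA j : palg V A' (y j).
  by apply: palgX; apply: palg_sum => k _; exact: palgZ.
have N0 j : 0 <= N j by apply: sumr_ge0 => k _; exact: sqr_ge0.
have yb j r : Ex (fun w => y j w ^+ r) <= (c * r%:R * N j) ^+ r.
  apply: le_trans (linear_form_moment indV momV (a j) r s0 WA dis sg).
  by rewrite le_eqVlt; apply/orP; left; apply/eqP/eq_Rintegral => w _; rewrite exprM.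
case: p => [|p].
  rewrite !muln0 !expr0 mulr1 -[leRHS](Ex_cst P 1) le_eqVlt; apply/orP; left; apply/eqP.
  by apply: eq_Rintegral => w _; rewrite expr0.
apply: (@le_trans _ _ (Ex (fun w => sqnorm a ^+ p * \sum_j N j * (y j w / N j) ^+ p.+1))).
  apply: (Ex_le indV momV (A := A')).
  - by apply: palgX; exact: palg_qform.
  - apply: palgZ; apply: palg_sum => j _; apply: palgZ; apply: palgX.
    by apply: palgM => //; exact: palgC.
  - move=> w; apply: jensen_pow => //; first by move=> j; exact: sqr_ge0.
    move=> j Nj0; rewrite /y big1 ?expr0n// => k _.
    have /eqP : a j k ^+ 2 = 0 by apply: (psumr_eq0P (P := predT) _ Nj0) => // i _; exact: sqr_ge0.
    by rewrite sqrf_eq0 => /eqP ->; rewrite mul0r.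
have yNA j : palg V A' (fun w => N j * (y j w / N j) ^+ p.+1).
  by apply: palgZ; apply: palgX; apply: palgM => //; exact: palgC.
rewrite (ExZ indV momV (A := A')); last by apply: palg_sum.
rewrite (Ex_sum indV momV (A := A'))//.
have h j : Ex (fun w => N j * (y j w / N j) ^+ p.+1) <= N j * (c * p.+1%:R) ^+ p.+1.
  have [e|n] := eqVneq (N j) 0.
    rewrite e mul0r -[leRHS](Ex_cst P 0) le_eqVlt; apply/orP; left; apply/eqP.
    by apply: eq_Rintegral => w _; rewrite mul0r.
  have -> : Ex (fun w => N j * (y j w / N j) ^+ p.+1) = N j * N j ^- p.+1 * Ex (fun w => y j w ^+ p.+1).
    rewrite -(ExZ indV momV _ (palgX p.+1 (yA j))); apply: eq_Rintegral => w _.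
    by rewrite expr_div_n -mulrA [_ / _]mulrC.
  rewrite -mulrA ler_wpM2l//; apply: le_trans (ler_wpM2l _ (yb j p.+1)) _.
    by rewrite invr_ge0 exprn_ge0.
  by rewrite [in leLHS]exprMn mulrCA mulVf ?mulr1// expf_neq0.
apply: le_trans (ler_wpM2l _ (ler_sum _ (fun j _ => h j))) _.
  by rewrite exprn_ge0// sqnorm_ge0.
by rewrite -mulr_suml -/(sqnorm a) mulrA -exprSr mulrC mul1n.
Qed.

(* Conditionally on om, the form is a sum of squares of linear forms in eta,
   whose total squared norm is again a form in om with the same sqnorm. *)
Lemma moment_controlledM (c : R) (n1 n2 m : nat) (A1 A2 : pred I)
    (eta : 'I_n1 -> T -> R) (om : 'I_n2 -> T -> R) (om3 : 'I_(n1 * n2) -> T -> R) :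
  0 <= c -> (forall q, A1 q -> ~~ A2 q) ->
  moment_controlled c A1 1 eta -> moment_controlled c A2 m om ->
  (forall b k w, om3 (mxvec_index b k) w = eta b w * om k w) ->
  moment_controlled c [predU A1 & A2] m.+1 om3.
Proof.
move=> c0 dis [etaA eta_c] [omA om_c] om3E.
have sumE (F : 'I_(n1 * n2) -> R) : \sum_x F x = \sum_b \sum_k F (mxvec_index b k).
  rewrite pair_bigA/= (reindex (fun x : 'I_n1 * 'I_n2 => mxvec_index x.1 x.2))//=.
  have [g gK1 gK2] := curry_mxvec_bij n1 n2.
  by exists g => x _; [rewrite -[RHS]gK1|rewrite -[RHS]gK2]; case: (g x) || case: x.
split.
  move=> x; case/mxvec_indexP: x => b k.
  apply: (palg_ext (f := fun w => eta b w * om k w)); last by move=> w; rewrite om3E.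
  apply: palgM; [apply: palgS (etaA b) => q h|apply: palgS (omA k) => q h].
    by apply/orP; left.
  by apply/orP; right.
move=> J a.
pose h (jb : J * 'I_n1) (k : 'I_n2) : R := a jb.1 (mxvec_index jb.2 k).
have hN : sqnorm h = sqnorm a.
  rewrite /sqnorm -(pair_bigA _ (fun j b => \sum_k h (j, b) k ^+ 2))/=.
  by apply: eq_bigr => j _; rewrite sumE.
pose H j b w := \sum_k h (j, b) k * om k w.
have HN w : sqnorm (fun j b => H j b w) = qform h (om ^~ w).
  by rewrite /sqnorm pair_bigA/=; apply: eq_bigr => -[j b] _.
(* The new factor is read at [w'], the earlier ones at [w]; [decouple] integrates out [w'] with [w]
   fixed. *)
pose F p w' w := qform (fun j b => H j b w) (eta ^~ w') ^+ p.
have FE p w : qform a (om3 ^~ w) ^+ p = F p w w.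
  congr (_ ^+ p); apply: eq_bigr => j _; congr (_ ^+ 2); rewrite sumE.
  apply: eq_bigr => b _; rewrite mulr_suml; apply: eq_bigr => k _.
  by rewrite om3E mulrA mulrAC.
have Fb p : bialg V A1 A2 (F p).
  apply: bialgX; apply: bialg_sum => j; apply: bialgX; apply: bialg_sum => b.
  apply: bialgM; last exact: bialgL.
  by apply: bialgR; apply: palg_sum => k _; exact: palgZ.
have [eta1 etap] := (fun w => (eta_c _ (fun j b => H j b w)).1,
                     fun w => (eta_c _ (fun j b => H j b w)).2).
have dF p := decouple indV momV dis (Fb p).
have qA : palg V A2 (fun w => qform h (om ^~ w)) by exact: palg_qform.
split=> [|p].
  transitivity (Ex (fun w => F 1%N w w)).
    by apply: eq_Rintegral => w _; rewrite -FE expr1.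
  have [_ _ _ ->] := dF 1%N.
  transitivity (Ex (fun w => qform h (om ^~ w))); last by have [-> _] := om_c _ h.
  by apply: eq_Rintegral => w _; rewrite -HN -eta1; apply: eq_Rintegral => w' _; rewrite /F expr1.
have -> : Ex (fun w => qform a (om3 ^~ w) ^+ p) = Ex (fun w => F p w w).
  by apply: eq_Rintegral => w _; rewrite -FE.
have [_ FB _ ->] := dF p.
have qpA : palg V A2 (fun w => (c * p%:R) ^+ p * qform h (om ^~ w) ^+ p).
  by apply: palgZ; exact: palgX.
apply: le_trans (Ex_le indV momV FB qpA _) _.
  by move=> w; have := etap w p; rewrite mul1n HN.
rewrite (ExZ indV momV _ (palgX p qA)).
have [_ /(_ p) hp] := om_c _ h.
apply: le_trans (ler_wpM2l _ hp) _; first by rewrite exprn_ge0// mulr_ge0.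
by rewrite hN mulrA -exprD mulSn.
Qed.

End KhatriRaoMoments.

Section KrpMoments.
Local Open Scope classical_set_scope.
Context {R : realType} {disp : measure_display} {T : measurableType disp}.
Variable P : probability T R.
Notation Ex f := (Rintegral P setT f).
Variables (I : finType) (V : I -> T -> R).
Hypothesis indV : independent_family P V.
Hypothesis momV : forall q k, rintegrable P (fun w => V q w ^+ k).

Lemma moment_controlledS (c : R) (K : finType) (A B : pred I) m (om : K -> T -> R) :
  (forall q, A q -> B q) -> moment_controlled P V c A m om ->
  moment_controlled P V c B m om.
Proof. by move=> AB [omA h]; split=> // k; apply: palgS (omA k). Qed.

Context {d : nat} (n : 'I_d -> nat) (l : nat).
Variables (md : I -> 'I_d) (rw : I -> nat) (cl : I -> 'I_l).
Variable W : forall j : 'I_d, 'I_(n j) -> 'I_l -> T -> R.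

(** Serves as the support of one matrix entry. The row is a plain number because its range depends
    on the mode. *)
Definition entry_at (j : 'I_d) (a : nat) (b : 'I_l) : pred I :=
  fun q => [&& md q == j, rw q == a & cl q == b].

(** Induction on the modes, one Kronecker factor at a time. The support also records the column,
    which later makes distinct columns of the sketch independent. *)
Lemma krp_controlled (sg : R) (s : seq 'I_d) (b : 'I_l) : 0 < sg -> uniq s ->
  (forall j (a : 'I_(n j)), j \in s -> palg V (entry_at j a b) (W a b)) ->
  (forall j (a : 'I_(n j)), j \in s -> subgaussian_moments P sg (W a b)) ->
  moment_controlled P V (4 * expR 1 * sg)
    (fun q => (md q \in s) && (cl q == b)) (size s)
    (fun x w => krp (fun j => \matrix_(a, b) W a b w : 'M[R]_(n j, l)) s x b).
Proof.
move=> sg0; elim: s => [_ _ _|j s IHs /= /andP[js us] hA hs].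
  split=> [k|J a].
    by apply: palg_ext (palgC _ _ 1) _ => w; rewrite mxE.
  have qE : qform a (fun k => (const_mx 1 : 'M[R]_(1, l)) k b) = sqnorm a.
    apply: eq_bigr => i _; rewrite !big_ord1 mxE mulr1//.
  split=> [|p].
    by rewrite -[RHS](Ex_cst P) -qE.
  rewrite mul0n expr0 mul1r -[leRHS](Ex_cst P) le_eqVlt; apply/orP; left; apply/eqP.
  by apply: eq_Rintegral => w _; rewrite qE.
have c0 : 0 <= 4 * expR 1 * sg by rewrite !mulr_ge0 ?expR_ge0// ltW.
have IH := IHs us (fun j' a js' => hA j' a (mem_behead (s := j :: s) js'))
  (fun j' a js' => hs j' a (mem_behead (s := j :: s) js')).
pose A1 : pred I := fun q => (md q == j) && (cl q == b).
have H1 : moment_controlled P V (4 * expR 1 * sg) A1 1 (fun a => W (j := j) a b).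
  apply: (moment_controlled1 indV momV (A := fun a : 'I_(n j) => entry_at j a b)) => //.
  - by move=> a; apply: hA; rewrite mem_head.
  - by move=> a q /and3P[h _ h']; apply/andP.
  - move=> a a' q aa' /and3P[_ /eqP h _]; apply/negP => /and3P[_ /eqP h' _].
    by case/eqP: aa'; apply: val_inj; rewrite /= -h -h'.
  - by move=> a; apply: hs; rewrite mem_head.
have dis q : A1 q -> ~~ ((md q \in s) && (cl q == b)).
  by move=> /andP[/eqP -> _]; rewrite (negPf js).
have := moment_controlledM indV momV c0 dis H1 IH.
move=> /(_ (fun x w => krp (fun j => \matrix_(a, b) W a b w : 'M[R]_(n j, l)) (j :: s) x b)) h.
apply: moment_controlledS (h _); last first.
  by move=> a k w; rewrite /= /khatri_rao !mxE mxvecE !mxE big_ord1 !mxE.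
move=> q /orP[] /andP[h1 h2]; apply/andP; split=> //; rewrite inE.
  by rewrite h1.
by apply/orP; right.
Qed.
End KrpMoments.

Lemma expn_le_fact_expR {R : realType} k : (k ^ k)%:R <= k`!%:R * expR k%:R :> R.
Proof.
case: k => [|k]; first by rewrite expn0 fact0 expR0 mulr1.
have /(le_trans _) := expR_ge1Dxn k (ler0n R k.+1).
move=> /(_ (k.+1%:R ^+ k.+1 / k.+1`!%:R)); rewrite lerDr ler01 => /(_ isT).
by rewrite ler_pdivrMr ?ltr0n ?fact_gt0// natrX mulrC.
Qed.

Lemma geometric_le2 {R : realFieldType} (x : R) k : 0 <= x <= 2^-1 ->
  \sum_(i < k) x ^+ i <= 2.
Proof.
move=> /andP[x0 x2]; elim: k => [|k IHk]; first by rewrite big_ord0.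
rewrite big_ord_recl expr0.
under eq_bigr do rewrite exprS; rewrite -mulr_sumr.
have := ler_pM x0 (sumr_ge0 _ (fun i _ => exprn_ge0 (val i) x0)) x2 IHk.
rewrite mulVf ?pnatr_eq0// => h.
by apply: le_trans (lerD (lexx 1) h) _; rewrite -[2]/(1 + 1).
Qed.

(** With no first-order term, the truncated series departs from 1 only at order t^2. The whole
    series of these bounds may diverge; the condition linking [t] and [p] makes the terms up to
    order [p] decay geometrically. *)
Lemma moment_series_bound {R : realType} (c t : R) (m p : nat) (b : nat -> R) :
  0 <= c -> 0 < t -> b 0%N <= 1 -> b 1%N <= 0 ->
  (forall k, (1 < k)%N -> b k <= 2 * (c * k%:R) ^+ (m.+1 * k) / k`!%:R) ->
  2 * expR 1 * (4 * c) ^+ m.+1 * t * p%:R ^+ m <= 1 ->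
  \sum_(k < p.+1) b k * t ^+ k <= 1 + (2 * expR 1 * (4 * c) ^+ m.+1 * t) ^+ 2.
Proof.
move=> c0 t0 b0 b1 bk; set Dt := _ * t => Dtp.
have [g gE] : exists g, g = expR 1 * c ^+ m.+1 * t by exists (expR 1 * c ^+ m.+1 * t).
have g0 : 0 <= g by rewrite gE !mulr_ge0 ?expR_ge0 ?exprn_ge0 ?(ltW t0).
have DtE : Dt = 2 * 4 ^+ m.+1 * g by rewrite /Dt gE exprMn; ring.
have Dt0 : 0 <= Dt by rewrite DtE !mulr_ge0 ?exprn_ge0.
case: p Dtp => [|p] Dtp.
  by rewrite big_ord1 expr0 mulr1 (le_trans b0)// lerDl sqr_ge0.
rewrite 2!big_ord_recl expr0 mulr1 expr1 addrA lerD//.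
  by rewrite (le_trans _ b0)// gerDl mulr_le0_ge0// ltW.
have [x xE] : exists x, x = g * 4 ^+ m * p.+1%:R ^+ m by exists (g * 4 ^+ m * p.+1%:R ^+ m).
have x0 : 0 <= x by rewrite xE !mulr_ge0 ?exprn_ge0.
have x2 : x <= 2^-1.
  have : 8 * x <= 1.
    by apply: le_trans Dtp; rewrite DtE xE exprS; rewrite le_eqVlt; apply/orP; left; apply/eqP; ring.
  by lra.
have term (i : 'I_p) : b (bump 0 (bump 0 i)) * t ^+ bump 0 (bump 0 i) <=
    2 * g ^+ 2 * 4 ^+ m * x ^+ i.
  rewrite /bump !leq0n !add1n; set k := i.+2.
  have kp : (k <= p.+1)%N by rewrite ltnS ltn_ord.
  apply: (@le_trans _ _ (2 * (g * k%:R ^+ m) ^+ k)).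
    apply: (@le_trans _ _ (2 * (c * k%:R) ^+ (m.+1 * k) / k`!%:R * t ^+ k)).
      by rewrite ler_wpM2r ?exprn_ge0 ?bk// ltW.
    rewrite -2!mulrA ler_wpM2l// [_^-1 * _]mulrC mulrA exprM -exprMn.
    rewrite ler_pdivrMr ?ltr0n ?fact_gt0//.
    have -> : (c * k%:R) ^+ m.+1 * t = t * c ^+ m.+1 * k%:R ^+ m * k%:R.
      by rewrite exprMn [k%:R ^+ m.+1]exprSr; ring.
    have -> : g * k%:R ^+ m = t * c ^+ m.+1 * k%:R ^+ m * expR 1.
      by rewrite gE; ring.
    have u0 : 0 <= t * c ^+ m.+1 * k%:R ^+ m.
      by rewrite !mulr_ge0 ?exprn_ge0// ltW.
    move: u0; set u := t * _ * _ => u0.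
    rewrite [in leLHS]exprMn [in leRHS]exprMn -(mulrA (u ^+ k)).
    rewrite (@ler_wpM2l _ (u ^+ k))// ?exprn_ge0//.
    by rewrite -natrX -expRM_natl mulr1 mulrC expn_le_fact_expR.
  (* Two of the [k] powers of k^m are bounded through k <= 2^(k-1), the other k-2 through k being at
     most the truncation order; what remains is geometric of ratio [x]. *)
  have -> : (g * k%:R ^+ m) ^+ k =
      g ^+ 2 * g ^+ i * ((k%:R ^+ m) ^+ 2 * (k%:R ^+ m) ^+ i).
    by rewrite -!exprD -exprMn.
  have -> : 2 * g ^+ 2 * 4 ^+ m * x ^+ i =
      2 * (g ^+ 2 * g ^+ i * (4 ^+ m * (4 ^+ m) ^+ i * (p.+1%:R ^+ m) ^+ i)).
    rewrite xE !exprMn; set u := (4 ^+ m) ^+ i; set v := g ^+ i; set z := _ ^+ i.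
    by ring.
  rewrite ler_wpM2l// ler_wpM2l ?mulr_ge0 ?exprn_ge0// ler_pM ?mulr_ge0 ?exprn_ge0//.
    rewrite -exprS -!exprM mulnC [(m * i.+1)%N]mulnC !exprM.
    rewrite lerXn2r ?nnegrE ?exprn_ge0//.
    rewrite [4](_ : _ = 2 ^+ 2); last by ring.
    rewrite -exprM mulnC exprM lerXn2r ?nnegrE ?exprn_ge0//.
    by rewrite -natrX ler_nat /k; elim: (val i) => // u; rewrite [(2 ^ u.+2)%N]expnS; lia.
  by rewrite -!exprM lerXn2r ?nnegrE// ler_nat.
apply: le_trans (ler_sum _ (fun i _ => term i)) _.
rewrite -mulr_sumr; apply: le_trans (ler_wpM2l _ (geometric_le2 p (x := x) _)) _.
- by rewrite !mulr_ge0 ?exprn_ge0.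
- by rewrite x0.
rewrite DtE [4 ^+ m.+1]exprS; set q := 4 ^+ m.
have q1 : 1 <= q by rewrite exprn_ege1// ler1n.
have -> : (2 * (4 * q) * g) ^+ 2 = 64 * (g ^+ 2 * q * q) by ring.
have g2 : 0 <= g ^+ 2 * q by rewrite mulr_ge0 ?sqr_ge0// exprn_ge0.
have := ler_peMr g2 q1; lra.
Qed.

(** * Concentration of the sketched norm *)
Section Concentration.
Local Open Scope classical_set_scope.
Context {R : realType} {disp : measure_display} {T : measurableType disp}.
Variable P : probability T R.
Notation Ex f := (Rintegral P setT f).
Variables (I : finType) (V : I -> T -> R).
Hypothesis indV : independent_family P V.
Hypothesis momV : forall q k, rintegrable P (fun w => V q w ^+ k).

(** Markov's inequality. The order is even so that |f|^p is itself a polynomial in the entries. *)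
Lemma even_moment_tail (A : pred I) (f : T -> R) (dev y : R) p : palg V A f ->
  ~~ odd p -> 0 < dev -> Ex (fun w => f w ^+ p) <= y ->
  measurable [set w | dev < `|f w|] /\
  (P [set w | (dev < `|f w|)%R] <= (y / dev ^+ p)%:E)%E.
Proof.
move=> fA pe dev0 fy; set E := [set w | _].
have mf : measurable_fun setT f by exact: (palg_measurable indV momV fA).
have mE : measurable E.
  have mn : measurable_fun setT (fun w => `|f w|) by exact: measurableT_comp.
  have mI : measurable (`]dev, +oo[ : set R) by exact: measurable_itv.
  have := mn measurableT _ mI; rewrite setTI.
  by congr (measurable _); apply/seteqP; split=> w; rewrite /E /= in_itv/= andbT.
split=> //.
have PE : P E = (fine (P E))%:E by rewrite fineK// fin_num_measure.
rewrite PE lee_fin ler_pdivlMr ?exprn_gt0//; apply: le_trans fy.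
have iE : rintegrable P (\1_E : T -> R) by exact: integrable_indic.
have -> : fine (P E) * dev ^+ p = Ex (fun w => dev ^+ p * \1_E w).
  rewrite RintegralZl// mulrC; congr (_ * _).
  by rewrite /Rintegral integral_indic// setIT.
apply: le_Rintegral => //.
- exact: rintegrableZ.
- exact: (palg_integrable indV momV (palgX p fA)).
move=> w _; rewrite indicE; have [|_] := boolP (w \in E).
  rewrite inE => /= /ltW h; rewrite mulr1 -(ger0_norm (_ : 0 <= f w ^+ p)).
    by rewrite normrX lerXn2r ?nnegrE// ltW.
  by rewrite exprn_even_ge0.
by rewrite mulr0 exprn_even_ge0.
Qed.

(** Bernstein's argument at a fixed order [p], over columns with disjoint supports. The two terms of
    [x] are the Gaussian regime and the heavy-tailed regime. *)
Lemma krp_concentration (c : R) (m l p : nat) (K J : finType) (A : 'I_l -> pred I)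
    (om : 'I_l -> K -> T -> R) (a : J -> K -> R) :
  1 <= c -> (0 < p)%N -> ~~ odd p -> (0 < l)%N ->
  (forall i i' q, i != i' -> A i q -> ~~ A i' q) ->
  (forall i, moment_controlled P V c (A i) m.+1 (om i)) ->
  let x := Num.max (Num.sqrt (p%:R * l%:R)) (p%:R ^+ m.+1) in
  exists E, [/\ measurable E, (P E <= (expR (- p%:R))%:E)%E &
    forall w, ~ E w ->
      `|\sum_i qform a (om i ^~ w) - l%:R * sqnorm a| <=
        expR 1 * (expR 1 * (2 * expR 1 * (4 * c) ^+ m.+1) * x) * sqnorm a].
Proof.
move=> c1 p0 pe l0 dis ctl x.
have c0 : 0 <= c by apply: le_trans c1.
have [N0|Nn] := eqVneq (sqnorm a) 0.
  exists set0; rewrite measure0 lee_fin expR_ge0; split=> // w _.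
  rewrite N0 !mulr0 subr0 big1 ?normr0// => i _.
  rewrite /qform big1// => j _; rewrite big1 ?expr0n// => k _.
  have a0 i' j' : 0 <= a i' j' ^+ 2 by exact: sqr_ge0.
  have Nj : \sum_k a j k ^+ 2 = 0.
    by apply: (psumr_eq0P (P := predT) _ N0) => // i' _; apply: sumr_ge0.
  have /eqP : a j k ^+ 2 = 0 by apply: (psumr_eq0P (P := predT) _ Nj).
  by rewrite sqrf_eq0 => /eqP ->; rewrite mul0r.
set N := sqnorm a in Nn *.
have Np : 0 < N by rewrite lt_def Nn sqnorm_ge0.
pose Z i w := N^-1 * qform a (om i ^~ w).
have ZA i : palg V (A i) (Z i).
  by apply: palgZ; apply: palg_qform; have [] := ctl i.
have Z0 i w : 0 <= Z i w by rewrite mulr_ge0 ?invr_ge0 ?qform_ge0// ltW.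
have ZX i k : Ex (fun w => Z i w ^+ k) <= (c * k%:R) ^+ (m.+1 * k).
  have [omA /(_ J a)[_ /(_ k) h]] := ctl i.
  have -> : Ex (fun w => Z i w ^+ k) = N ^- k * Ex (fun w => qform a (om i ^~ w) ^+ k).
    rewrite -(ExZ indV momV _ (palgX k (palg_qform a omA))).
    by apply: eq_Rintegral => w _; rewrite /Z exprMn exprVn.
  apply: le_trans (ler_wpM2l _ h) _; first by rewrite invr_ge0 exprn_ge0// ltW.
  by rewrite mulrCA mulVf ?mulr1// expf_neq0.
have Z1 i : Ex (Z i) = 1.
  have [omA /(_ J a)[h _]] := ctl i.
  by rewrite (ExZ indV momV _ (palg_qform a omA)) h mulVf.
pose X i w := Z i w - 1.
have XA i : palg V (A i) (X i) by apply: palgB => //; exact: palgC.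
(* Order one vanishes by centring. From order two on, |Z - 1|^k <= 1 + Z^k for Z >= 0, and both
   terms are below the moment bound of Z since c >= 1, whence the factor 2. *)
pose b k : R := if k == 0%N then 1 else if k == 1%N then 0
   else 2 * (c * k%:R) ^+ (m.+1 * k) / k`!%:R.
have hb (i : 'I_l) k : (k <= p)%N -> `|Ex (fun w => X i w ^+ k)| <= k`!%:R * b k.
  move=> _; rewrite /b; case: k => [|[|k]].
  - rewrite /= mulr1 (_ : Ex _ = 1) ?normr1//.
    by rewrite -[RHS](Ex_cst P); apply: eq_Rintegral => w _; rewrite expr0.
  - rewrite /= mulr0 (_ : Ex _ = 0) ?normr0//.
    transitivity (Ex (fun w => Z i w + (-1))).
      by apply: eq_Rintegral => w _; rewrite expr1.
    by rewrite (ExD indV momV (ZA i) (palgC _ _ (-1))) Z1 Ex_cst subrr.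
  rewrite /= mulrCA mulfV ?mulr1 ?pnatr_eq0 -?lt0n ?fact_gt0//.
  set M := (c * k.+2%:R) ^+ (m.+1 * k.+2).
  have M1 : 1 <= M.
    by rewrite exprn_ege1// mulr_ege1// ler1n.
  have hZ : Ex (fun w => 1 + Z i w ^+ k.+2) <= 2 * M.
    rewrite (ExD indV momV (palgC _ _ 1) (palgX k.+2 (ZA i))) Ex_cst.
    by rewrite mulr_natl mulr2n lerD// ZX.
  have pA : palg V (A i) (fun w => 1 + Z i w ^+ k.+2).
    by apply: palgD; [exact: palgC|exact: palgX].
  have bnd w : `|X i w ^+ k.+2| <= 1 + Z i w ^+ k.+2.
    rewrite normrX /X; have [z1|z1] := lerP (Z i w) 1.
      apply: (@le_trans _ _ 1); last by rewrite lerDl exprn_ge0.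
      by apply: exprn_ile1; have := Z0 i w; lra.
    apply: (@le_trans _ _ (Z i w ^+ k.+2)); last by rewrite lerDr.
    by rewrite lerXn2r ?nnegrE ?Z0//; have := Z0 i w; lra.
  rewrite ler_norml; apply/andP; split.
    rewrite lerNl; apply: le_trans hZ.
    rewrite -mulN1r -(ExZ indV momV (-1) (palgX k.+2 (XA i))).
    apply: (Ex_le indV momV (A := A i)) => //; first by apply: palgZ; exact: palgX.
    by move=> w; rewrite mulN1r (le_trans _ (bnd w))// -normrN ler_norm.
  apply: le_trans hZ; apply: (Ex_le indV momV (A := A i)) => //; first exact: palgX.
  by move=> w; rewrite (le_trans _ (bnd w))// ler_norm.
pose D := 2 * expR 1 * (4 * c) ^+ m.+1.
have D0 : 0 < D.
  rewrite /D mulr_gt0 ?mulr_gt0 ?expR_gt0// exprn_gt0// mulr_gt0//.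
  exact: lt_le_trans c1.
have pR : 0 < p%:R :> R by rewrite ltr0n.
have lR : 0 < l%:R :> R by rewrite ltr0n.
have xp : p%:R ^+ m.+1 <= x by rewrite /x le_max lexx orbT.
have xs : p%:R * l%:R <= x ^+ 2.
  rewrite -[leLHS]sqr_sqrtr ?mulr_ge0//.
  by rewrite lerXn2r ?nnegrE ?sqrtr_ge0//; rewrite /x le_max ?sqrtr_ge0 ?lexx.
have x0 : 0 < x by rewrite (lt_le_trans _ xp)// exprn_gt0.
clearbody x.
(* x >= p^(m+1) gives D t p^m <= 1, as [moment_series_bound] requires; x^2 >= p l bounds each factor
   by exp(p / l), hence the product over the l columns by exp p. *)
pose t := p%:R / (D * x).
have t0 : 0 < t by rewrite divr_gt0// mulr_gt0.
have Dt : D * t = p%:R / x by rewrite /t; field; rewrite !gt_eqF.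
have Fb : \sum_(k < p.+1) b k * t ^+ k <= expR (p%:R / l%:R).
  apply: le_trans (moment_series_bound (c := c) (m := m) _ t0 _ _ _ _) _ => //.
  - by move=> k; rewrite /b; case: k => [|[|k]].
  - rewrite -/D Dt mulrAC -exprS ler_pdivrMr// mul1r//.
  rewrite -/D Dt; apply: le_trans (expR_ge1Dx _); rewrite lerD2l.
  rewrite expr_div_n ler_pdivrMr ?exprn_gt0// mulrAC ler_pdivlMr//.
  by rewrite expr2 -mulrA ler_wpM2l// ltW.
have := moment_recursion indV momV (enum_uniq 'I_l) XA dis t0 hb (leqnn _).
rewrite big_enum /= prodr_const card_ord.
pose S w := \sum_i X i w.
rewrite (_ : Ex _ = Ex (fun w => S w ^+ p)); last first.
  by apply: eq_Rintegral => w _; rewrite big_enum.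
move=> /(le_trans (ler_norm _)) hS.
have {}hS : Ex (fun w => S w ^+ p) <= (expR 1 * D * x) ^+ p.
  apply: le_trans hS _.
  have Fl : (\sum_(k < p.+1) b k * t ^+ k) ^+ l <= expR 1 ^+ p.
    rewrite -expRM_natl mulr1; apply: (@le_trans _ _ (expR (p%:R / l%:R) ^+ l)).
      rewrite lerXn2r ?nnegrE ?expR_ge0// sumr_ge0// => k _.
      rewrite mulr_ge0 ?exprn_ge0 ?(ltW t0)// /b; case: eqP => // _; case: eqP => // _.
      by rewrite !mulr_ge0 ?invr_ge0 ?exprn_ge0// mulr_ge0.
    by rewrite -expRM_natl mulrC divfK// gt_eqF.
  apply: le_trans (ler_wpM2l _ Fl) _.
    by rewrite mulr_ge0// invr_ge0 exprn_ge0// ltW.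
  have pp : p`!%:R <= p%:R ^+ p :> R by rewrite -natrX ler_nat fact_le_expn.
  apply: (@le_trans _ _ (p%:R ^+ p * (t ^- p * expR 1 ^+ p))).
    rewrite -mulrA ler_wpM2r//.
    by rewrite mulr_ge0 ?exprn_ge0 ?invr_ge0 ?exprn_ge0 ?expR_ge0// ltW.
  rewrite -exprVn -!exprMn le_eqVlt; apply/orP; left; apply/eqP; congr (_ ^+ _).
  by rewrite /t invf_div; field; rewrite gt_eqF.
have SA : palg V predT S by apply: palg_sum => i _; apply: palgS (XA i).
(* The p-th moment is at most (exp(1) D x)^p; one more factor exp(1) in the threshold turns Markov's
   bound into exp(-p). *)
pose dev := expR 1 * (expR 1 * D * x).
have y0 : 0 < expR 1 * D * x by apply: mulr_gt0 => //; apply: mulr_gt0 => //; exact: expR_gt0.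
have dev0 : 0 < dev by rewrite mulr_gt0// expR_gt0.
have [mE PE] := even_moment_tail SA pe dev0 hS.
exists [set w | dev < `|S w|]; split=> //.
  apply: le_trans PE _; rewrite lee_fin -exprVn -exprMn /dev.
  rewrite invfM mulrCA mulfV ?gt_eqF// mulr1 -expRN -expRM_natl mulrN1 lexx//.
move=> w /= /negP; rewrite -leNgt => h.
have -> : \sum_i qform a (om i ^~ w) - l%:R * N = S w * N.
  rewrite /S sumrB mulrBl sumr_const card_ord mulr_suml; congr (_ - _).
  by apply: eq_bigr => i _; rewrite /Z mulrAC mulVf ?mul1r.
by rewrite normrM (ger0_norm (ltW Np)) ler_wpM2r// ltW.
Qed.

End Concentration.

(** * Moments from the sub-Gaussian norm *)
Lemma fact_sqr_le j : (j`! * j`! <= (2 * j)`!)%N.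
Proof.
elim: j => // j IHj; rewrite (mulnS 2 j) add2n !factS.
have : ((j.+1 * j.+1) * (j`! * j`!) <= ((2 * j).+2 * (2 * j).+1) * (2 * j)`!)%N.
  by apply: leq_mul => //; nia.
by rewrite mulnACA !mulnA.
Qed.

Lemma factS_sqr_le j : (j.+1`! * j.+1`! <= (2 * j).+1`!)%N.
Proof.
elim: j => // j IHj; rewrite (mulnS 2 j) !add2n [j.+2`!]factS [_.+3`!]factS [_.+2`!]factS.
have : ((j.+2 * j.+2) * (j.+1`! * j.+1`!) <= ((2 * j).+3 * (2 * j).+2) * (2 * j).+1`!)%N.
  by apply: leq_mul => //; nia.
by rewrite mulnACA !mulnA.
Qed.

Lemma sum_pairs {V : nmodType} (e : nat -> V) n :
  \sum_(k < 2 * n) e k = \sum_(j < n) (e (2 * j)%N + e (2 * j).+1).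
Proof.
elim: n => [|n IHn]; first by rewrite muln0 !big_ord0.
by rewrite mulnS add2n !big_ord_recr/= IHn addrA.
Qed.

Lemma exp_partial_sum {R : realType} (u : R) n : 0 <= u ->
  \sum_(j < n) u ^+ j / j`!%:R <= expR u.
Proof.
move=> u0; have nd : nondecreasing_seq (series (exp_coeff u)).
  by apply/nondecreasing_seqP => k; rewrite seriesEnat/= big_nat_recr//= lerDl exp_coeff_ge0.
have := nondecreasing_cvgn_le nd (is_cvg_series_exp_coeff u) n.
by rewrite /series/= big_mkord.
Qed.

Section Subgaussian.
Local Open Scope classical_set_scope.
Context {R : realType} {disp : measure_display} {T : measurableType disp}.
Variable P : probability T R.
Notation Ex f := (Rintegral P setT f).

(** With u = 4 K^2 x^2, even orders 2j contribute at most 2 u^j / j!, and odd orders are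
    interpolated between their even neighbours. Orders 0 and 1 give exactly 1, so the sum is at most
    1 + 4 (exp u - 1) <= exp(4 u), and 4 u = 16 K^2 x^2. *)
Lemma sketch_entry_moments (K : R) (X : {RV P >-> R}) : 1 <= K -> sketch_entry K X ->
  (forall k, rintegrable P (fun w => X w ^+ k)) /\
  subgaussian_moments P (16 * K ^+ 2) X.
Proof.
move=> K1 [EX VX psiX].
have K0 : 0 < K by apply: lt_le_trans K1.
have [t [t0 tK hexp]] : exists t, [/\ 0 < t, t < 2 * K &
   (\int[P]_w (expR (X w ^+ 2 / t ^+ 2))%:E <= 2%:E)%E].
  (* The infimum need not be attained; doubling [K] makes room for an actual [t]. *)
  have : (psi2_norm X < (2 * K)%:E)%E.
    by apply: le_lt_trans psiX _; rewrite lte_fin; lra.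
  move=> /ereal_inf_lt[_ [t [t0 ht] <-]]; rewrite lte_fin => tK.
  exists t; split=> //; move: ht; rewrite unlock.
  by under eq_integral do rewrite real_normK ?num_real//.
have mX : measurable_fun setT X by exact: measurable_funP.
pose B := 4 * K ^+ 2.
have B0 : 0 <= B by rewrite mulr_ge0// exprn_ge0// ltW.
have tB : t ^+ 2 <= B.
  have -> : B = (2 * K) ^+ 2 by rewrite /B; ring.
  by rewrite lerXn2r ?nnegrE ?(ltW t0) ?(ltW tK)// mulr_ge0// ltW.
pose g w := expR (X w ^+ 2 / t ^+ 2).
have g0 w : 0 <= g w by exact: expR_ge0.
have mg : measurable_fun setT g.
  apply: measurableT_comp => //; apply: measurable_funM => //.
  exact: measurable_funX.
have ig : rintegrable P g.
  by apply: rintegrable_ge0 => //; apply: le_lt_trans hexp _; exact: ltry.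
have Eg : Ex g <= 2 by rewrite -lee_fin -EFin_Rintegral.
have even_le w k : X w ^+ (2 * k) <= k`!%:R * B ^+ k * g w.
  have h : X w ^+ (2 * k) <= B ^+ k * (X w ^+ 2 / t ^+ 2) ^+ k.
    rewrite exprM -exprMn; apply: lerXn2r; rewrite ?nnegrE ?sqr_ge0//.
      by apply: mulr_ge0 => //; rewrite mulr_ge0 ?invr_ge0 ?sqr_ge0.
    rewrite mulrCA ler_peMr ?sqr_ge0// ler_pdivlMr ?exprn_gt0// mul1r//.
  apply: le_trans h _; rewrite -mulrA mulrCA ler_wpM2l ?exprn_ge0//.
  have y0 : 0 <= X w ^+ 2 / t ^+ 2 by rewrite mulr_ge0 ?invr_ge0 ?sqr_ge0.
  rewrite -ler_pdivrMl ?ltr0n ?fact_gt0// mulrC.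
  apply: le_trans (exp_partial_sum k.+1 y0).
  rewrite big_ord_recr/= lerDr sumr_ge0// => i _.
  by rewrite mulr_ge0 ?exprn_ge0.
have ieven k : rintegrable P (fun w => X w ^+ (2 * k)).
  apply: (le_integrable measurableT _ _ (rintegrableZ (k`!%:R * B ^+ k) ig)).
    by apply/measurable_EFinP; exact: measurable_funX.
  move=> w _; rewrite /= lee_fin ger0_norm; last by rewrite exprM exprn_ge0 ?sqr_ge0.
  by rewrite (le_trans (even_le w k))// ler_norm.
have Eeven k : Ex (fun w => X w ^+ (2 * k)) <= 2 * k`!%:R * B ^+ k.
  apply: (@le_trans _ _ (Ex (fun w => k`!%:R * B ^+ k * g w))).
    by apply: (le_Rintegral measurableT (ieven k) (rintegrableZ _ ig)) => w _; exact: even_le.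
  rewrite RintegralZl// mulrC -[leRHS]mulrA ler_wpM2r//.
  by rewrite mulr_ge0// exprn_ge0.
have iall k : rintegrable P (fun w => X w ^+ k).
  apply: (le_integrable measurableT _ _ (rintegrableD (rintegrable_cst P 1) (ieven k))).
    by apply/measurable_EFinP; exact: measurable_funX.
  move=> w _; rewrite /= lee_fin mulnC exprM [leRHS]ger0_norm ?addr_ge0 ?sqr_ge0//.
  rewrite -(real_normK (num_real (X w ^+ k))).
  have := normr_ge0 (X w ^+ k); set z := `|_|; nra.
split=> //; split.
- by move: EX; rewrite unlock /Rintegral => ->.
- move: VX; rewrite /variance covariance.unlock EX /= expectation.unlock.
  rewrite (eq_integral (fun w => (X w ^+ 2)%:E)) => [|w _].
    by rewrite /Rintegral => ->.
  by congr (_%:E); rewrite /GRing.mul /= subr0 -expr2.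
move=> p x x0; pose u := B * x ^+ 2.
have u0 : 0 <= u by rewrite mulr_ge0 ?sqr_ge0.
pose e k := `|Ex (fun w => X w ^+ k)| / k`!%:R * x ^+ k.
have e0 k : 0 <= e k by rewrite /e !mulr_ge0 ?invr_ge0 ?exprn_ge0.
pose c j := u ^+ j / j`!%:R.
have c0 j : 0 <= c j by rewrite /c mulr_ge0 ?invr_ge0 ?exprn_ge0.
have fn0 k : k`!%:R != 0 :> R by rewrite pnatr_eq0 -lt0n fact_gt0.
have fp0 k : 0 < k`!%:R :> R by rewrite ltr0n fact_gt0.
have Mx j : Ex (fun w => X w ^+ (2 * j)) * x ^+ (2 * j) <= 2 * j`!%:R * u ^+ j.
  rewrite /u exprMn -exprM mulrA ler_wpM2r ?exprn_ge0//.
have Mx0 j : 0 <= Ex (fun w => X w ^+ (2 * j)).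
  by apply: Rintegral_ge0 => w _; rewrite exprM exprn_ge0 ?sqr_ge0.
have eE j : e (2 * j)%N <= 2 * c j.
  rewrite /e ger0_norm// mulrAC ler_pdivrMr//; apply: le_trans (Mx j) _.
  rewrite /c -2!mulrA ler_wpM2l// mulrC -mulrA ler_wpM2l ?exprn_ge0//.
  rewrite mulrC ler_pdivlMr//.
  by rewrite -natrM ler_nat fact_sqr_le.
have eO j : e (2 * j).+1 <= c j + c j.+1.
  (* With z = |x X|, the inequality 2 z^(2j+1) <= z^(2j) + z^(2j+2) is integrated. *)
  have h : `|Ex (fun w => X w ^+ (2 * j).+1)| * x ^+ (2 * j).+1 <=
      2^-1 * (Ex (fun w => X w ^+ (2 * j)) * x ^+ (2 * j) +
             Ex (fun w => X w ^+ (2 * j.+1)) * x ^+ (2 * j.+1)).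
    have ia : rintegrable P (fun w => `|X w ^+ (2 * j).+1|).
      by have := integrable_norm (iall (2 * j).+1).
    have i1 := rintegrableZ (x ^+ (2 * j).+1) ia.
    have i2 := rintegrableZ (x ^+ (2 * j)) (ieven j).
    have i3 := rintegrableZ (x ^+ (2 * j.+1)) (ieven j.+1).
    have i23 := rintegrableZ 2^-1 (rintegrableD i2 i3).
    apply: (@le_trans _ _ (x ^+ (2 * j).+1 * Ex (fun w => `|X w ^+ (2 * j).+1|))).
      rewrite mulrC ler_wpM2l ?exprn_ge0//.
      by apply: le_normr_Rintegral => //; exact: iall.
    have E1 : Ex (fun w => x ^+ (2 * j).+1 * `|X w ^+ (2 * j).+1|) =
        x ^+ (2 * j).+1 * Ex (fun w => `|X w ^+ (2 * j).+1|).
      exact: (RintegralZl _ measurableT ia).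
    have EZ k : Ex (fun w => x ^+ (2 * k) * X w ^+ (2 * k)) =
        Ex (fun w => X w ^+ (2 * k)) * x ^+ (2 * k).
      by rewrite [RHS]mulrC; exact: (RintegralZl _ measurableT (ieven k)).
    have E4 : Ex (fun w => 2^-1 * (x ^+ (2 * j) * X w ^+ (2 * j) + x ^+ (2 * j.+1) * X w ^+ (2 * j.+1))) =
        2^-1 * (Ex (fun w => X w ^+ (2 * j)) * x ^+ (2 * j) +
             Ex (fun w => X w ^+ (2 * j.+1)) * x ^+ (2 * j.+1)).
      rewrite -!EZ -(RintegralD measurableT i2 i3).
      exact: (RintegralZl _ measurableT (rintegrableD i2 i3)).
    rewrite -E1 -E4; apply: (le_Rintegral measurableT i1 i23) => w _.
    rewrite -[x ^+ (2 * j).+1]ger0_norm ?exprn_ge0// -normrM -!exprMn.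
    rewrite (mulnS 2 j) add2n; set z := x * X w.
    rewrite normrX !exprS !exprM -(real_normK (num_real z)).
    have : 0 <= (`|z| ^+ 2) ^+ j by rewrite exprn_ge0 ?sqr_ge0.
    set v := (_ ^+ 2) ^+ j; have := normr_ge0 z; set z' := `|z| => z0 v0.
    have : 0 <= v * (z' - 1) ^+ 2 by rewrite mulr_ge0 ?sqr_ge0.
    have -> : z * (z * v) = z' ^+ 2 * v by rewrite /z' real_normK ?num_real// expr2 mulrA.
    lra.
  rewrite /e mulrAC ler_pdivrMr//; apply: le_trans h _.
  have h1 := Mx j; have h2 := Mx j.+1.
  rewrite mulrDl; apply: le_trans (ler_wpM2l _ (lerD h1 h2)) _ => //.
  rewrite mulrDr; apply: lerD.
    rewrite !mulrA mulVf ?pnatr_eq0// mul1r /c mulrC -mulrA ler_wpM2l ?exprn_ge0//.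
    rewrite mulrC ler_pdivlMr// -natrM ler_nat (leq_trans (fact_sqr_le j))//.
    by rewrite factS leq_pmull.
  rewrite !mulrA mulVf ?pnatr_eq0// mul1r /c mulrC -mulrA ler_wpM2l ?exprn_ge0//.
  by rewrite mulrC ler_pdivlMr// -natrM ler_nat factS_sqr_le.
apply: (@le_trans _ _ (\sum_(k < 2 * p.+1) e k)).
  rewrite -(big_mkord predT e) -(big_mkord predT e).
  rewrite [leRHS](big_cat_nat (n := p.+1))//=; last by rewrite leq_pmull.
  by rewrite lerDl sumr_ge0.
rewrite sum_pairs big_ord_recl/=.
have -> : e (2 * 0)%N + e (2 * 0).+1 = 1.
  rewrite /e muln0 !expr0 expr1 fact0 divr1 mulr1.
  have -> : Ex (fun w => X w ^+ 0) = 1.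
    by rewrite -[RHS](Ex_cst P); apply: eq_Rintegral => w _; rewrite expr0.
  have -> : Ex (fun w => X w ^+ 1) = 0.
    by move: EX; rewrite expectation.unlock /Rintegral => ->.
  by rewrite normr1 normr0 !mul0r addr0.
have v1 : 1 <= expR u by rewrite (le_trans _ (expR_ge1Dx u))// lerDl.
have S : \sum_(j < p) c j.+1 <= expR u - 1.
  rewrite lerBrDl; apply: le_trans (exp_partial_sum p.+1 u0).
  by rewrite big_ord_recl/= expr0 fact0 divr1.
have S' : \sum_(j < p) c j.+2 <= expR u - 1.
  rewrite lerBrDl; apply: le_trans (exp_partial_sum p.+2 u0).
  rewrite big_ord_recl/= expr0 fact0 divr1 lerD2l big_ord_recl/=.
  by rewrite lerDr mulr_ge0 ?exprn_ge0.
have : \sum_(j < p) (e (2 * bump 0 j)%N + e (2 * bump 0 j).+1) <=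
    \sum_(j < p) (3 * c j.+1 + c j.+2).
  apply: ler_sum => j _; rewrite /bump add1n.
  have := eE j.+1; have := eO j.+1; lra.
rewrite big_split/= [X in _ <= X]big_split/= -mulr_sumr => h.
have -> : 16 * K ^+ 2 * x ^+ 2 = 4%:R * u by rewrite /u /B; ring.
(* Bernoulli's inequality, the tangent of y^4 at 1, taken at y = exp u. *)
rewrite expRM_natl; have := pow_tangent 3 (expR_ge0 u) ler01.
rewrite !expr1n mulr1 => h4; lra.
Qed.
End Subgaussian.

(** * Embedding of a subspace *)
Section SquaredFrobenius.
Context {R : realFieldType}.

Definition nsq m n (A : 'M[R]_(m, n)) : R := \sum_i \sum_j A i j ^+ 2.

Lemma nsq_ge0 m n (A : 'M[R]_(m, n)) : 0 <= nsq A.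
Proof. by apply: sumr_ge0 => i _; apply: sumr_ge0 => j _; exact: sqr_ge0. Qed.

Lemma nsqZ m n c (A : 'M[R]_(m, n)) : nsq (c *: A) = c ^+ 2 * nsq A.
Proof.
rewrite /nsq mulr_sumr; apply: eq_bigr => i _; rewrite mulr_sumr.
by apply: eq_bigr => j _; rewrite mxE exprMn.
Qed.

Lemma nsqN m n (A : 'M[R]_(m, n)) : nsq (- A) = nsq A.
Proof. by rewrite -scaleN1r nsqZ sqrrN expr1n mul1r. Qed.

Lemma nsq_trace m n (A : 'M[R]_(m, n)) : nsq A = \tr (A *m A^T).
Proof.
apply: eq_bigr => i _; rewrite mxE; apply: eq_bigr => j _.
by rewrite mxE expr2.
Qed.

(** Young's inequality with weight 1/10, the mesh of the net: an error of squared norm 1/100 then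
    costs only 11/100. *)
Lemma nsqD_le m n (A B : 'M[R]_(m, n)) : nsq (A + B) <= 11 / 10 * nsq A + 11 * nsq B.
Proof.
rewrite /nsq 2!mulr_sumr -big_split/=; apply: ler_sum => i _.
rewrite 2!mulr_sumr -big_split/=; apply: ler_sum => j _; rewrite mxE.
set a := A i j; set b := B i j.
have := sqr_ge0 (a / 10 - b); rewrite -subr_ge0; nra.
Qed.

Lemma sum_mul_sqr_le (I : finType) (a b : I -> R) :
  (\sum_i a i * b i) ^+ 2 <= (\sum_i a i ^+ 2) * (\sum_i b i ^+ 2).
Proof.
have : 0 <= \sum_i \sum_j (a i * b j - a j * b i) ^+ 2.
  by apply: sumr_ge0 => i _; apply: sumr_ge0 => j _; exact: sqr_ge0.
have -> : \sum_i \sum_j (a i * b j - a j * b i) ^+ 2 =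
    \sum_i \sum_j (a i ^+ 2 * b j ^+ 2) + \sum_i \sum_j (b i ^+ 2 * a j ^+ 2)
    - 2 * \sum_i \sum_j ((a i * b i) * (a j * b j)).
  rewrite mulr_sumr -sumrN -!big_split/=; apply: eq_bigr => i _.
  rewrite mulr_sumr -sumrN -!big_split/=; apply: eq_bigr => j _; ring.
rewrite -!big_distrlr/= [_ * \sum_i a i ^+ 2]mulrC -expr2; lra.
Qed.

Lemma nsq_mulmx m n p (A : 'M[R]_(m, n)) (B : 'M[R]_(n, p)) :
  nsq (A *m B) <= nsq A * nsq B.
Proof.
rewrite /nsq mulr_suml; apply: ler_sum => i _.
rewrite [X in _ * X]exchange_big/= mulr_sumr; apply: ler_sum => j _.
by rewrite mxE; exact: sum_mul_sqr_le.
Qed.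
End SquaredFrobenius.

(** * A lattice net of the unit ball and the embedding it yields *)

Section Net.
Context {R : realType} (r : nat).

(* Lattice points of l1-norm at most 100 r; divided by 10 sqrt r they form a
   net of the unit ball of radius 1/10. *)
Definition grid := {ffun 'I_r -> bool * 'I_(100 * r).+1}.

Definition gridpt (f : grid) : 'rV[R]_r := \row_i ((-1) ^+ (f i).1 * (f i).2%:R).

Definition small_grid : {set grid} := [set f : grid | (\sum_i (f i).2 <= 100 * r)%N].

(** Counting by exponential weights: give a point of l1 norm k the weight 2^(100 r - k), which is at
    least 1 on the small grid. The weights factor over the coordinates, each contributing at most 4,
    so the count is at most 2^(102 r) = 8^(34 r). Base 9 matches the logarithm in the theorem. *)
Lemma card_small_grid : (#|small_grid| <= 9 ^ (34 * r))%N.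
Proof.
have h : (#|small_grid|%:R <= 2 ^+ (102 * r) :> R).
  apply: (@le_trans _ _ (\sum_(f : grid) 2 ^+ (100 * r) * \prod_i 2^-1 ^+ (f i).2)).
    rewrite -sum1_card natr_sum [leRHS](bigID (mem small_grid))/=.
    rewrite -[leLHS]addr0 lerD//; last first.
      by apply: sumr_ge0 => f _; rewrite mulr_ge0 ?exprn_ge0 ?prodr_ge0// => i _; rewrite exprn_ge0.
    apply: ler_sum => f; rewrite inE => hf.
    rewrite prodrXr exprVn ler_pdivlMr ?exprn_gt0// mul1r.
    by rewrite ler_eXn2l// ltr1n.
  rewrite -mulr_sumr.
  rewrite -(bigA_distr_bigA (fun (i : 'I_r) (u : bool * 'I_(100 * r).+1) => 2^-1 ^+ u.2))/=.
  rewrite prodr_const card_ord.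
  have hs : \sum_(u : bool * 'I_(100 * r).+1) (2^-1 : R) ^+ u.2 <= 4.
    rewrite -(pair_bigA _ (fun (b : bool) (k : 'I_(100 * r).+1) => (2^-1 : R) ^+ k))/=.
    rewrite big_bool/= -(big_mkord predT (fun k => (2^-1 : R) ^+ k)) big_mkord.
    have := geometric_le2 (x := 2^-1 : R) (100 * r).+1.
    rewrite invr_ge0 ler0n lexx => /(_ isT); lra.
  apply: (@le_trans _ _ (2 ^+ (100 * r) * 4 ^+ r)).
    rewrite ler_wpM2l ?exprn_ge0// lerXn2r ?nnegrE//.
    by apply: sumr_ge0 => u _; rewrite exprn_ge0.
  rewrite (_ : 4 = 2 ^+ 2 :> R); last by ring.
  by rewrite -exprM -exprD (_ : 100 * r + 2 * r = 102 * r)%N// -mulnDl.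
rewrite -(ler_nat R) (le_trans h)//.
rewrite (_ : 102 * r = 3 * (34 * r))%N; last by lia.
by rewrite natrX exprM lerXn2r ?nnegrE// -natrX ler_nat.
Qed.

(** Scale by q = 10 sqrt r and truncate every coordinate towards zero, which never increases its
    size. Integers satisfy k <= k^2, so the l1 norm of the lattice point is at most q^2 |x|^2 <= 100
    r. *)
Lemma grid_round (x : 'rV[R]_r) : (0 < r)%N -> nsq x <= 1 -> exists2 f, f \in small_grid &
  let z := (10 * Num.sqrt r%:R)^-1 *: gridpt f in
  forall i, (x - z) 0 i ^+ 2 <= (100 * r%:R)^-1 /\ z 0 i ^+ 2 <= x 0 i ^+ 2.
Proof.
move=> r0 x1; set q := 10 * Num.sqrt r%:R.
have rp : 0 < r%:R :> R by rewrite ltr0n.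
have q0 : 0 < q by rewrite mulr_gt0// sqrtr_gt0.
have qq : q ^+ 2 = 100 * r%:R.
  by rewrite exprMn sqr_sqrtr ?ltW//; ring.
pose k i := Num.truncn (q * `|x 0 i|).
have a0 i : 0 <= q * `|x 0 i| by rewrite mulr_ge0// ltW.
have kle i : (k i)%:R <= q * `|x 0 i|.
  by rewrite /k truncn_le.
have kgt i : q * `|x 0 i| < (k i)%:R + 1 by rewrite natr1 truncnS_gt.
have ksum : (\sum_i k i <= 100 * r)%N.
  rewrite -(ler_nat R) natr_sum natrM -qq.
  apply: (@le_trans _ _ (q ^+ 2 * nsq x)); last by rewrite ler_piMr ?sqr_ge0.
  rewrite /nsq big_ord1 mulr_sumr; apply: ler_sum => i _.
  rewrite -[x 0 i ^+ 2]real_normK ?num_real// -exprMn.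
  apply: (@le_trans _ _ ((k i)%:R ^+ 2)); last by rewrite lerXn2r ?nnegrE.
  by rewrite -natrX ler_nat expnS expn1; case: (k i) => // u; rewrite leq_pmulr.
have klt i : (k i < (100 * r).+1)%N.
  by rewrite ltnS (leq_trans _ ksum)// (bigD1 i)//= leq_addr.
exists [ffun i => (x 0 i < 0, Ordinal (klt i))].
  by rewrite inE; under eq_bigr do rewrite ffunE/=.
move=> z i; rewrite /z !mxE ffunE/=.
have sE : x 0 i = (-1) ^+ (x 0 i < 0)%R * `|x 0 i| by exact: numEsign.
set s := (-1) ^+ _ in sE *; set y := `|x 0 i| in sE *.
have ss : s ^+ 2 = 1 by rewrite /s sqrr_sign.
have ky : (k i)%:R / q <= y by rewrite ler_pdivrMr// mulrC.
have ky' : y - (k i)%:R / q <= q^-1.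
  rewrite lerBlDl -[X in _ + X]mul1r -mulrDl ler_pdivlMr// mulrC; apply/ltW; exact: kgt.
have k0 : 0 <= (k i)%:R / q by rewrite divr_ge0// ltW.
have -> : q^-1 * (s * (k i)%:R) = s * ((k i)%:R / q) by rewrite mulrCA [q^-1 * _]mulrC.
have E1 : (x 0 i - s * ((k i)%:R / q)) ^+ 2 = (y - (k i)%:R / q) ^+ 2.
  by rewrite sE -mulrBr exprMn ss mul1r.
have E2 : x 0 i ^+ 2 = y ^+ 2 by rewrite sE exprMn ss mul1r.
have y0 : 0 <= y by exact: normr_ge0.
rewrite E1 E2 exprMn ss mul1r -qq -exprVn.
by split; apply: lerXn2r; rewrite ?nnegrE ?invr_ge0 ?subr_ge0 ?(ltW q0).
Qed.

(** A vector differs from a net point by at most 1/10 in norm. On that difference the sketch is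
    controlled by its supremum over the unit ball, which must be bounded before the lower bound can
    be derived. *)
Lemma net_embedding N l (V : 'M[R]_(r, N)) (Om : 'M[R]_(N, l)) (e : 'rV[R]_r) (L : R) :
  (0 < r)%N -> 0 <= L ->
  V *m V^T = diag_mx e -> (forall i, e 0 i = 0 \/ e 0 i = 1) ->
  (forall f, f \in small_grid ->
     `|nsq (gridpt f *m V *m Om) - L * nsq (gridpt f *m V)| <=
       L / 10 * nsq (gridpt f *m V)) ->
  forall x : 'rV[R]_r, L / 2 * nsq (x *m V) <= nsq (x *m V *m Om).
Proof.
move=> r0 L0 VV e01 hgrid.
have nV (x : 'rV[R]_r) : nsq (x *m V) = \sum_i e 0 i * x 0 i ^+ 2.
  rewrite nsq_trace trmx_mul mulmxA -(mulmxA x) VV /mxtrace big_ord1 mul_mx_diag !mxE.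
  by apply: eq_bigr => i _; rewrite !mxE mulrAC mulrC expr2 mulrA.
(* Coordinates on zero rows of [V] are erased: [x *m V] does not change and |xe| = |x V|, so
   rounding may be applied to [xe]. *)
pose xe (x : 'rV[R]_r) : 'rV[R]_r := \row_i (e 0 i * x 0 i).
have ee i : e 0 i * e 0 i = e 0 i by case: (e01 i) => ->; rewrite ?mulr0 ?mulr1.
have e0 i : 0 <= e 0 i by case: (e01 i) => ->.
have e1 i : e 0 i <= 1 by case: (e01 i) => ->.
have xeV x : xe x *m V = x *m V.
  apply/eqP; rewrite -subr_eq0 -mulmxBl; apply/eqP.
  have n0 : nsq ((xe x - x) *m V) = 0.
    rewrite nV big1// => i _; rewrite !mxE.
    have -> : e 0 i * (e 0 i * x 0 i - x 0 i) ^+ 2 = (e 0 i * e 0 i - e 0 i) * (e 0 i * x 0 i - x 0 i) * x 0 i by ring.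
    by rewrite ee subrr !mul0r.
  apply/matrixP => i j; rewrite [RHS]mxE; apply/eqP; rewrite -sqrf_eq0.
  have h1 := psumr_eq0P (fun i _ => sumr_ge0 _ (fun j _ => sqr_ge0 _)) n0.
  by rewrite (psumr_eq0P (fun j _ => sqr_ge0 _) (h1 i isT)).
have round x : nsq (x *m V) <= 1 -> exists z : 'rV[R]_r,
   [/\ nsq (z *m V) <= 1, nsq ((xe x - z) *m V) <= 100^-1 &
     `|nsq (z *m V *m Om) - L * nsq (z *m V)| <= L / 10 * nsq (z *m V)].
  move=> xV1; have nx : nsq (xe x) = nsq (x *m V).
    rewrite nV /nsq big_ord1; apply: eq_bigr => i _.
    by rewrite !mxE exprMn expr2 ee.
  have xx1 : nsq (xe x) <= 1 by rewrite nx.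
  have [f fs hz] := grid_round r0 xx1; move: hz; set c := _^-1; set z := c *: _ => hz.
  exists z; split.
  - apply: le_trans xx1; rewrite nV /nsq big_ord1; apply: ler_sum => i _.
    apply: le_trans (hz i).2; rewrite ler_piMl ?sqr_ge0//.
  - rewrite nV; apply: (@le_trans _ _ (\sum_(i < r) (100 * r%:R)^-1)).
      apply: ler_sum => i _; apply: le_trans (hz i).1.
      by rewrite ler_piMl ?sqr_ge0.
    rewrite sumr_const card_ord invfM -[leLHS]mulr_natr divfK//.
    by rewrite pnatr_eq0 -lt0n.
  - rewrite /z -!scalemxAl !nsqZ mulrCA -mulrBr normrM (ger0_norm (sqr_ge0 c)).
    by rewrite [leRHS]mulrCA ler_wpM2l ?sqr_ge0// hgrid.
pose Q (x : 'rV[R]_r) := nsq (x *m V *m Om).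
pose A := [set y | exists2 x, nsq (x *m V) <= 1 & y = Q x]%classic.
have A0 : (A !=set0)%classic.
  by exists (Q 0), 0 => //; rewrite mul0mx -(scale0r 0) nsqZ expr0n mul0r.
have Aub : has_ubound A.
  exists (nsq Om) => _ [x x1 ->]; apply: le_trans (nsq_mulmx _ _) _.
  by rewrite ler_piMl ?nsq_ge0.
have supA : has_sup A by [].
pose S := sup A.
have QS x : nsq (x *m V) <= 1 -> Q x <= S.
  by move=> x1; apply: sup_upper_bound => //; exists x.
have QS' x : nsq (x *m V) <= 100^-1 -> Q x <= S / 100.
  move=> x1; have := QS (10 *: x).
  rewrite /Q -!scalemxAl !nsqZ => h; have := h _; lra.
have S0 : 0 <= S.
  apply: le_trans (QS 0 _); first exact: nsq_ge0.
  by rewrite mul0mx -(scale0r 0) nsqZ expr0n mul0r.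
have Qxe x : Q (xe x) = Q x by rewrite /Q xeV.
(* By homogeneity the rounding error costs at most S / 100, so the supremum bounds itself: S <= (121
   / 89) L. *)
have Sle : S <= 121 / 100 * L + 11 / 100 * S.
  apply: ge_sup => // _ [x x1 ->].
  have [z [z1 xz hz]] := round x x1.
  have h2 := QS' _ xz.
  have := nsqD_le (z *m V *m Om) ((xe x - z) *m V *m Om).
  rewrite -!mulmxDl addrC subrK xeV -/(Q x) -/(Q (xe x - z)) => h1.
  have := ler_norm (nsq (z *m V *m Om) - L * nsq (z *m V)) => h3.
  have : L * nsq (z *m V) <= L by rewrite ler_piMr.
  lra.
move=> x; wlog x1 : x / nsq (x *m V) = 1.
  move=> hw; have [x0|xn] := eqVneq (nsq (x *m V)) 0.
    by rewrite x0 mulr0 nsq_ge0.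
  have xp : 0 < nsq (x *m V) by rewrite lt_def xn nsq_ge0.
  set c := Num.sqrt (nsq (x *m V)).
  have cc : c ^+ 2 = nsq (x *m V) by rewrite sqr_sqrtr// ltW.
  have := hw (c^-1 *: x); rewrite -!scalemxAl !nsqZ exprVn cc mulVf// => /(_ erefl).
  by rewrite mulr1 ler_pdivlMl// mulrC.
rewrite x1 mulr1.
have x1' : nsq (x *m V) <= 1 by rewrite x1.
have [z [z1 xz hz]] := round x x1'.
have h2 := QS' _ xz.
have h3 : nsq (x *m V) <= 11 / 10 * nsq (z *m V) + 11 * nsq ((xe x - z) *m V).
  by have := nsqD_le (z *m V) ((xe x - z) *m V); rewrite -mulmxDl addrC subrK xeV.
have h4 : Q z <= 11 / 10 * Q x + 11 * Q (xe x - z).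
  have := nsqD_le (xe x *m V *m Om) (- ((xe x - z) *m V *m Om)).
  by rewrite nsqN -mulmxBl -mulmxBl opprB addrCA subrr addr0 xeV.
have h5 : - (L / 10 * nsq (z *m V)) <= Q z - L * nsq (z *m V).
  by rewrite -[leRHS]opprK lerN2 (le_trans _ hz)// -normrN ler_norm.
(* With 9/10 of L on the net this gives Q z >= 0.728 L; taking off 0.11 S <= 0.150 L and dividing by
   1.1 leaves 0.526 L, above L / 2. *)
have h6 : 89 / 110 <= nsq (z *m V) by rewrite x1 in h3; lra.
have h7 : L * (89 / 110) <= L * nsq (z *m V) by rewrite ler_wpM2l.
rewrite -/(Q x); lra.
Qed.
End Net.

(** * Singular values and the range finder *)
Section RealSpectral.
Context {R : rcfType}.

Definition dot n (x y : 'rV[R]_n) : R := (x *m y^T) 0 0.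

Lemma dotC n (x y : 'rV[R]_n) : dot x y = dot y x.
Proof. by rewrite /dot -[in RHS](trmxK (y *m x^T)) [RHS]mxE trmx_mul trmxK. Qed.

Lemma dotDl n (x y z : 'rV[R]_n) : dot (x + y) z = dot x z + dot y z.
Proof. by rewrite /dot mulmxDl mxE. Qed.

Lemma dotZl n c (x z : 'rV[R]_n) : dot (c *: x) z = c * dot x z.
Proof. by rewrite /dot -scalemxAl mxE. Qed.

Lemma dotNl n (x z : 'rV[R]_n) : dot (- x) z = - dot x z.
Proof. by rewrite -scaleN1r dotZl mulN1r. Qed.

Lemma dotvv n (x : 'rV[R]_n) : dot x x = nsq x.
Proof. by rewrite nsq_trace trace_mx11. Qed.

Lemma nsq_eq0 m n (A : 'M[R]_(m, n)) : nsq A = 0 -> A = 0.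
Proof.
move=> A0; apply/matrixP => i j; rewrite [RHS]mxE; apply/eqP; rewrite -sqrf_eq0.
have h := psumr_eq0P (fun i _ => sumr_ge0 _ (fun j _ => sqr_ge0 _)) A0.
by rewrite (psumr_eq0P (fun j _ => sqr_ge0 _) (h i isT)).
Qed.

(** An eigenvalue al + i be exists over the complex extension. Symmetry, applied to the real part u
    and imaginary part w of an eigenvector, forces be (|u|^2 + |w|^2) = 0; so the eigenvalue is real
    and whichever part is nonzero is a real eigenvector. *)
Lemma symmetric_eigenvector n (S : 'M[R]_n) : (0 < n)%N -> S^T = S ->
  exists a (u : 'rV[R]_n), u != 0 /\ u *m S = a *: u.
Proof.
move=> n0 Ssym; pose SC := map_mx (real_complex R) S.
have [a] : exists a : R[i], eigenvalue SC a.
  have /closed_rootP[a] : size (char_poly SC) != 1%N.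
    by rewrite size_char_poly; case: (n) n0.
  by rewrite -eigenvalue_root_char; exists a.
move=> /eigenvalueP[v vS vn0].
pose u := map_mx (@complex.Re R) v; pose w := map_mx (@complex.Im R) v.
pose al := complex.Re a; pose be := complex.Im a.
have ReD (x y : R[i]) : complex.Re (x + y) = complex.Re x + complex.Re y by case: x; case: y.
have ImD (x y : R[i]) : complex.Im (x + y) = complex.Im x + complex.Im y by case: x; case: y.
have uS : u *m S = al *: u - be *: w.
  apply/rowP => k; have /rowP/(_ k) := vS; rewrite !mxE => /(congr1 (@complex.Re R)).
  rewrite (big_morph _ ReD (erefl : complex.Re 0 = 0)).
  rewrite (eq_bigr (fun j => u 0 j * S j k)) => [->|j _]; last first.
    by rewrite !mxE; case: (v 0 j) => x y /=; rewrite mulr0 subr0.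
  by rewrite /al /be; case: (a) => a1 a2; case: (v 0 k).
have wS : w *m S = be *: u + al *: w.
  apply/rowP => k; have /rowP/(_ k) := vS; rewrite !mxE => /(congr1 (@complex.Im R)).
  rewrite (big_morph _ ImD (erefl : complex.Im 0 = 0)).
  rewrite (eq_bigr (fun j => w 0 j * S j k)) => [->|j _]; last first.
    by rewrite !mxE; case: (v 0 j) => x y /=; rewrite mulr0 add0r.
  by rewrite /al /be; case: (a) => a1 a2; case: (v 0 k) => x y /=; rewrite addrC.
have E : dot (u *m S) w = dot (w *m S) u.
  by rewrite [RHS]dotC /dot trmx_mul Ssym mulmxA.
have nz : nsq u + nsq w != 0.
  apply: contraNneq vn0 => e0.
  have hu : nsq u = 0 by have := nsq_ge0 u; have := nsq_ge0 w; lra.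
  have hw : nsq w = 0 by have := nsq_ge0 u; have := nsq_ge0 w; lra.
  apply/eqP/rowP => k; have /rowP/(_ k) := nsq_eq0 hu; have /rowP/(_ k) := nsq_eq0 hw.
  by rewrite !mxE; case: (v 0 k) => x y /= -> ->.
have b0 : be = 0.
  move: E; rewrite uS wS !dotDl dotNl !dotZl !dotvv [dot w u]dotC => E.
  have /eqP : be * (nsq u + nsq w) = 0 by lra.
  by rewrite mulf_eq0 (negPf nz) orbF => /eqP.
have {uS}uS : u *m S = al *: u by rewrite uS b0 scale0r subr0.
have {wS}wS : w *m S = al *: w by rewrite wS b0 scale0r add0r.
have [u0|un] := eqVneq u 0; last by exists al, u.
exists al, w; split=> //; apply: contraNneq nz => ->.
by rewrite u0 -(scale0r 0) !nsqZ expr0n !mul0r addr0.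
Qed.

Lemma unit_eigenvector n (S : 'M[R]_n) : (0 < n)%N -> S^T = S ->
  exists a (u : 'rV[R]_n), nsq u = 1 /\ u *m S = a *: u.
Proof.
move=> n0 /symmetric_eigenvector -/(_ n0)[a [u [un uS]]].
have up : 0 < nsq u.
  rewrite lt_def nsq_ge0 andbT; apply: contraNneq un.
  rewrite /nsq big_ord1 => u0; apply/eqP/rowP => k; rewrite mxE; apply/eqP.
  by rewrite -sqrf_eq0 (psumr_eq0P (fun j _ => sqr_ge0 _) u0).
exists a, ((Num.sqrt (nsq u))^-1 *: u); split.
  by rewrite nsqZ exprVn sqr_sqrtr ?nsq_ge0// mulVf ?gt_eqF.
by rewrite -scalemxAl uS !scalerA mulrC.
Qed.

(** The reflection in the hyperplane orthogonal to u - e exchanges two unit vectors. *)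
Lemma householder n (u e : 'rV[R]_n) : nsq u = 1 -> nsq e = 1 ->
  exists H : 'M[R]_n, [/\ H^T = H, H *m H = 1%:M & u *m H = e].
Proof.
move=> u1 e1; have [->|ue] := eqVneq u e.
  by exists 1%:M; rewrite trmx1 !mulmx1.
pose w := u - e.
have ww : dot w w = 2 - 2 * dot u e.
  by rewrite /w dotDl dotNl ![dot _ (u - e)]dotC !dotDl !dotNl !dotvv u1 e1 [dot e u]dotC; lra.
have uw : dot u w = 1 - dot u e by rewrite dotC dotDl dotNl dotvv u1 [dot e u]dotC.
have wn : dot w w != 0.
  apply: contraNneq ue; rewrite dotvv => /nsq_eq0/eqP; rewrite subr_eq0 => /eqP ->//.
have wwM : w *m w^T = (dot w w)%:M by rewrite [LHS]mx11_scalar.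
have uwe : u - w = e by rewrite /w opprB addrC subrK.
clearbody w.
set c := dot w w in ww wn wwM.
exists (1%:M - (2 / c) *: (w^T *m w)); split.
- by rewrite linearB linearZ/= trmx1 trmx_mul trmxK.
- rewrite mulmxBl mul1mx mulmxBr mulmx1 -scalemxAl -scalemxAr.
  rewrite mulmxA -(mulmxA w^T) wwM mul_mx_scalar -scalemxAl !scalerA.
  have -> : 2 / c * (2 / c * c) = 2 / c + 2 / c by field.
  by rewrite scalerDl opprB addrK subrK.
- rewrite mulmxBr mulmx1 -scalemxAr mulmxA [u *m w^T]mx11_scalar -/(dot u w).
  rewrite mul_scalar_mx scalerA (_ : 2 / c * dot u w = 1).
    by rewrite scale1r.
  by rewrite uw ww; field; rewrite -ww.
Qed.

(** Deflation: a reflection sends a unit eigenvector to the first basis vector, and symmetry then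
    makes the conjugated matrix block diagonal. *)
Lemma spectral_real n (S : 'M[R]_n) : S^T = S ->
  exists (O : 'M[R]_n) (D : 'rV[R]_n), O *m O^T = 1%:M /\ S = O^T *m diag_mx D *m O.
Proof.
elim: n S => [|n IHn] S Ssym.
  by exists 1%:M, 0; split; apply/matrixP => -[].
have [a [u [u1 uS]]] := unit_eigenvector (ltn0Sn n) Ssym.
pose e : 'rV[R]_(1 + n) := delta_mx 0 0.
have e1 : nsq e = 1.
  rewrite /nsq big_ord1 (bigD1 0)//= big1 ?addr0 => [|j j0]; first by rewrite mxE !eqxx expr1n.
  by rewrite mxE (negPf j0) andbF expr0n.
have [H [HT HH uH]] := householder u1 e1.
have eH : e *m H = u by rewrite -uH -mulmxA HH mulmx1.
pose M : 'M[R]_(1 + n) := H *m S *m H.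
have Msym : M^T = M by rewrite /M !trmx_mul HT Ssym mulmxA.
have eM : e *m M = a *: e by rewrite /M !mulmxA eH uS -scalemxAl uH.
have r0 : row 0 M = a *: e by rewrite rowE -/e.
have SM : S = H *m M *m H by rewrite /M !mulmxA HH mul1mx -mulmxA HH mulmx1.
clearbody M.
have ME : M = block_mx a%:M 0 0 (drsubmx M).
  rewrite -[LHS]submxK; congr block_mx.
  - apply/matrixP => i j; rewrite !ord1 [RHS]mxE; have /rowP/(_ 0) := r0.
    rewrite !mxE/= mulr1 mulr1n => <-; congr (M _ _); exact: val_inj.
  - apply/matrixP => i j; rewrite !ord1 [RHS]mxE; have /rowP/(_ (rshift 1 j)) := r0.
    rewrite !mxE/= mulr0 => <-; congr (M _ _); exact: val_inj.
  - apply/matrixP => i j; rewrite !ord1 [RHS]mxE; have /rowP/(_ (rshift 1 i)) := r0.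
    rewrite !mxE/= mulr0 => <-; rewrite -[in LHS]Msym mxE; congr (M _ _); exact: val_inj.
have Dsym : (drsubmx M)^T = drsubmx M by rewrite -{2}Msym; apply/matrixP => i j; rewrite !mxE.
have [U' [D' [UU' SE]]] := IHn _ Dsym.
pose B : 'M[R]_(1 + n) := block_mx 1%:M 0 0 U'.
have BB : B *m B^T = 1%:M.
  rewrite /B tr_block_mx mulmx_block !trmx0 trmx1 !mulmx0 !mul0mx !mulmx1 UU' ?addr0 ?add0r.
  by rewrite -scalar_mx_block.
pose D : 'rV[R]_(1 + n) := row_mx a%:M D'.
have DE : diag_mx D = block_mx a%:M 0 0 (diag_mx D').
  rewrite /D diag_mx_row; congr block_mx.
  by apply/matrixP => i j; rewrite !ord1 !mxE.
have MB : M = B^T *m diag_mx D *m B.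
  rewrite {1}ME SE DE /B tr_block_mx !mulmx_block !trmx0 trmx1.
  by rewrite !mulmx0 !mul0mx !addr0 !add0r !mul1mx !mulmx1 ?mul0mx.
exists (B *m H), D; split.
  by rewrite trmx_mul HT mulmxA -(mulmxA B) HH mulmx1.
by rewrite SM {1}MB trmx_mul HT !mulmxA.
Qed.

Lemma mup_prod_XsubC (s : seq R) x : mup x (\prod_(y <- s) ('X - y%:P)) = count_mem x s.
Proof.
elim: s => [|y s IHs]; first by rewrite big_nil mupNroot// root1.
rewrite big_cons mupM ?polyXsubC_eq0//; last first.
  by rewrite monic_neq0// monic_prod_XsubC.
by rewrite IHs -['X - _]expr1 mup_XsubCX/=; case: eqP.
Qed.

(** Compared by multiplicities: similarity makes the characteristic polynomial split over the
    entries of [D], so both lists contain a value as often as it is a root. *)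
Lemma real_eigenvalues_perm n (S O : 'M[R]_n) (D : 'rV[R]_n) :
  O *m O^T = 1%:M -> S = O^T *m diag_mx D *m O ->
  perm_eq (real_eigenvalues S) [tuple D 0 i | i < n].
Proof.
move=> OO SE; pose s := [tuple D 0 i | i < n].
have pE : char_poly S = \prod_(y <- s) ('X - y%:P).
  have -> : char_poly S = char_poly (diag_mx D).
    rewrite /char_poly.
    have -> : char_poly_mx S = map_mx polyC O^T *m char_poly_mx (diag_mx D) *m map_mx polyC O.
      rewrite /char_poly_mx mulmxBr mulmxBl SE !map_mxM/=; congr (_ - _).
      rewrite mul_mx_scalar -scalemxAl -map_mxM/=.
      by rewrite (mulmx1C OO) map_mx1 scalemx1.
    rewrite !det_mulmx mulrC mulrA -det_mulmx -map_mxM OO map_mx1 det1 mul1r//.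
  rewrite char_poly_trig ?diag_mx_is_trig// big_tuple.
  by apply: eq_bigr => i _; rewrite tnth_mktuple mxE eqxx mulr1n.
have p0 : char_poly S != 0 by rewrite pE monic_neq0// monic_prod_XsubC.
rewrite /real_eigenvalues; apply/allP => x _ /=; apply/eqP.
rewrite -[RHS]mup_prod_XsubC -[in RHS]pE count_flatten -map_comp sumnE big_map.
rewrite (eq_bigr (fun y => (y == x) * mup y (char_poly S))%N); last first.
  by move=> y _; rewrite /= count_nseq /=.
have [xr|xr] := boolP (x \in rootsR (char_poly S)).
  rewrite (bigD1_seq x)//= ?uniq_roots// eqxx mul1n big1 ?addn0// => y /negPf ->.
  by rewrite mul0n.
rewrite big_seq big1 => [|y yr]; last first.
  by case: eqP => [yx|]; rewrite ?mul0n// -yx yr in xr.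
rewrite mupNroot//; apply: contra xr => xr.
by have /(_ x) := roots_on_rootsR p0; rewrite in_itv/= xr.
Qed.

(** The permutation that sorts the spectrum is absorbed into the orthogonal matrix, so that the
    diagonal comes in the order of [sigma]. Singular values count from 1, hence the shift of the
    index. *)
Lemma spectral_sigma m n (A : 'M[R]_(m, n)) :
  exists (O : 'M[R]_m) (D : 'rV[R]_m), [/\ O *m O^T = 1%:M,
    A *m A^T = O^T *m diag_mx D *m O & forall i : 'I_m, sigma A i.+1 ^+ 2 = D 0 i].
Proof.
have Ssym : (A *m A^T)^T = A *m A^T by rewrite trmx_mul trmxK.
have [U [D [OO SE]]] := spectral_real Ssym.
have D0 i : 0 <= D 0 i.
  have : D 0 i = ((U *m A) *m (U *m A)^T) i i.
    rewrite trmx_mul mulmxA -(mulmxA U) SE !mulmxA OO mul1mx -mulmxA OO mulmx1.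
    by rewrite mxE eqxx.
  move=> ->; rewrite mxE sumr_ge0// => j _; rewrite [X in _ * X]mxE -expr2 sqr_ge0//.
have pe : perm_eq (singular_values A) [tuple Num.sqrt (D 0 i) | i < m].
  rewrite /singular_values perm_sort (perm_trans (perm_map _ (real_eigenvalues_perm OO SE)))//.
  by rewrite -map_comp/=.
have /tuple_permP[p pE] := pe.
have sD i : sigma A (val i).+1 ^+ 2 = D 0 (p i).
  rewrite /sigma /= pE (nth_map i) ?size_enum_ord// nth_ord_enum.
  by rewrite tnth_mktuple sqr_sqrtr.
pose D' : 'rV[R]_m := \row_i D 0 (p i).
have DE : diag_mx D' = perm_mx p *m diag_mx D *m (perm_mx p)^T.
  apply/matrixP => i j; rewrite -row_permE tr_perm_mx -col_permE !mxE.
  by rewrite (inj_eq perm_inj).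
have pp : (perm_mx p)^T *m perm_mx p = 1%:M :> 'M[R]_m.
  by rewrite tr_perm_mx -perm_mxM mulVg perm_mx1.
have pp' := mulmx1C pp.
exists (perm_mx p *m U), D'; split.
- by rewrite trmx_mul mulmxA -(mulmxA _ U) OO mulmx1.
- rewrite DE trmx_mul !mulmxA -(mulmxA _ _ (perm_mx p)) pp mulmx1.
  by rewrite -(mulmxA _ _ (perm_mx p)) pp mulmx1.
by move=> i; rewrite sD mxE.
Qed.
End RealSpectral.

(** * Deterministic error of the range finder *)

Section RangeFinder.
Context {R : rcfType}.

Lemma nsq_pythagoras m n k (Q : 'M[R]_(m, k)) (A : 'M[R]_(m, n)) : Q^T *m Q = 1%:M ->
  nsq A = nsq (A - Q *m Q^T *m A) + nsq (Q *m Q^T *m A).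
Proof.
move=> QQ; set B := Q *m Q^T *m A.
have AB : \tr (A *m B^T) = nsq B.
  pose Y := A *m A^T *m Q.
  have e1 : A *m B^T = Y *m Q^T by rewrite /B /Y !trmx_mul trmxK !mulmxA.
  have e2 : B *m B^T = Q *m (Q^T *m Y) *m Q^T by rewrite -[B *m _]mulmxA e1 !mulmxA.
  by rewrite nsq_trace e1 e2 mxtrace_mulC [RHS]mxtrace_mulC (mulmxA Q^T Q) QQ mul1mx.
have BA : \tr (B *m A^T) = nsq B by rewrite -AB -mxtrace_tr trmx_mul trmxK.
have -> : nsq (A - B) = nsq A - nsq B - (nsq B - nsq B).
  by rewrite [LHS]nsq_trace linearB/= mulmxBl !mulmxBr !linearB/= AB BA -!nsq_trace.
lra.
Qed.

Lemma nsq_proj_le m n k (Q : 'M[R]_(m, k)) (A : 'M[R]_(m, n)) : Q^T *m Q = 1%:M ->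
  nsq (Q *m Q^T *m A) <= nsq A /\ nsq (A - Q *m Q^T *m A) <= nsq A.
Proof.
move=> /nsq_pythagoras e; rewrite (e _ A).
by rewrite lerDl lerDr !nsq_ge0.
Qed.

Lemma nsq_rows m n (A : 'M[R]_(m, n)) : nsq A = \sum_i nsq (row i A).
Proof.
by apply: eq_bigr => i _; rewrite /nsq big_ord1; apply: eq_bigr => j _; rewrite mxE.
Qed.

Lemma nsq_add_orth m n (A B : 'M[R]_(m, n)) : A *m B^T = 0 -> nsq (A + B) = nsq A + nsq B.
Proof.
move=> AB; have BA : B *m A^T = 0 by rewrite -[LHS]trmxK trmx_mul trmxK AB trmx0.
by rewrite [LHS]nsq_trace linearD/= mulmxDl !mulmxDr AB BA add0r addr0 linearD/= -!nsq_trace.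
Qed.

(** [V], [e] and [X2] are chosen before the sketch, so concentration applies to fixed matrices. Let
    C be the projection I - Q Q^T. It kills A Om, so C X1 Om = - C X2 Om; the embedding bounds |C
    X1|^2 by 2 / L times |C X1 Om|^2, hence by 2 / L times |X2 Om|^2. The two parts of C A have
    orthogonal rows, so their squared norms add. *)
Lemma range_finder m n (r : nat) (A : 'M[R]_(m, n)) : (r <= m)%N ->
  exists (V : 'M[R]_(r, n)) (e : 'rV[R]_r) (X2 : 'M[R]_(m, n)),
  [/\ V *m V^T = diag_mx e, forall i, e 0 i = 0 \/ e 0 i = 1,
     nsq X2 = \sum_(r.+1 <= j < m.+1) sigma A j ^+ 2 &
     forall (l : nat) (Om : 'M[R]_(n, l)) (L : R), 0 < L ->
       (forall x : 'rV[R]_r, L / 2 * nsq (x *m V) <= nsq (x *m V *m Om)) ->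
       forall k (Q : 'M[R]_(m, k)) (U : 'M[R]_(k, l)), Q^T *m Q = 1%:M ->
         A *m Om = Q *m U ->
         nsq (A - Q *m Q^T *m A) <= nsq X2 + 2 / L * nsq (X2 *m Om)].
Proof.
move=> rm; have [F [D [OO SE sD]]] := spectral_sigma A.
have FF' := mulmx1C OO.
pose f := widen_ord rm.
have finj : injective f by move=> i j /(congr1 val)/= h; exact: val_inj.
pose G := F *m A.
have GG : G *m G^T = diag_mx D.
  by rewrite /G trmx_mul mulmxA -(mulmxA F) SE !mulmxA OO mul1mx -mulmxA OO mulmx1.
have AG : A = F^T *m G by rewrite /G mulmxA FF' mul1mx.
clearbody G.
have nG i : nsq (row i G) = D 0 i.
  have /matrixP/(_ i i) := GG; rewrite !mxE eqxx mulr1n => <-.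
  by rewrite /nsq big_ord1; apply: eq_bigr => j _; rewrite !mxE expr2.
have D0 i : 0 <= D 0 i by rewrite -nG nsq_ge0.
pose s (i : 'I_r) := Num.sqrt (D 0 (f i)).
(* Where [s i] is 0, the convention 0^-1 = 0 leaves a zero row, which [e] records; the rank may thus
   be smaller than [r]. *)
pose V : 'M[R]_(r, n) := \matrix_(i, j) ((s i)^-1 * G (f i) j).
pose e : 'rV[R]_r := \row_i (D 0 (f i) != 0)%:R.
pose W : 'M[R]_(m, r) := \matrix_(a, i) (F (f i) a * s i).
pose ind : 'rV[R]_m := \row_i (i < r)%:R.
pose X1 := F^T *m diag_mx ind *m G.
pose X2 := F^T *m diag_mx (const_mx 1 - ind) *m G.
have AX : A = X1 + X2.
  rewrite /X1 /X2 -mulmxDl -mulmxDr -linearD/= addrC subrK.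
  by rewrite (_ : diag_mx _ = 1%:M) ?mulmx1// -diag_const_mx.
have X12 : X1 *m X2^T = 0.
  rewrite /X1 /X2 !trmx_mul trmxK tr_diag_mx !mulmxA -(mulmxA _ G) GG.
  rewrite -(mulmxA _ (diag_mx ind)) mulmx_diag -(mulmxA _ (diag_mx _)) mulmx_diag.
  rewrite (_ : diag_mx _ = 0) ?mulmx0 ?mul0mx//.
  apply/matrixP => i j; rewrite !mxE.
  by case: (i < r)%N; rewrite ?mul0r ?mul0rn ?subrr ?mulr0 ?mul0rn.
have WV : X1 = W *m V.
  apply/matrixP => a b; rewrite /X1 mul_mx_diag !mxE.
  transitivity (\sum_(i < m | (i < r)%N) F i a * G i b).
    rewrite [RHS]big_mkcond/=; apply: eq_bigr => i _; rewrite !mxE.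
    by case: ifP => _; rewrite ?mulr1// mulr0 mul0r.
  rewrite (big_ord_narrow rm); apply: eq_bigr => i _; rewrite !mxE -/(f i).
  have [s0|sn] := eqVneq (s i) 0; last by field.
  have /nsq_eq0/rowP/(_ b) : nsq (row (f i) G) = 0.
    move/eqP: s0; rewrite sqrtr_eq0 => s0; rewrite nG; apply/eqP.
    by rewrite eq_le s0 D0.
  by rewrite [LHS]mxE mxE => ->; rewrite !mulr0.
exists V, e, X2; split.
- apply/matrixP => i j.
  have -> : (V *m V^T) i j = (s i)^-1 * (s j)^-1 * (G *m G^T) (f i) (f j).
    rewrite !mxE mulr_sumr; apply: eq_bigr => b _; rewrite !mxE; ring.
  rewrite GG !mxE (inj_eq finj).
  case: eqP => [<-|]; last by rewrite !mulr0n mulr0.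
  rewrite !mulr1n -invfM -expr2 sqr_sqrtr//.
  by have [->|n0] := eqVneq; rewrite ?mulr0// mulVf.
- by move=> i; rewrite mxE; case: (D 0 (f i) != 0); [right|left].
- rewrite big_add1 big_geq_mkord/=.
  have -> : nsq X2 = nsq (diag_mx (const_mx 1 - ind) *m G).
    rewrite /X2 -mulmxA; set Z := _ *m G.
    by rewrite !nsq_trace trmx_mul trmxK mulmxA mxtrace_mulC !mulmxA OO mul1mx.
  rewrite nsq_rows [RHS]big_mkcond/=; apply: eq_bigr => i _.
  rewrite sD -nG row_mul row_diag_mx -scalemxAl -rowE nsqZ !mxE.
  by case: ltnP => _; rewrite /= ?subrr ?expr0n ?mul0r// subr0 expr1n mul1r.
move=> l Om L L0 emb k Q U QQ AQ.
pose C (p : nat) (Z : 'M[R]_(m, p)) := Z - Q *m Q^T *m Z.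
have CD p (Y Z : 'M[R]_(m, p)) : C p (Y + Z) = C p Y + C p Z.
  by rewrite /C mulmxDr opprD addrACA.
have CM p q (Y : 'M[R]_(m, p)) (Z : 'M[R]_(p, q)) : C p Y *m Z = C q (Y *m Z).
  by rewrite /C mulmxBl -!mulmxA.
have Cle p (Z : 'M[R]_(m, p)) : nsq (C p Z) <= nsq Z by have [] := nsq_proj_le Z QQ.
have CA : C l (X1 *m Om) = - C l (X2 *m Om).
  apply/eqP; rewrite -addr_eq0 -CD -mulmxDl -AX AQ /C -!mulmxA (mulmxA Q^T) QQ mul1mx.
  by rewrite subrr.
rewrite -/(C n A) AX CD nsq_add_orth; last first.
  have CL p (Z : 'M[R]_(m, p)) : C p Z = (1%:M - Q *m Q^T) *m Z by rewrite mulmxBl mul1mx.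
  by rewrite !CL trmx_mul mulmxA -(mulmxA _ X1) X12 mulmx0 mul0mx.
rewrite addrC lerD//.
(* Since X1 = W V, every row of C X1 is a combination of the rows of [V], to which the embedding
   applies. *)
have h1 : L / 2 * nsq (C n X1) <= nsq (C n X1 *m Om).
  rewrite WV -CM [nsq (C r W *m V)]nsq_rows [nsq (C r W *m V *m Om)]nsq_rows mulr_sumr.
  by apply: ler_sum => i _; rewrite !row_mul; exact: emb.
have h2 : nsq (C n X1 *m Om) <= nsq (X2 *m Om) by rewrite CM CA nsqN.
have L2 : 0 < L / 2 by rewrite divr_gt0.
rewrite -(ler_pM2l L2); apply: le_trans h1 (le_trans h2 _).
by rewrite mulrA (_ : L / 2 * (2 / L) = 1) ?mul1r//; field; rewrite gt_eqF.
Qed.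
End RangeFinder.

(** * Mode products of tensors *)
Section MixedRadix.
Local Open Scope nat_scope.
Variables (c : pred nat) (r : nat -> nat).

(** A mixed-radix numeral with digits [u] and radices [r], in which the positions outside [c] are
    skipped. [colnum] skips one mode, and uniqueness of digits recovers the other coordinates from
    the column. *)
Definition radix_value (u : nat -> nat) t :=
  \sum_(0 <= j < t | c j) u j * \prod_(0 <= h < j | c h) r h.

Lemma radix_valueS u t : radix_value u t.+1 =
  radix_value u t + (if c t then u t * \prod_(0 <= h < t | c h) r h else 0).
Proof. by rewrite /radix_value big_mkcond big_nat_recr//= -big_mkcond. Qed.

Lemma radix_prodS t : \prod_(0 <= h < t.+1 | c h) r h =
  \prod_(0 <= h < t | c h) r h * (if c t then r t else 1).
Proof. by rewrite big_mkcond big_nat_recr//= -big_mkcond. Qed.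

Lemma radix_value_lt u t : (forall j, j < t -> c j -> u j < r j) ->
  radix_value u t < \prod_(0 <= h < t | c h) r h.
Proof.
elim: t => [_|t IHt ur]; first by rewrite /radix_value !big_geq.
have {}IHt := IHt (fun j jt => ur j (ltnW jt)).
rewrite radix_valueS radix_prodS; case: ifP => ct; last by rewrite addn0 muln1.
have := ur t (ltnSn t) ct; nia.
Qed.

Lemma radix_value_inj u v t : (forall j, j < t -> c j -> u j < r j) ->
  (forall j, j < t -> c j -> v j < r j) -> radix_value u t = radix_value v t ->
  forall j, j < t -> c j -> u j = v j.
Proof.
elim: t => // t IHt ur vr; rewrite !radix_valueS => E.
have ul := radix_value_lt (fun j jt => ur j (ltnW jt)).
have vl := radix_value_lt (fun j jt => vr j (ltnW jt)).
have [E1 E2] : radix_value u t = radix_value v t /\ (c t -> u t = v t).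
  move: E; case: ifP => ct; last by rewrite !addn0.
  rewrite addnC [RHS]addnC => E.
  have := edivn_eq (u t) ul; rewrite E edivn_eq//; by case=> -> ->.
move=> j; rewrite ltnS leq_eqVlt => /orP[/eqP -> //|jt cj].
exact: (IHt (fun j jt => ur j (ltnW jt)) (fun j jt => vr j (ltnW jt)) E1).
Qed.
End MixedRadix.

(** * Entrywise form of mode products and the telescoping error *)

Section TensorAlgebra.
Context {R : realType} {d : nat}.
Implicit Types (a b n : 'I_d -> nat) (i : 'I_d).

Let digit n (k : tindex n) (j : nat) : nat := if insub j is Some j' then k j' : nat else 0%N.
Let radix n (j : nat) : nat := if insub j is Some j' then n j' else 0%N.

Lemma colnumE n i (k : tindex n) : colnum i k = radix_value (fun j => j != i) (radix n) (digit k) d.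
Proof.
rewrite /radix_value big_mkord /colnum; apply: eq_bigr => j ji.
rewrite /digit valK; congr (_ * _)%N.
rewrite (big_nat_widen _ _ d)//; last exact/ltnW.
rewrite big_mkord; apply: eq_big => [h|h _]; first by rewrite andbC.
by rewrite /radix valK.
Qed.

Lemma ncolsE n i : ncols n i = (\prod_(0 <= h < d | h != i :> nat) radix n h)%N.
Proof. by rewrite big_mkord /ncols; apply: eq_bigr => j _; rewrite /radix valK. Qed.

Let digit_lt n (k : tindex n) j : (j < d)%N -> (digit k j < radix n j)%N.
Proof. by move=> jd; rewrite /digit /radix insubT ltn_ord. Qed.

Lemma colnum_lt n i (k : tindex n) : (colnum i k < ncols n i)%N.
Proof. by rewrite colnumE ncolsE; apply: radix_value_lt => j jd _; exact: digit_lt. Qed.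

Definition agree_off i a b (k : tindex a) (k' : tindex b) :=
  [forall j, (j != i) ==> (k j == k' j :> nat)].

Lemma ncols_eq a b i : (forall j, j != i -> a j = b j) -> ncols a i = ncols b i.
Proof. by move=> ab; apply: eq_bigr. Qed.

Lemma colnum_eq a b i (k : tindex a) (k' : tindex b) : (forall j, j != i -> a j = b j) ->
  (colnum i k == colnum i k') = agree_off i k k'.
Proof.
move=> ab; have rE j : (j < d)%N -> j != i -> radix a j = radix b j.
  by move=> jd ji; rewrite /radix insubT ab.
have E (u : nat -> nat) : radix_value (fun j => j != i) (radix a) u d =
    radix_value (fun j => j != i) (radix b) u d.
  rewrite /radix_value big_nat_cond [RHS]big_nat_cond; apply: eq_bigr => j /andP[/andP[_ jd] ji].
  congr (_ * _)%N; rewrite big_nat_cond [RHS]big_nat_cond.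
  by apply: eq_bigr => h /andP[/andP[_ hj] hi]; rewrite rE// (ltn_trans hj).
apply/eqP/forallP => [|h].
  rewrite !colnumE E => e j; apply/implyP => ji.
  have da j' : (j' < d)%N -> j' != i -> (digit k j' < radix b j')%N.
    by move=> jd j'i; rewrite -rE// digit_lt.
  have db j' : (j' < d)%N -> j' != i -> (digit k' j' < radix b j')%N.
    by move=> jd _; exact: digit_lt.
  have := radix_value_inj da db e (ltn_ord j) ji.
  by rewrite /digit !valK => ->.
rewrite !colnumE E /radix_value big_nat_cond [RHS]big_nat_cond.
apply: eq_bigr => j /andP[/andP[_ jd] ji]; congr (_ * _)%N.
by rewrite /digit insubT; have /implyP/(_ ji)/eqP := h (Sub j jd).
Qed.

(** Two multi-indices share a column exactly when they agree off mode [i], so column numbers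
    disappear from the formula. *)
Lemma mode_mulE a b i (A : 'M[R]_(b i, a i)) (X : tensor R a) (k : tindex b) :
  (forall j, j != i -> a j = b j) ->
  mode_mul A X k = \sum_(k' : tindex a | agree_off i k' k) A (k i) (k' i) * X k'.
Proof.
move=> ab; have cl : (colnum i k < ncols a i)%N by rewrite (ncols_eq ab) colnum_lt.
rewrite ffunE (big_pred1 (Ordinal cl))//.
rewrite mxE; under eq_bigr do rewrite mxE mulr_sumr.
rewrite (exchange_big_dep (fun k' : tindex a => agree_off i k' k))/=; last first.
  by move=> p k' _ /andP[_ /eqP h]; rewrite -colnum_eq// h.
apply: eq_bigr => k' h; rewrite (big_pred1 (k' i))// => p.
by rewrite eq_sym (_ : (colnum i k' == colnum i k)) ?andbT// colnum_eq.
Qed.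

Lemma tindex_eqP n (k k' : tindex n) : (forall j, k j = k' j :> nat) -> k = k'.
Proof. by move=> h; apply/ffunP => j; apply: val_inj; exact: h. Qed.

Lemma sqr_sum_pred1 (I : finType) (Q : pred I) (Z : I -> R) :
  (forall k k', Q k -> Q k' -> k = k') ->
  (\sum_(k | Q k) Z k) ^+ 2 = \sum_(k | Q k) Z k ^+ 2.
Proof.
move=> uQ; have [k0 Qk0|Q0] := pickP Q; last by rewrite !big_pred0// expr0n.
by rewrite !(big_pred1 k0)// => k; apply/idP/eqP => [Qk|->//]; exact: uQ.
Qed.

Let pos n i (k : tindex n) : 'I_(n i) * 'I_(ncols n i) :=
  (k i, Ordinal (colnum_lt i k)).

Lemma pos_inj n i : injective (@pos n i).
Proof.
move=> k k' [e c]; apply: tindex_eqP => j.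
have [->|ji] := eqVneq j i; first by rewrite e.
have : agree_off i k k' by rewrite -colnum_eq// c.
by move=> /forallP/(_ j)/implyP/(_ ji)/eqP.
Qed.

Lemma unfold_pos n i (X : tensor R n) k : unfold i X (pos i k).1 (pos i k).2 = X k.
Proof.
rewrite mxE (big_pred1 k)// => k'; apply/idP/eqP => [/andP[/eqP e /eqP c]|->]; last first.
  by rewrite !eqxx.
by apply: (@pos_inj n i); congr (_, _) => //; exact: val_inj.
Qed.

Lemma refold_pos n i (M : 'M[R]_(n i, ncols n i)) (k : tindex n) :
  refold (a := n) (b := n) M k = M (pos i k).1 (pos i k).2.
Proof. by rewrite ffunE (big_pred1 (pos i k).2). Qed.

Lemma nsq_unfold n i (Z : tensor R n) : nsq (unfold i Z) = \sum_k Z k ^+ 2.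
Proof.
rewrite /nsq pair_bigA/= [RHS](partition_big (@pos n i) predT)//=.
apply: eq_bigr => -[p c] _; rewrite mxE sqr_sum_pred1 => [|k k'].
  by apply: eq_bigl => k.
move=> /andP[/eqP e1 /eqP c1] /andP[/eqP e2 /eqP c2]; apply: (@pos_inj n i).
by congr (_, _); [rewrite e1 e2|apply: val_inj; rewrite /= c1 c2].
Qed.

(** Injectivity of [pos] gives an inequality; entries outside its image are dropped. *)
Lemma sum_refold_le n i (M : 'M[R]_(n i, ncols n i)) :
  \sum_k refold (a := n) (b := n) M k ^+ 2 <= nsq M.
Proof.
rewrite /nsq pair_bigA/= (partition_big (@pos n i) predT)//=.
apply: ler_sum => -[p c] _.
have [k0 /eqP pk0|Q0] := pickP (fun k : tindex n => pos i k == (p, c)); last first.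
  by rewrite big_pred0// sqr_ge0.
rewrite (big_pred1 k0) => [|k]; first by rewrite refold_pos pk0.
by rewrite -pk0 (inj_eq (@pos_inj n i)).
Qed.

(** With the projection P = Q Q^T, X - P Y is the orthogonal sum of X - P X and P (X - Y), and P
    does not increase the norm of X - Y. *)
Lemma sqnorm_sub_mode_mul n i m (Q : 'M[R]_(n i, m)) (X Y : tensor R n) :
  Q^T *m Q = 1%:M ->
  \sum_k (X k - mode_mul (a := n) (b := n) (Q *m Q^T) Y k) ^+ 2 <=
    nsq (unfold i X - Q *m Q^T *m unfold i X) + \sum_k (X k - Y k) ^+ 2.
Proof.
move=> QQ; pose Z : tensor R n := [ffun k => X k - Y k].
have -> : \sum_k (X k - Y k) ^+ 2 = nsq (unfold i Z).
  by rewrite nsq_unfold; apply: eq_bigr => k _; rewrite ffunE.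
have uZ : unfold i Z = unfold i X - unfold i Y.
  by apply/matrixP => p c; rewrite !mxE -sumrB; apply: eq_bigr => k _; rewrite ffunE.
pose M := unfold i X - Q *m Q^T *m unfold i Y.
apply: (@le_trans _ _ (nsq M)).
  apply: le_trans (sum_refold_le M); apply: ler_sum => k _.
  have MpE p c : M p c = unfold i X p c - (Q *m Q^T *m unfold i Y) p c.
    by rewrite /M mxE [X in _ + X]mxE.
  by rewrite /mode_mul !refold_pos MpE unfold_pos.
have ME : M - Q *m Q^T *m M = unfold i X - Q *m Q^T *m unfold i X.
  rewrite /M mulmxBr [in X in _ - X]mulmxA -(mulmxA Q _ (Q *m _)) (mulmxA _ Q) QQ mul1mx.
  by rewrite opprB addrA addrNK.
have MP : Q *m Q^T *m M = Q *m Q^T *m unfold i Z.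
  by rewrite /M uZ !mulmxBr [in X in _ - X]mulmxA -(mulmxA Q _ (Q *m _)) (mulmxA _ Q) QQ mul1mx.
rewrite (nsq_pythagoras M QQ) ME MP lerD2l.
by have [] := nsq_proj_le (unfold i Z) QQ.
Qed.

Lemma prod_sum_tindex (c : 'I_d -> nat) (F : forall j, 'I_(c j) -> R) :
  \prod_j \sum_m F j m = \sum_(k : tindex c) \prod_j F j (k j).
Proof.
pose T_ j : finType := 'I_(c j).
pose G (j : 'I_d) : {ffun T_ j -> R} := [ffun m => F j m].
transitivity (\prod_j \sum_(x in tagged_with T_ j) untag 0 (G j) x).
  apply: eq_bigr => j _.
  rewrite -(@big_tag R 0 +%R 'I_d T_ (fun i => G i) j).
  by apply: eq_bigr => m _; rewrite ffunE.
rewrite bigA_distr_big_dep -big_fprod.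
rewrite [RHS](reindex (@dffun_of_fprod _ T_))/=; last exact/onW_bij/dffun_of_fprod_bij.
by apply: eq_bigr => t _; apply: eq_bigr => j _; rewrite !ffunE.
Qed.

(* Entries at natural-number positions (0 out of range), so that casts of
   dimensions disappear. *)
Definition ent m1 m2 (A : 'M[R]_(m1, m2)) (p q : nat) : R :=
  \sum_(i < m1 | i == p :> nat) \sum_(j < m2 | j == q :> nat) A i j.

Lemma ent_val m1 m2 (A : 'M[R]_(m1, m2)) (p : 'I_m1) (q : 'I_m2) : ent A p q = A p q.
Proof. by rewrite /ent (big_pred1 p)// (big_pred1 q). Qed.

Lemma ent_castmx m1 m2 m1' m2' (e : (m1 = m1') * (m2 = m2')) (A : 'M[R]_(m1, m2)) p q :
  ent (castmx e A) p q = ent A p q.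
Proof. by case: e => e1 e2; case: m1' / e1; case: m2' / e2; rewrite castmx_id. Qed.

Definition agree_from (t : nat) a b (k : tindex a) (k' : tindex b) :=
  [forall j : 'I_d, (t <= j)%N ==> (k j == k' j :> nat)].

Lemma mode_muls_uptoE a b (A : forall i, 'M[R]_(b i, a i)) (X : tensor R a) t (td : (t <= d)%N)
    (k : tindex (stage a b t)) :
  mode_muls_upto A X td k =
  \sum_(k' : tindex a | agree_from t k' k)
     (\prod_(j < d | (j < t)%N) ent (A j) (k j) (k' j)) * X k'.
Proof.
elim: t td k => [|t IHt] td k.
  rewrite /= (big_pred1 (k : tindex a)) => [|k']; first by rewrite big_pred0// mul1r.
  apply/forallP/eqP => [h|->]; last by move=> j; rewrite eqxx implybT.
  by apply: tindex_eqP => j; have /implyP/(_ isT)/eqP := h j.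
rewrite [mode_muls_upto _ _ _]/=; set i := Ordinal td.
have nt (j : 'I_d) : j != i -> (j : nat) != t.
  by apply: contra => /eqP e; apply/eqP/val_inj.
have st j : j != i -> stage a b t j = stage a b t.+1 j.
  by move=> ji; rewrite /stage ltnS [(j <= t)%N]leq_eqVlt (negPf (nt _ ji)).
rewrite mode_mulE//.
under eq_bigr do rewrite IHt mulr_sumr.
rewrite (exchange_big_dep (fun k' : tindex a => agree_from t.+1 k' k))/=; last first.
  move=> k2 k' /forallP h1 /forallP h2; apply/forallP => j; apply/implyP => tj.
  have /implyP/(_ (ltnW tj))/eqP -> := h2 j.
  by apply: (implyP (h1 j)); rewrite -val_eqE/= gtn_eqF.
apply: eq_bigr => k' /forallP hk'.
have bnd j : ((if j == i then k' j : nat else k j) < stage a b t j)%N.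
  by case: eqP => [->|/eqP ji]; [rewrite /stage /= ltnn|rewrite st].
(* The only intermediate multi-index: at mode [i] it follows the input [k'], elsewhere the output
   [k]. *)
pose k0 : tindex (stage a b t) := [ffun j => Ordinal (bnd j)].
have k0E j : k0 j = (if j == i then k' j : nat else k j) :> nat by rewrite ffunE.
rewrite (big_pred1 k0) => [|k2].
  rewrite mulrA; congr (_ * _).
  rewrite [RHS](bigD1 i)//=; congr (_ * _).
    by rewrite -ent_val ent_castmx k0E eqxx.
  apply: eq_big => [j|j jt].
    by rewrite ltnS [RHS]andbC -val_eqE/= -ltn_neqAle.
  by rewrite k0E -val_eqE/= ltn_eqF.
apply/andP/eqP => [[/forallP h1 /forallP h2]|->].
  apply: tindex_eqP => j; rewrite k0E; case: eqP => [->|/eqP ji].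
    by have /implyP/(_ (leqnn _))/eqP := h2 i.
  by have /implyP/(_ ji)/eqP := h1 j.
split; apply/forallP => j; apply/implyP; rewrite k0E.
  by move=> /negPf ->.
move=> tj; have [_|ji] := eqVneq j i; first exact: eqxx.
apply: (implyP (hk' j)).
by rewrite ltn_neqAle tj andbT eq_sym nt.
Qed.

Lemma mode_mulsE a b (A : forall i, 'M[R]_(b i, a i)) (X : tensor R a) (k : tindex b) :
  mode_muls A X k = \sum_(k' : tindex a) (\prod_j A j (k j) (k' j)) * X k'.
Proof.
have sE j : stage a b d j = b j by rewrite /stage ltn_ord.
have bnd j : (k j < stage a b d j)%N by rewrite sE.
pose k0 : tindex (stage a b d) := [ffun j => Ordinal (bnd j)].
have k0E j : k0 j = k j :> nat by rewrite ffunE.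
rewrite ffunE (big_pred1 k0) => [|k2]; last first.
  apply/forallP/eqP => [h|->]; last by move=> j; rewrite k0E.
  by apply: tindex_eqP => j; rewrite k0E; apply/eqP.
rewrite mode_muls_uptoE; apply: eq_big => [k'|k' _].
  by apply/forallP => j; rewrite leqNgt ltn_ord.
congr (_ * _); apply: eq_big => [j|j _]; first by rewrite ltn_ord.
by rewrite k0E ent_val.
Qed.

(* The tensor after projecting along the modes below t only: the error of the
   full projection telescopes along t, orthogonally. *)
Let hybrid n (P : forall i, 'M[R]_(n i)) (X : tensor R n) t : tensor R n :=
  [ffun k => \sum_(k' : tindex n | agree_from t k' k)
     (\prod_(j < d | (j < t)%N) P j (k j) (k' j)) * X k'].

Lemma hybrid0 n P (X : tensor R n) : hybrid P X 0 = X.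
Proof.
apply/ffunP => k; rewrite ffunE (big_pred1 k) => [|k']; first by rewrite big_pred0// mul1r.
apply/forallP/eqP => [h|->]; last by move=> j; rewrite eqxx implybT.
by apply: tindex_eqP => j; have /implyP/(_ isT)/eqP := h j.
Qed.

Lemma hybridS n P (X : tensor R n) t (td : (t < d)%N) :
  hybrid P X t.+1 = mode_mul (a := n) (b := n) (P (Ordinal td)) (hybrid P X t).
Proof.
set i := Ordinal td; apply/ffunP => k; rewrite mode_mulE// ffunE.
have nt (j : 'I_d) : j != i -> (j : nat) != t.
  by apply: contra => /eqP e; apply/eqP/val_inj.
under [RHS]eq_bigr do rewrite ffunE mulr_sumr.
rewrite [RHS](exchange_big_dep (fun k' : tindex n => agree_from t.+1 k' k))/=; last first.
  move=> k2 k' /forallP h1 /forallP h2; apply/forallP => j; apply/implyP => tj.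
  have /implyP/(_ (ltnW tj))/eqP -> := h2 j.
  by apply: (implyP (h1 j)); rewrite -val_eqE/= gtn_eqF.
apply: eq_bigr => k' /forallP hk'.
pose k0 : tindex n := [ffun j => if j == i then k' j else k j].
have k0E j : k0 j = (if j == i then k' j else k j) by rewrite ffunE.
rewrite [RHS](big_pred1 k0) => [|k2].
  rewrite mulrA; congr (_ * _).
  rewrite [LHS](bigD1 i)//=; congr (_ * _); first by rewrite k0E eqxx.
  apply: eq_big => [j|j /andP[jt ji]].
    by rewrite ltnS andbC -val_eqE/= -ltn_neqAle.
  by rewrite k0E (negPf ji).
apply/andP/eqP => [[/forallP h1 /forallP h2]|->].
  apply: tindex_eqP => j; rewrite k0E; case: eqP => [->|/eqP ji].
    by have /implyP/(_ (leqnn _))/eqP := h2 i.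
  by have /implyP/(_ ji)/eqP := h1 j.
split; apply/forallP => j; apply/implyP; rewrite k0E.
  by move=> /negPf ->.
move=> tj; have [_|ji] := eqVneq j i; first exact: eqxx.
apply: (implyP (hk' j)).
by rewrite ltn_neqAle tj andbT eq_sym nt.
Qed.

Lemma frob_projection_error n (m : 'I_d -> nat) (Q : forall i, 'M[R]_(n i, m i)) (X : tensor R n) :
  (forall i, (Q i)^T *m Q i = 1%:M) ->
  frob (X - mode_muls Q (mode_muls (fun i => (Q i)^T) X)) ^+ 2 <=
    \sum_i nsq (unfold i X - Q i *m (Q i)^T *m unfold i X).
Proof.
move=> QQ; rewrite sqr_sqrtr; last by apply: sumr_ge0 => k _; exact: sqr_ge0.
pose P i := Q i *m (Q i)^T.
have -> : mode_muls Q (mode_muls (fun i => (Q i)^T) X) = hybrid P X d.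
  apply/ffunP => k; rewrite mode_mulsE ffunE.
  under eq_bigr do rewrite mode_mulsE mulr_sumr.
  rewrite exchange_big/=; apply: eq_big => [k'|k' _].
    by apply/esym/forallP => j; rewrite leqNgt ltn_ord.
  (* Distributivity sums out the core index, which merges the two rounds of products into the
     projections [P j]. *)
  transitivity ((\prod_j \sum_x Q j (k j) x * (Q j)^T x (k' j)) * X k').
    rewrite prod_sum_tindex mulr_suml; apply: eq_bigr => x _.
    by rewrite mulrA -big_split.
  congr (_ * _); apply: eq_big => [j|j _]; first by rewrite ltn_ord.
  by rewrite mxE.
have h t : (t <= d)%N -> \sum_k (X k - hybrid P X t k) ^+ 2 <=
    \sum_(i < d | (i < t)%N) nsq (unfold i X - Q i *m (Q i)^T *m unfold i X).
  elim: t => [_|t IHt td].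
    rewrite hybrid0 big1 => [|k _]; last by rewrite subrr expr0n.
    by rewrite sumr_ge0// => i _; exact: nsq_ge0.
  rewrite (hybridS P X td); apply: le_trans (sqnorm_sub_mode_mul _ _ (QQ (Ordinal td))) _.
  rewrite [leRHS](bigD1 (Ordinal td))//= lerD2l; apply: le_trans (IHt (ltnW td)) _.
  rewrite le_eqVlt; apply/orP; left; apply/eqP; apply: eq_bigl => j.
  by rewrite ltnS [RHS]andbC -val_eqE/= -ltn_neqAle.
under eq_bigr do rewrite !ffunE.
have := h d (leqnn d); under [X in X <= _]eq_bigr do rewrite ffunE.
move=> /le_trans; apply; rewrite le_eqVlt; apply/orP; left; apply/eqP.
by apply: eq_bigl => j; rewrite ltn_ord.
Qed.
End TensorAlgebra.

(** * The error of one mode and of all modes *)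
Section Union.
Local Open Scope classical_set_scope.
Context {R : realType} {disp : measure_display} {T : measurableType disp}.
Variable P : probability T R.

(** [G] may be non-measurable, as it will quantify over all factorizations; only the exceptional
    event is measured. *)
Definition fails_with_prob (eps : R) (G : T -> Prop) : Prop :=
  exists E, [/\ measurable E, (P E <= eps%:E)%E & forall w, ~ E w -> G w].

Lemma fails_with_probW (e e' : R) (G G' : T -> Prop) : e <= e' -> (forall w, G w -> G' w) ->
  fails_with_prob e G -> fails_with_prob e' G'.
Proof.
move=> ee GG [E [mE PE h]]; exists E; split=> // [|w /h/GG//].
by rewrite (le_trans PE)// lee_fin.
Qed.

Lemma fails_with_probI (e e' : R) (G G' : T -> Prop) :
  fails_with_prob e G -> fails_with_prob e' G' ->
  fails_with_prob (e + e') (fun w => G w /\ G' w).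
Proof.
move=> [E [mE PE h]] [E' [mE' PE' h']]; exists (E `|` E'); split.
- exact: measurableU.
- by apply: le_trans (measureU2 _ mE mE') _; rewrite EFinD leeD.
- by move=> w nE; split; [apply: h|apply: h'] => Ew; apply: nE; [left|right].
Qed.

Lemma union_bound (J : eqType) (s : seq J) (e : R) (G : J -> T -> Prop) :
  (forall j, j \in s -> fails_with_prob e (G j)) ->
  fails_with_prob (e *+ size s) (fun w => forall j, j \in s -> G j w).
Proof.
elim: s => [_|j s IHs h].
  by exists set0; split=> //; rewrite measure0.
have h1 := h j (mem_head _ _).
have h2 := IHs (fun i si => h i (mem_behead (s := j :: s) si)).
apply: fails_with_probW (fails_with_probI h1 h2) => [|w [Gj Gs] i]; first by rewrite mulrS.
by rewrite inE => /orP[/eqP ->|/Gs].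
Qed.

Lemma fails_holds (e : R) (G : T -> Prop) : fails_with_prob e G ->
  holds_with_prob P (1 - e) [set w | G w].
Proof.
move=> [E [mE PE h]]; exists (~` E); split=> //; first exact: measurableC.
rewrite probability_setC//.
have PEf : P E = (fine (P E))%:E by rewrite fineK// fin_num_measure.
by move: PE; rewrite PEf -EFinB !lee_fin => PE; rewrite lerB.
Qed.

(** The sketch of one mode reads a subfamily of the entries drawn; sets at positions outside the
    image of [g] do not matter, and the whole line is put there. Both algorithms enter through this
    lemma. *)
Lemma independent_reindex (I I' : finType) (X : I' -> {RV P >-> R}) (g : I -> I') :
  injective g -> mutually_independent X -> independent_family P (fun q => X (g q) : T -> R).
Proof.
move=> gI ind B mB; pose B' q' := if [pick q | g q == q'] is Some q then B q else setT.
have B'E q : B' (g q) = B q.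
  rewrite /B'; case: pickP => [q' /eqP/gI -> //|/(_ q)].
  by rewrite eqxx.
have mB' q' : measurable (B' q') by rewrite /B'; case: pickP.
have := ind (g @: [set: I])%SET B' mB'.
rewrite big_imset/=; last by move=> q q' _ _; exact: gI.
rewrite (eq_bigl predT) => [|q]; last by rewrite finset.in_setT.
under eq_bigr do rewrite B'E.
move=> <-; congr (P _); apply/seteqP; split=> w /= h q.
  by move=> /imsetP[q0 _ ->]; rewrite B'E.
by rewrite -B'E; apply: h; apply: imset_f; rewrite finset.in_setT.
Qed.
End Union.

(** Twice the successor of the floor of x / 2 lies between x and x + 2, and x + 2 <= 2 x. *)
Lemma even_ceil {R : realType} (x : R) : 2 <= x ->
  exists p, [/\ (0 < p)%N, ~~ odd p, x <= p%:R & p%:R <= 2 * x].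
Proof.
move=> x2; exists (2 * (Num.truncn (x / 2)).+1)%N; split.
- by rewrite muln_gt0.
- by rewrite mul2n odd_double.
- have : x / 2 < (Num.truncn (x / 2)).+1%:R by exact: truncnS_gt.
  by rewrite natrM; lra.
- have : (Num.truncn (x / 2))%:R <= x / 2 by rewrite truncn_le// divr_ge0//; lra.
  rewrite natrM (_ : (Num.truncn (x / 2)).+1%:R = (Num.truncn (x / 2))%:R + 1) ?natr1//; lra.
Qed.

Lemma mulmx_castmx {R : pzRingType} q n1 n2 l (e : n1 = n2) (A : 'M[R]_(q, n2)) (B : 'M[R]_(n1, l)) :
  A *m castmx (e, erefl) B = castmx (erefl, esym e) A *m B.
Proof. by case: n2 / e A => A; rewrite !castmx_id. Qed.

Lemma nsq_castmx {R : realFieldType} m n m' n' (e : (m = m') * (n = n')) (A : 'M[R]_(m, n)) :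
  nsq (castmx e A) = nsq A.
Proof. by case: e => e1 e2; case: m' / e1; case: n' / e2; rewrite castmx_id. Qed.

Section SketchConcentration.
Local Open Scope classical_set_scope.
Context {R : realType} {disp : measure_display} {T : measurableType disp}.
Variable P : probability T R.
Context {d : nat} (n : 'I_d -> nat) (l : nat) (i : 'I_d).
Variable W : forall j : 'I_d, 'I_(n j) -> 'I_l -> T -> R.
Arguments W : clear implicits.
Variable sg : R.

(** The entries feeding one sketch, common to both algorithms. Mode [i] is excluded, as [krp_draw]
    constrains no matrix at that place. *)
Definition mode_vars : finType := {x : {j : 'I_d | j != i} & ('I_(n (val x)) * 'I_l)%type}.
Definition mode_family (q : mode_vars) : T -> R :=
  W (val (tag q)) (tagged q).1 (tagged q).2.

Hypothesis sg1 : 1 <= 4 * expR 1 * sg.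
Hypothesis indW : independent_family P mode_family.
Hypothesis momW : forall j a b k, j != i -> rintegrable P (fun w => W j a b w ^+ k).
Hypothesis sgW : forall j a b, j != i -> subgaussian_moments P sg (W j a b).

Let c := 4 * expR 1 * sg.

Definition sketch_mx w : 'M[R]_(ncols n i, l) :=
  castmx (krp_rows_other n i, erefl)
    (krp (fun j => \matrix_(a, b) W j a b w : 'M[R]_(n j, l)) (other_modes i)).

Lemma size_other_modes : size (other_modes i) = d.-1.
Proof.
rewrite size_rev size_filter; have := count_predC (pred1 i) (enum 'I_d).
by rewrite size_enum_ord count_uniq_mem ?enum_uniq// mem_enum add1n => /(congr1 predn) /= <-.
Qed.

Lemma sketch_concentration q (a : 'M[R]_(q, ncols n i)) (m p : nat) :
  d = m.+2 -> (0 < p)%N -> ~~ odd p -> (0 < l)%N ->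
  let x := Num.max (Num.sqrt (p%:R * l%:R)) (p%:R ^+ m.+1) in
  fails_with_prob P (expR (- p%:R)) (fun w =>
    `|nsq (a *m sketch_mx w) - l%:R * nsq a| <=
      expR 1 * (expR 1 * (2 * expR 1 * (4 * c) ^+ m.+1) * x) * nsq a).
Proof.
move=> dm p0 pe l0 x.
have sg0 : 0 < sg.
  by have := lt_le_trans ltr01 sg1; rewrite pmulr_rgt0// mulr_gt0// expR_gt0.
pose s := other_modes i.
have ss j : j \in s -> j != i by rewrite mem_rev mem_filter => /andP[].
have us : uniq s by rewrite rev_uniq filter_uniq// enum_uniq.
pose md (q : mode_vars) : 'I_d := val (tag q).
pose rw (q : mode_vars) : nat := (tagged q).1.
pose cl (q : mode_vars) : 'I_l := (tagged q).2.
have hA (b : 'I_l) j (a0 : 'I_(n j)) : j \in s ->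
    palg mode_family (entry_at md rw cl j a0 b) (W j a0 b).
  move=> /ss ji; pose q0 : mode_vars := existT (fun x : {j : 'I_d | j != i} => ('I_(n (val x)) * 'I_l)%type) (exist _ j ji) (a0, b).
  by apply: (palgV mode_family (q := q0)); rewrite /entry_at /md /rw /cl/= !eqxx.
have momV q0 k : rintegrable P (fun w => mode_family q0 w ^+ k).
  by apply: momW; exact: (valP (tag q0)).
have ctl (b : 'I_l) := krp_controlled indW momV sg0 us (hA b) (fun j a0 js => sgW a0 b (ss j js)).
have sm : size s = m.+1 by rewrite size_other_modes dm.
rewrite sm in ctl.
pose e := krp_rows_other n i.
pose a' : 'M[R]_(q, krp_rows n s) := castmx (erefl, esym e) a.
pose om (b : 'I_l) (x : 'I_(krp_rows n s)) w := krp (fun j => \matrix_(a, b) W j a b w : 'M[R]_(n j, l)) s x b.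
have dis (b b' : 'I_l) q0 : b != b' -> (md q0 \in s) && (cl q0 == b) -> ~~ ((md q0 \in s) && (cl q0 == b')).
  by move=> bb' /andP[_ /eqP ->]; rewrite negb_and bb' orbT.
have [E [mE PE h]] := krp_concentration indW momV (fun (j : 'I_q) x => a' j x) sg1 p0 pe l0 dis ctl.
exists E; split=> // w /h.
have -> : \sum_b qform (fun j x => a' j x) (om b ^~ w) = nsq (a *m sketch_mx w).
  have -> : a *m sketch_mx w = a' *m krp (fun j => \matrix_(a, b) W j a b w : 'M[R]_(n j, l)) s.
    by rewrite /sketch_mx mulmx_castmx.
  rewrite /nsq [RHS]exchange_big/=; apply: eq_bigr => b _; apply: eq_bigr => j _.
  by rewrite mxE.
have -> : sqnorm (fun j x => a' j x) = nsq a.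
  by rewrite -[RHS](nsq_castmx (erefl, esym e)).
by [].
Qed.
End SketchConcentration.

(** * Numerical constants of the two deviation bounds *)

Section Constants.
Context {R : realType}.
Implicit Types (E c L lR : R).

(** With d = m + 2, p <= 2 L gives x <= 2^d max(sqrt(L l), L^d), and 2 E^3 (4 c)^(d-1) <= (8 E^3
    c)^d; the two together give the base 16 E^3 c of Gamma. *)
Lemma upper_deviation E c L lR (m p : nat) : 1 <= E -> 1 <= c -> 2 <= L -> 0 < lR ->
  p%:R <= 2 * L ->
  E * (E * (2 * E * (4 * c) ^+ m.+1) * Num.max (Num.sqrt (p%:R * lR)) (p%:R ^+ m.+1)) <=
  lR * ((16 * E ^+ 3 * c) ^+ m.+2 *
    Num.max (Num.sqrt L / Num.sqrt lR) (L ^+ m.+2 / lR)).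
Proof.
move=> E1 c1 L2 l0 pL.
have E0 : 0 < E by lra.
have L0 : 0 < L by lra.
set x := Num.max (Num.sqrt (p%:R * lR)) _.
pose M := Num.max (Num.sqrt (L * lR)) (L ^+ m.+2).
have sl0 : 0 < Num.sqrt lR by rewrite sqrtr_gt0.
have -> : lR * ((16 * E ^+ 3 * c) ^+ m.+2 * Num.max (Num.sqrt L / Num.sqrt lR) (L ^+ m.+2 / lR)) =
    (16 * E ^+ 3 * c) ^+ m.+2 * M.
  rewrite mulrCA; congr (_ * _); rewrite /M maxr_pMr ?(ltW l0)//; congr Num.max.
    rewrite sqrtrM ?(ltW L0)// -{1}(sqr_sqrtr (ltW l0)) expr2.
    by rewrite mulrCA -mulrA mulfV ?mulr1 ?gt_eqF.
  by rewrite mulrC divfK// gt_eqF.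
have M0 : 0 <= M by rewrite /M le_max sqrtr_ge0.
have xM : x <= 2 ^+ m.+2 * M.
  rewrite /x ge_max; apply/andP; split.
    apply: (@le_trans _ _ (2 * Num.sqrt (L * lR))).
      rewrite -[2 * _]ger0_norm ?mulr_ge0 ?sqrtr_ge0// -sqrtr_sqr ler_wsqrtr//.
      rewrite exprMn sqr_sqrtr ?mulr_ge0 ?(ltW L0) ?(ltW l0)// mulrA ler_wpM2r ?(ltW l0)//.
      by apply: le_trans pL _; nra.
    apply: ler_pM; rewrite ?sqrtr_ge0 ?ler0n//; last by rewrite le_max lexx.
    by rewrite exprS ler_peMr// exprn_ege1// ler1n.
  apply: (@le_trans _ _ ((2 * L) ^+ m.+1)); first by rewrite lerXn2r ?nnegrE//; lra.
  apply: (@le_trans _ _ ((2 * L) ^+ m.+2)); first by rewrite ler_weXn2l//; lra.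
  by rewrite exprMn ler_wpM2l ?exprn_ge0// le_max lexx orbT.
have k0 : 0 <= 2 * E ^+ 3 * (4 * c) ^+ m.+1.
  by rewrite !mulr_ge0 ?exprn_ge0 ?mulr_ge0//; lra.
have -> : E * (E * (2 * E * (4 * c) ^+ m.+1) * x) = 2 * E ^+ 3 * (4 * c) ^+ m.+1 * x by ring.
apply: le_trans (ler_wpM2l k0 xM) _; rewrite mulrA ler_wpM2r//.
have -> : 16 * E ^+ 3 * c = 2 * (8 * E ^+ 3 * c) by ring.
have E3 : 1 <= E ^+ 3 by rewrite exprn_ege1.
rewrite [leRHS]exprMn [leLHS]mulrC; apply: ler_wpM2l; first exact: exprn_ge0.
rewrite [leRHS]exprS.
have h4 : 4 * c <= 8 * E ^+ 3 * c by nra.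
have c0 : 0 <= 4 * c by lra.
apply: ler_pM; first by lra.
- exact: exprn_ge0.
- by nra.
- by rewrite lerXn2r ?nnegrE// (le_trans c0).
Qed.

(* 68 = 2 * 34: the net has at most 9^(34 r) points, and the moment order
   is rounded up to an even number, at most doubling it. *)
Lemma lower_deviation E c lam lR (m p : nat) : 1 <= E -> 1 <= c -> 2 <= lam ->
  p%:R <= 68 * lam -> (68 * (80 * E ^+ 3 * c) ^+ 2) ^+ m.+2 * lam ^+ m.+2 <= lR ->
  E * (E * (2 * E * (4 * c) ^+ m.+1) * Num.max (Num.sqrt (p%:R * lR)) (p%:R ^+ m.+1)) <=
  lR / 10.
Proof.
move=> E1 c1 L2 pL hl; set x := Num.max _ _.
(* Ten times the deviation constant, so that the goal reads A x <= lR. The square-root term of [x]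
   needs A^2 p <= lR, which is why the sketch size carries a square. *)
pose A := 20 * E ^+ 3 * (4 * c) ^+ m.+1.
have E3 : 1 <= E ^+ 3 by rewrite exprn_ege1.
have A1 : 1 <= A.
  have : 1 <= (4 * c) ^+ m.+1 by rewrite exprn_ege1//; lra.
  rewrite /A; nra.
have A0 : 0 <= A by lra.
have AB : A <= (80 * E ^+ 3 * c) ^+ m.+2.
  apply: (@le_trans _ _ ((80 * E ^+ 3 * c) ^+ m.+1)); last by rewrite ler_weXn2l//; nra.
  have -> : 80 * E ^+ 3 * c = 20 * E ^+ 3 * (4 * c) by ring.
  rewrite /A [leRHS]exprMn; apply: ler_wpM2r; first by rewrite exprn_ge0//; lra.
  by rewrite [leRHS]exprS ler_peMr ?exprn_ege1//; lra.
have A2 : A ^+ 2 * (68 * lam) ^+ m.+2 <= lR.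
  apply: le_trans hl; move: AB; move: (80 * _ * c) => B AB.
  rewrite -[leRHS]exprMn (_ : 68 * B ^+ 2 * lam = B ^+ 2 * (68 * lam)); last by ring.
  rewrite [leRHS]exprMn; apply: ler_wpM2r; first by rewrite exprn_ge0//; lra.
  by rewrite -exprM mulnC exprM lerXn2r ?nnegrE// (le_trans A0).
have l68 : 1 <= 68 * lam by lra.
have l0 : 0 <= lR by apply: le_trans A2; rewrite mulr_ge0 ?sqr_ge0 ?exprn_ge0//; lra.
have x1 : A * x <= lR.
  rewrite /x maxr_pMr// ge_max; apply/andP; split.
    rewrite -[A]ger0_norm// -sqrtr_sqr -sqrtrM ?sqr_ge0//.
    rewrite -[leRHS]ger0_norm// -sqrtr_sqr ler_wsqrtr// mulrA expr2 ler_wpM2r//.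
    apply: le_trans A2; rewrite ler_wpM2l ?sqr_ge0//.
    apply: le_trans pL _; rewrite exprS ler_peMr ?exprn_ege1//; lra.
  apply: le_trans A2; apply: ler_pM; rewrite ?exprn_ge0//.
    by rewrite expr2 ler_peMr.
  apply: (@le_trans _ _ ((68 * lam) ^+ m.+1)); last by rewrite ler_weXn2l.
  by rewrite lerXn2r ?nnegrE//; lra.
have -> : E * (E * (2 * E * (4 * c) ^+ m.+1) * x) = A * x / 10 by rewrite /A; field.
lra.
Qed.
End Constants.

Section ModeBound.
Local Open Scope classical_set_scope.
Context {R : realType} {disp : measure_display} {T : measurableType disp}.
Variable P : probability T R.
Context {d : nat} (n : 'I_d -> nat) (l : nat) (i : 'I_d).
Variable W : forall j : 'I_d, 'I_(n j) -> 'I_l -> T -> R.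
Arguments W : clear implicits.
Variable sg : R.
Hypothesis sg1 : 1 <= 4 * expR 1 * sg.
Hypothesis indW : independent_family P (mode_family (i := i) W).
Hypothesis momW : forall j a b k, j != i -> rintegrable P (fun w => W j a b w ^+ k).
Hypothesis sgW : forall j a b, j != i -> subgaussian_moments P sg (W j a b).

Let c := 4 * expR 1 * sg.

(** The failure probability delta / d is halved: one half for the upper bound on |X2 Omega|^2, at a
    moment order near L, the other for the embedding on the net, at an order near [Lam]. *)
Lemma mode_bound (m r : nat) (X : tensor R n) (delta : R) : d = m.+2 -> (1 <= r <= n i)%N ->
  0 < delta -> delta <= 2 * d%:R * expR (- 2) ->
  (68 * (80 * expR 1 ^+ 3 * c) ^+ 2) ^+ d * ln (2 * d%:R * 9 ^+ r / delta) ^+ d <= l%:R ->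
  fails_with_prob P (delta / d%:R) (fun w =>
    forall k (Q : 'M[R]_(n i, k)) (U : 'M[R]_(k, l)), Q^T *m Q = 1%:M ->
      sketch i X (fun j => \matrix_(a, b) W j a b w) = Q *m U ->
      nsq (unfold i X - Q *m Q^T *m unfold i X) <=
      (1 + 2 * (1 + Gamma d (16 * expR 1 ^+ 3 * c) delta l)) *
        \sum_(r.+1 <= j < (n i).+1) sigma (unfold i X) j ^+ 2).
Proof.
move=> dm /andP[r1 rn] de0 de2 hl.
have E1 : 1 <= expR 1 :> R by have := expR_ge1Dx (1 : R); lra.
have d0 : 0 < d%:R :> R by rewrite ltr0n dm.
pose y := 2 * d%:R / delta.
have y0 : 0 < y by rewrite divr_gt0// mulr_gt0.
pose L := ln y.
(* The bound delta <= 2 d exp(-2) enters here; [even_ceil] needs it. *)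
have L2 : 2 <= L.
  rewrite /L -[2]expRK ler_ln ?posrE ?expR_gt0// /y ler_pdivlMr//.
  by rewrite -ler_pdivlMl ?expR_gt0// mulrC -expRN.
have expL : expR (- L) = delta / (2 * d%:R) by rewrite expRN lnK ?posrE// /y invf_div.
have nine (k : nat) : 2 * d%:R * 9 ^+ k / delta = y * 9 ^+ k by rewrite /y mulrAC.
have lnk k : ln (y * 9 ^+ k) = L + k%:R * ln 9.
  by rewrite lnM ?posrE ?exprn_gt0// lnXn// mulr_natl.
have ln9 : 0 <= ln 9 :> R by rewrite ln_ge0// ler1n.
pose lam := ln (2 * d%:R * 9 ^+ r / delta).
have lamE : lam = L + r%:R * ln 9 by rewrite /lam nine lnk.
have lam2 : 2 <= lam by rewrite lamE (le_trans L2)// lerDl mulr_ge0.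
(* The extra term pays for the union bound over the net: 9^(34 r) exp(-Lam) = exp(-L) = delta / (2
   d). *)
pose Lam := L + (34 * r)%:R * ln 9.
have Lam2 : 2 <= Lam by rewrite /Lam (le_trans L2)// lerDl mulr_ge0.
have Lamlam : Lam <= 34 * lam.
  by rewrite /Lam lamE natrM -mulrA; lra.
have c0 : 0 < c := lt_le_trans ltr01 sg1.
have lp : 0 < l%:R :> R.
  apply: lt_le_trans hl; rewrite mulr_gt0// exprn_gt0//; last by rewrite -/lam; lra.
  by rewrite mulr_gt0// exprn_gt0// mulr_gt0// mulr_gt0// exprn_gt0// expR_gt0.
have l0 : (0 < l)%N by rewrite -(ltr0n R).
have [V [e [X2 [VV e01 nX2 rf]]]] := range_finder (unfold i X) rn.
have [p1 [p10 p1e p1L p1L']] := even_ceil L2.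
have [p2 [p20 p2e p2L p2L']] := even_ceil Lam2.
have H1 := sketch_concentration sg1 indW momW sgW X2 dm p10 p1e l0.
have H2 : forall f, f \in enum (small_grid r) ->
    fails_with_prob P (expR (- p2%:R)) (fun w =>
    `|nsq (gridpt f *m V *m sketch_mx i W w) - l%:R * nsq (gridpt f *m V)| <=
      l%:R / 10 * nsq (gridpt f *m V)).
  move=> f _; apply: fails_with_probW (lexx _) _
    (sketch_concentration sg1 indW momW sgW (gridpt f *m V) dm p20 p2e l0) => w.
  move=> /le_trans; apply; rewrite ler_wpM2r ?nsq_ge0//.
  rewrite (lower_deviation E1 sg1 lam2)//; last by rewrite -dm.
  by apply: le_trans p2L' _; lra.
apply: fails_with_probW (fails_with_probI H1 (union_bound H2)) => [|w [h1 h2] k Q U QQ YQ].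
  have -> : delta / d%:R = delta / (2 * d%:R) + delta / (2 * d%:R) by field; rewrite !gt_eqF.
  apply: lerD; first by rewrite -expL ler_expR lerN2.
  rewrite -cardE -[leLHS]mulr_natl.
  have hc : (#|small_grid r|%:R <= 9 ^+ (34 * r) :> R).
    by rewrite -natrX ler_nat card_small_grid.
  have he : expR (- p2%:R) <= expR (- Lam) by rewrite ler_expR lerN2.
  apply: le_trans (ler_pM _ _ hc he) _; rewrite ?expR_ge0//.
  have k9 : 0 < 9 ^+ (34 * r) :> R by rewrite exprn_gt0.
  rewrite /Lam -lnk expRN lnK ?posrE; last exact: mulr_gt0.
  by rewrite invfM mulrCA mulfV ?gt_eqF// mulr1 /y invf_div.
have emb := net_embedding r1 (ltW lp) VV e01 (Om := sketch_mx i W w)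
  (fun f fs => h2 f (etrans (mem_enum _ _) fs)).
have := rf _ (sketch_mx i W w) _ lp emb _ Q U QQ YQ.
move=> /le_trans; apply; rewrite -nX2.
have N0 := nsq_ge0 X2.
have := upper_deviation m E1 sg1 L2 lp p1L'.
rewrite -dm -/c -/(Gamma d _ delta l) => G2.
have h3 : nsq (X2 *m sketch_mx i W w) <=
    l%:R * (1 + Gamma d (16 * expR 1 ^+ 3 * c) delta l) * nsq X2.
  rewrite mulrDr mulr1 mulrDl -lerBlDl.
  by apply: le_trans (ler_norm _) (le_trans h1 _); rewrite ler_wpM2r.
(* The embedding factor 2 / l cancels the mean growth l of |X2 Omega|^2, leaving 2 (1 + Gamma). *)
have k0 : 0 <= 2 / l%:R :> R by rewrite divr_ge0.
move: (Gamma _ _ _ _) h3 => G h3; move: (ler_wpM2l k0 h3).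
have -> : 2 / l%:R * (l%:R * (1 + G) * nsq X2) = 2 * (1 + G) * nsq X2.
  by rewrite !mulrA divfK ?gt_eqF.
by move=> h4; rewrite [leRHS]mulrDl mul1r lerD2l.
Qed.
End ModeBound.

Section Error.
Local Open Scope classical_set_scope.
Context {R : realType} {disp : measure_display} {T : measurableType disp}.
Variable P : probability T R.
Context {d : nat} (n l : 'I_d -> nat).

Lemma rhosvd_error (X : tensor R n) (Xhat : T -> tensor R n)
    (Om : T -> forall i j, 'M[R]_(n j, l i)) (delta : R) (b : 'I_d -> R) :
  (0 < d)%N ->
  (forall i, fails_with_prob P (delta / d%:R) (fun w =>
    forall k (Q : 'M[R]_(n i, k)) (U : 'M[R]_(k, l i)), Q^T *m Q = 1%:M ->
      sketch i X (Om w i) = Q *m U ->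
      nsq (unfold i X - Q *m Q^T *m unfold i X) <= b i)) ->
  (forall w, rhosvd_output X (Om w) (Xhat w)) ->
  holds_with_prob P (1 - delta) [set w | frob (X - Xhat w) ^+ 2 <= \sum_i b i].
Proof.
move=> d0 hb hX; apply: fails_holds.
have hb' i : i \in enum 'I_d -> _ := fun=> hb i.
apply: fails_with_probW (union_bound hb') => [|w hw].
  by rewrite size_enum_ord -[leLHS]mulr_natr divfK// pnatr_eq0 -lt0n.
have [Q [U [qr ->]]] := hX w.
apply: le_trans (frob_projection_error (Q := Q) X _) _.
  by move=> i; case: (qr i).
apply: ler_sum => i _; have [QQ _ YQ] := qr i.
by apply: hw QQ YQ; rewrite mem_enum.
Qed.

Section Modes.
Variables (K : R) (m : nat).
Hypotheses (K1 : 1 <= K) (dm : d = m.+2).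
Let c : R := 4 * expR 1 * (16 * K ^+ 2).
Let C1 : R := 68 * (80 * expR 1 ^+ 3 * c) ^+ 2.
Let C2 : R := 16 * expR 1 ^+ 3 * c.

Lemma sketch_mode_bound (l0 r : nat) (i : 'I_d)
    (W : forall j, 'I_(n j) -> 'I_l0 -> {RV P >-> R}) (X : tensor R n) (delta : R) :
  (forall j a b, j != i -> sketch_entry K (W j a b)) ->
  independent_family P (mode_family (i := i) (fun j a b => W j a b : T -> R)) ->
  (1 <= r <= n i)%N -> 0 < delta -> delta <= 2 * d%:R * expR (- 2) ->
  C1 ^+ d * ln (2 * d%:R * 9 ^+ r / delta) ^+ d <= l0%:R ->
  fails_with_prob P (delta / d%:R) (fun w =>
    forall k (Q : 'M[R]_(n i, k)) (U : 'M[R]_(k, l0)), Q^T *m Q = 1%:M ->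
      sketch i X (fun j => random_mx (W j) w) = Q *m U ->
      nsq (unfold i X - Q *m Q^T *m unfold i X) <=
      (1 + 2 * (1 + Gamma d C2 delta l0)) *
        \sum_(r.+1 <= j < (n i).+1) sigma (unfold i X) j ^+ 2).
Proof.
move=> hW ind r1 de0 de2 hl.
have sg1 : 1 <= 4 * expR 1 * (16 * K ^+ 2).
  have E1 : 1 <= expR 1 :> R by have := expR_ge1Dx (1 : R); lra.
  have K2 : 1 <= K ^+ 2 by rewrite exprn_ege1.
  nra.
apply: (mode_bound (W := fun j a b => W j a b) sg1 ind _ _ X dm r1 de0 de2 hl).
- by move=> j a b k ji; case: (sketch_entry_moments K1 (hW j a b ji)).
- by move=> j a b ji; case: (sketch_entry_moments K1 (hW j a b ji)).
Qed.
End Modes.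
End Error.

Theorem theorem5p1 (R : realType) (K : R) (hK : 1 <= K) :
  exists C C' : nat -> R,
    (forall i, 0 < C i /\ 0 < C' i) /\
    forall (d : nat) (n r l : 'I_d -> nat) (X : tensor R n) (delta : R)
      (disp : measure_display) (T : measurableType disp) (P : probability T R)
      (Xhat : T -> tensor R n),
      (2 <= d)%N ->
      (forall i, (1 <= r i <= n i)%N) ->
      rhosvd_krp P K r l X Xhat \/ rhosvd_krp_memo P K l X Xhat ->
      0 < delta <= Num.min 1 (2 * d%:R * expR (- 2)) ->
      (forall i : 'I_d,
         C i ^+ d * ln (2 * d%:R * 9 ^+ r i / delta) ^+ d <= (l i)%:R) ->
      holds_with_prob P (1 - delta)
        [set w |
          frob (X - Xhat w) ^+ 2 <=
          \sum_(i < d) (1 + 2 * (1 + Gamma d (C' i) delta (l i))) *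
            \sum_((r i).+1 <= j < (n i).+1) sigma (unfold i X) j ^+ 2]%classic.
Proof.
have c0 : 0 < 4 * expR 1 * (16 * K ^+ 2) :> R.
  by rewrite !mulr_gt0 ?expR_gt0 ?exprn_gt0//; lra.
(* Both sequences are constant in the mode: they are the constants of [mode_bound] for the
   sub-Gaussian proxy 16 K^2. *)
exists (fun=> 68 * (80 * expR 1 ^+ 3 * (4 * expR 1 * (16 * K ^+ 2))) ^+ 2).
exists (fun=> 16 * expR 1 ^+ 3 * (4 * expR 1 * (16 * K ^+ 2))); split.
  by move=> _; split; repeat (apply: mulr_gt0 || apply: exprn_gt0 || apply: expR_gt0) => //; lra.
move=> d n r l X delta disp T P Xhat d2 hr alg /andP[de0]; rewrite le_min => /andP[_ de2] hl.
have [m dm] : exists m, d = m.+2 by exists d.-2; lia.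
case: alg => [[_ [W [_ [hW ind] out]]]|[l0 [W [lE [hW ind] out]]]].
  apply: rhosvd_error out => [|i]; first by rewrite dm.
  apply: (sketch_mode_bound hK dm) => //; first by move=> j a b; exact: hW.
  pose g (x : mode_vars n (l i) i) : krp_entry n l :=
    existT _ (exist _ (i, val (tag x)) (valP (tag x))) (tagged x).
  have gI : injective g.
    move=> [[j ji] x] [[j' ji'] x']/= E.
    have /= jj := congr1 (fun y : krp_entry n l => (val (tag y)).2) E.
    case: j' / jj ji' x' E => ji' x' E.
    have /= Ej := bool_irrelevance ji ji'; case: ji' / Ej x' E => x' E.
    by have := eq_from_Tagged E => /= ->.
  exact: (independent_reindex gI ind).
apply: rhosvd_error out => [|i]; first by rewrite dm.
have := hl i; rewrite lE => hli.
apply: (sketch_mode_bound hK dm) => //.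
pose g (x : mode_vars n l0 i) : {j : 'I_d & ('I_(n j) * 'I_l0)%type} :=
  existT _ (val (tag x)) (tagged x).
have gI : injective g.
  move=> [[j ji] x] [[j' ji'] x']/= E.
  have /= jj := congr1 tag E.
  case: j' / jj ji' x' E => ji' x' E.
  have /= Ej := bool_irrelevance ji ji'; case: ji' / Ej x' E => x' E.
  by have := eq_from_Tagged E => /= ->.
exact: (independent_reindex gI ind).
Qed.
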